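(* Consider the shifting problem $\max\{c\,\overline{x} : x\in S^n\}$, where $S\subseteq\{0,1\}^d$ is the independence system of (indicator vectors of) matchings in a given graph $G$ with $d$ edges and $c\in\mathbb{Z}^{d\times n}$. Then: \begin{enumerate} \item For bipartite graphs $G$ and shifted $c$ (that is, $c=\overline{c}$), the problem is polynomial time solvable for all $n$. \item For cubic graphs $G$, the problem is NP-hard already for shifted $c$ ($c=\overline{c}$) and $n=2$. \item For bipartite graphs $G$ and arbitrary $c$, the problem is NP-hard already for $n=2$. \end{enumerate}
   Context: For $S\subseteq\{0,1\}^d$, $S^n$ is the set of $d\times n$ matrices all of whose columns lie in $S$. The shift $\overline{x}$ of $x\in\mathbb{R}^{d\times n}$ is the unique matrix obtained from $x$ by permuting the entries within each row so that each row is nonincreasing. A matrix $x$ is shifted if $x=\overline{x}$. For $c,x\in\mathbb{R}^{d\times n}$, $cx:=\sum_{i,j}c_{i,j}x_{i,j}$. The input of the problem consists of $G$, $n$ and $c$ (with $n$ fixed to $2$ in parts 2 and 3). A set $S\subseteq\{0,1\}^d$ is an independence system if $0\in S$ and $u\le v\in S$, $u\in\{0,1\}^d$ imply $u\in S$. A graph is cubic if each vertex has degree $3$. *)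

(* Defs.v *)
From mathcomp Require Import all_boot all_order all_fingroup all_algebra.

Set Implicit Arguments.
Unset Strict Implicit.
Unset Printing Implicit Defensive.

Import Order.TTheory GRing.Theory Num.Theory.
Local Open Scope ring_scope.

(** * Polynomial time *)

Notation word := (seq bool).

(* Deterministic multi-tape Turing machines.  A tape cell holds a bit, one of
   finitely many additional work symbols, or a blank (None). *)
Inductive move := MoveL | MoveN | MoveR.

Definition cell (A : finType) : finType := option (bool + A)%type.

Record tm := TM {
  tm_tapes : nat; (* the machine has tm_tapes.+1 tapes *)
  tm_state : finType;
  tm_work : finType;
  tm_start : tm_state;
  (* None: the machine halts *)
  tm_trans : tm_state -> {ffun 'I_tm_tapes.+1 -> cell tm_work} ->
    option (tm_state * {ffun 'I_tm_tapes.+1 -> cell tm_work * move})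
}.

(* A two-way infinite tape as a zipper: the first component is the part to the
   left of the head, read leftwards; the second one starts at the scanned cell.
   All cells beyond the two sequences are blank. *)
Definition tape (A : finType) := (seq (cell A) * seq (cell A))%type.

Definition tape_read (A : finType) (t : tape A) : cell A := head None t.2.

Definition tape_act (A : finType) (am : cell A * move) (t : tape A) : tape A :=
  let r := am.1 :: behead t.2 in
  match am.2 with
  | MoveL => (behead t.1, head None t.1 :: r)
  | MoveN => (t.1, r)
  | MoveR => (am.1 :: t.1, behead r)
  end.

Definition config (M : tm) :=
  (tm_state M * {ffun 'I_(tm_tapes M).+1 -> tape (tm_work M)})%type.

Definition tm_next (M : tm) (x : config M) :
    option (tm_state M * {ffun 'I_(tm_tapes M).+1 -> cell (tm_work M) * move}) :=
  tm_trans x.1 [ffun i => tape_read (x.2 i)].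

Definition tm_halted (M : tm) (x : config M) : bool := ~~ isSome (tm_next x).

Definition tm_step (M : tm) (x : config M) : config M :=
  if tm_next x is Some (q, a) then (q, [ffun i => tape_act (a i) (x.2 i)])
  else x.

(* The input is on tape 0, with the head on its first bit. *)
Definition tm_init (M : tm) (w : word) : config M :=
  (tm_start M, [ffun i =>
    if i == ord0 then ([::], [seq Some (inl b) | b <- w]) else ([::], [::])]).

Fixpoint read_bits (A : finType) (s : seq (cell A)) : word :=
  if s is Some (inl b) :: s' then b :: read_bits s' else [::].

(* The output is the maximal block of bits on tape 0 starting at the head. *)
Definition tm_output (M : tm) (x : config M) : word := read_bits (x.2 ord0).2.

Definition computes_within (M : tm) (t : nat) (w v : word) : Prop :=
  let x := iter t (@tm_step M) (tm_init M w) in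
  tm_halted x /\ tm_output x = v.

(* Every polynomial in m with natural coefficients is dominated by one of
   these. *)
Definition poly_bound (k m : nat) : nat := (k * m.+1 ^ k)%N.

Definition polytime (f : word -> word) : Prop :=
  exists (M : tm) (k : nat), forall w : word,
    computes_within M (poly_bound k (size w)) w (f w).

(** * Encodings by words; all of them are prefix-free codes *)

Definition enc_word (w : word) : word :=
  flatten [seq [:: true; b] | b <- w] ++ [:: false].

(* Binary digits, least significant first; up_log 2 n.+1 is their number. *)
Definition bits (n : nat) : word :=
  mkseq (fun i => odd (n %/ 2 ^ i)) (up_log 2 n.+1).

Definition enc_nat (n : nat) : word := enc_word (bits n).

Definition enc_unary (n : nat) : word := nseq n true ++ [:: false].

Definition enc_int (z : int) : word := (z < 0) :: enc_nat `|z|%N.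

Definition enc_seq (T : Type) (enc : T -> word) (s : seq T) : word :=
  flatten [seq true :: enc x | x <- s] ++ [:: false].

(* Entries listed row by row. *)
Definition enc_mx (d n : nat) (x : 'M[int]_(d, n)) : word :=
  enc_seq enc_int [seq x i j | i <- enum 'I_d, j <- enum 'I_n].

(** * NP and NP-hardness *)

Definition in_NP (L : word -> Prop) : Prop :=
  exists (V : word -> word) (k : nat), polytime V /\
    forall w : word, L w <->
      exists2 u : word, (size u <= poly_bound k (size w))%N &
                        V (enc_word w ++ u) = [:: true].

(* Karp (polynomial time many-one) hardness of a decision problem with instance
   set P, instance encoding enc and set of yes-instances yes.  Reductions are
   required to produce instances in P only. *)
Definition NP_hard (I : Type) (P : I -> Prop) (enc : I -> word)
    (yes : I -> Prop) : Prop :=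
  forall L : word -> Prop, in_NP L ->
    exists2 f : word -> word, polytime f &
      forall w : word, exists2 i : I, P i & f w = enc i /\ (L w <-> yes i).

(** * Maximization problems *)

Record max_problem := MaxProblem {
  inst : Type;
  sol : inst -> Type;
  feasible : forall i : inst, sol i -> Prop;
  value : forall i : inst, sol i -> int;
  enc_inst : inst -> word;
  enc_sol : forall i : inst, sol i -> word
}.

Definition optimal (Q : max_problem) (i : inst Q) (x : sol i) : Prop :=
  feasible x /\ forall y : sol i, feasible y -> value y <= value x.

(* Some polynomial time machine outputs an optimal solution on each instance in
   the class P. *)
Definition polytime_solvable (Q : max_problem) (P : inst Q -> Prop) : Prop :=
  exists (M : tm) (k : nat), forall i : inst Q, P i ->
    exists2 x : sol i, optimal x &
      computes_within M (poly_bound k (size (enc_inst i)))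
        (enc_inst i) (enc_sol x).

(* A maximization problem is NP-hard on the class P if its decision version is:
   given an instance in P and an integer t, is there a feasible solution of
   value at least t? *)
Definition NP_hard_max (Q : max_problem) (P : inst Q -> Prop) : Prop :=
  NP_hard (fun it : inst Q * int => P it.1)
          (fun it => enc_inst it.1 ++ enc_int it.2)
          (fun it => exists2 x : sol it.1, feasible x & it.2 <= value x).

(** * Graphs and matchings *)

(* Finite simple graphs with numbered vertices and edges.  The edge {u, v} with
   u < v is represented by the pair (u, v). *)
Record graph := Graph {
  nv : nat;
  ne : nat;
  edge : ne.-tuple ('I_nv * 'I_nv);
  edge_lt : all (fun e : 'I_nv * 'I_nv => (e.1 < e.2)%N) edge;
  edge_uniq : uniq edge
}.

Definition incident (G : graph) (v : 'I_(nv G)) (i : 'I_(ne G)) : bool :=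
  (v == (tnth (edge G) i).1) || (v == (tnth (edge G) i).2).

Definition degree (G : graph) (v : 'I_(nv G)) : nat := #|[set i | incident v i]|.

Definition cubic (G : graph) : Prop := forall v : 'I_(nv G), degree v = 3%N.

Definition bipartite (G : graph) : Prop :=
  exists side : 'I_(nv G) -> bool, forall i : 'I_(ne G),
    side (tnth (edge G) i).1 != side (tnth (edge G) i).2.

Definition matching (G : graph) (A : {set 'I_(ne G)}) : Prop :=
  forall i j : 'I_(ne G), i \in A -> j \in A -> i != j ->
    forall v : 'I_(nv G), ~~ (incident v i && incident v j).

Definition indicator (d : nat) (A : {set 'I_d}) : 'cV[int]_d :=
  \col_i (i \in A)%:R.

Definition matching_vectors (G : graph) (u : 'cV[int]_(ne G)) : Prop :=
  exists2 A : {set 'I_(ne G)}, matching A & u = indicator A.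

(** * Shifted matrices *)

Definition shift_mx (d n : nat) (x : 'M[int]_(d, n)) : 'M[int]_(d, n) :=
  \matrix_(i, j) nth 0 (sort >=%O [seq x i k | k <- enum 'I_n]) j.

Definition row_permuted (d n : nat) (x y : 'M[int]_(d, n)) : Prop :=
  forall i : 'I_d, exists s : 'S_n, forall j : 'I_n, y i j = x i (s j).

Definition rows_nonincreasing (d n : nat) (x : 'M[int]_(d, n)) : Prop :=
  forall (i : 'I_d) (j k : 'I_n), (j <= k)%N -> x i k <= x i j.

Lemma shift_mxP (d n : nat) (x y : 'M[int]_(d, n)) :
  y = shift_mx x <-> row_permuted x y /\ rows_nonincreasing y.
Proof.
pose r (z : 'M[int]_(d, n)) i := [seq z i k | k <- enum 'I_n].
have szr z i : size (r z i) = n by rewrite size_map size_enum_ord.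
have nthr z i (j : 'I_n) : nth 0 (r z i) j = z i j.
  by rewrite (nth_map j) ?size_enum_ord ?nth_ord_enum.
have tot : total (>=%O : rel int) by move=> a b; exact: ge_total.
have tr : transitive (>=%O : rel int) by exact: ge_trans.
have asy : antisymmetric (>=%O : rel int) by exact: ge_anti.
have rsh i : r (shift_mx x) i = sort >=%O (r x i).
  apply: (@eq_from_nth _ 0); first by rewrite szr size_sort szr.
  move=> j; rewrite szr => ltj.
  by rewrite -[j]/(nat_of_ord (Ordinal ltj)) nthr mxE.
split=> [->|[yx ymon]].
  split=> [i|i j k le_jk].
    have: perm_eq (r (shift_mx x) i) (r x i) by rewrite rsh perm_sort.
    have -> : r (shift_mx x) i = [tuple shift_mx x i k | k < n] by [].
    have -> : r x i = [tuple x i k | k < n] by [].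
    move=> /tuple_permP[s e]; exists s => j.
    by rewrite -nthr [X in nth _ X]e -tnth_nth !tnth_mktuple.
  rewrite -!nthr rsh.
  apply: (sorted_leq_nth tr (@ge_refl _ _)) => //; rewrite ?inE ?size_sort ?szr //.
  exact: sort_sorted.
suff e i : r y i = r (shift_mx x) i.
  by apply/matrixP => i j; rewrite -!nthr e.
rewrite rsh; apply: (sorted_eq tr asy) => //.
- apply/(sortedP 0) => j; rewrite szr => ltj.
  rewrite -[j.+1]/(nat_of_ord (Ordinal ltj)).
  rewrite -[j in nth _ _ j]/(nat_of_ord (Ordinal (ltnW ltj))) !nthr.
  exact: ymon.
- exact: sort_sorted.
rewrite perm_sym perm_sort perm_sym.
have [s es] := yx i.
have -> : r x i = [tuple x i k | k < n] by [].
apply/tuple_permP; exists s.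
by apply: eq_map => j; rewrite tnth_mktuple.
Qed.

Definition shifted (d n : nat) (x : 'M[int]_(d, n)) : Prop := x = shift_mx x.

Definition mx_dot (d n : nat) (c x : 'M[int]_(d, n)) : int :=
  \sum_i \sum_j c i j * x i j.

(* S^n *)
Definition columns_in (d n : nat) (S : 'cV[int]_d -> Prop)
    (x : 'M[int]_(d, n)) : Prop :=
  forall j : 'I_n, S (col j x).

(** * The shifting problem over matchings *)

Record shift_inst := ShiftInst {
  si_graph : graph;
  si_n : nat;
  si_c : 'M[int]_(ne si_graph, si_n)
}.

(* The size of the encoding is at least the number of vertices; the other
   numbers are in binary. *)
Definition enc_shift_inst (I : shift_inst) : word :=
  enc_unary (nv (si_graph I)) ++
  enc_seq (fun e : 'I_(nv (si_graph I)) * 'I_(nv (si_graph I)) =>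
             enc_nat e.1 ++ enc_nat e.2) (edge (si_graph I)) ++
  enc_nat (si_n I) ++
  enc_mx (si_c I).

Definition matching_shifting : max_problem := {|
  inst := shift_inst;
  sol := fun I => 'M[int]_(ne (si_graph I), si_n I);
  feasible := fun I x => columns_in (@matching_vectors (si_graph I)) x;
  value := fun I x => mx_dot (si_c I) (shift_mx x);
  enc_inst := enc_shift_inst;
  enc_sol := fun I x => enc_mx x
|}.

(* Main.v *)
(* Polynomial time is established through stack programs on prefix-coded trees,
   which compile to Turing machines and are closed under composition and under
   folds whose intermediate results have polynomial size.

   Part 1.  Take n parallel copies of each edge, the j-th one with profit
   c_{i,j}.  A maximum profit subgraph with all degrees at most n is a minimum
   cost circulation, as the graph is bipartite.  If it contains y_i copies of
   edge i then these may be assumed to be the first ones, because the rows of c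
   are nonincreasing.  The multigraph y decomposes into n matchings, which are
   the columns of an optimal x: for k = n, ..., 1 remove a matching that covers
   all vertices of degree k.  Circulations are found by inserting the arcs one
   by one, each time cancelling a cheapest negative cycle.

   Parts 2 and 3 are reductions from satisfiability with five literals per
   clause, the truth value of a variable being one of the two ways to select
   alternate edges of a long even cycle.  In part 2 the weights are (w, 0), so
   that the union of the two matchings counts.  A clause is a cycle of length 15
   with one port for each literal; if all of its literals are false then the
   whole cycle has to be covered by two matchings, but it is odd.  In part 3 most
   edges have weight (0, 2), so that it pays to use them in both matchings, and
   a clause vertex yields its full profit only if one of its literals leaves an
   adjacent cycle vertex free in one of the matchings. *)

Require Import Defs.
From mathcomp Require Import all_boot all_order all_algebra.
From mathcomp Require Import zify.

Set Implicit Arguments.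
Unset Strict Implicit.
Unset Printing Implicit Defensive.

(** * Polynomial bounds *)

(** Five is the size of a rule of the Cook-Levin tableau: four symbols of a row determine one symbol
    of the next row; shorter clauses repeat a literal. As five is odd, so is the length of the
    clause cycle, with three edges per literal. In both reductions the weight of an edge is split
    between its ends. Two matchings limit what a single vertex can receive, and the target is the
    sum of these limits, so a solution that reaches it is tight at every vertex. On the variable
    cycles tightness forces the alternation. Cancelling has to maintain a certificate, a potential
    with nonnegative reduced costs on the residual arcs. Distances serve as such a potential, and
    they survive the reversal of a cheapest walk. The certificate also compares an integral optimum
    with fractional solutions, which yields the matchings that cover all vertices of maximum degree.
    Sizes need care: vertices and counters are unary numbers, profits stay binary words, and n,
    given in binary, is expanded only if there is an edge. *)

Lemma poly_bound_mono k k' m m' :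
  k <= k' -> m <= m' -> poly_bound k m <= poly_bound k' m'.
Proof.
move=> kk mm; rewrite /poly_bound leq_mul //.
apply: leq_trans (leq_pexp2l _ kk) => //.
by case: k {kk} => // k; rewrite leq_exp2r.
Qed.

Definition pbounded (p : nat -> nat) := exists k, forall m, p m <= poly_bound k m.

Lemma pbounded_const c : pbounded (fun=> c).
Proof. by exists c => m; rewrite /poly_bound leq_pmulr // expn_gt0. Qed.

Lemma pbounded_id : pbounded id.
Proof. by exists 1 => m; rewrite /poly_bound mul1n expn1. Qed.

Lemma pbounded_pb k : pbounded (poly_bound k).
Proof. by exists k. Qed.

Lemma pbounded_add p q : pbounded p -> pbounded q -> pbounded (fun m => p m + q m).
Proof.
move=> [k kP] [l lP]; exists (k + l) => m.
rewrite {1}/poly_bound mulnDl; apply: leq_add.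
  by apply: leq_trans (kP m) _; rewrite leq_mul // leq_pexp2l // leq_addr.
by apply: leq_trans (lP m) _; rewrite leq_mul // leq_pexp2l // leq_addl.
Qed.

Lemma pbounded_mul p q : pbounded p -> pbounded q -> pbounded (fun m => p m * q m).
Proof.
move=> [k kP] [l lP]; exists (k * l + (k + l)) => m.
apply: leq_trans (leq_mul (kP m) (lP m)) _.
rewrite /poly_bound mulnACA -expnD leq_mul ?leq_addr // leq_pexp2l //.
by rewrite leq_addl.
Qed.

Lemma pbounded_comp p q : pbounded p -> pbounded q -> pbounded (fun m => p (q m)).
Proof.
move=> [k kP] [l lP].
(* Because [(l * m.+1 ^ l).+1 <= l.+1 * m.+1 ^ l], the composite is at most
   [k * l.+1 ^ k * m.+1 ^ (l * k)]; the sum dominates both the coefficient and the exponent. *)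
exists (k * l.+1 ^ k + l * k) => m.
apply: leq_trans (kP _) _.
apply: (leq_trans (poly_bound_mono (leqnn k) (lP m))).
rewrite /poly_bound.
have h : (l * m.+1 ^ l).+1 <= l.+1 * m.+1 ^ l.
  by rewrite mulSn -addn1 addnC leq_add2r expn_gt0.
apply: (@leq_trans (k * (l.+1 ^ k * m.+1 ^ (l * k)))).
  rewrite leq_mul2l expnM -expnMn.
  by apply/orP; right; case: k {kP} => // k; rewrite leq_exp2r.
by rewrite mulnA leq_mul ?leq_addr // leq_pexp2l // leq_addl.
Qed.

Ltac pbd := repeat lazymatch goal with
  | |- pbounded id => exact: pbounded_id
  | |- pbounded S => exact: (pbounded_add (pbounded_const 1) pbounded_id)
  | |- pbounded (fun m => m) => exact: pbounded_id
  | |- pbounded (poly_bound _) => exact: pbounded_pb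
  | |- pbounded (fun m => poly_bound _ m) => exact: pbounded_pb
  | |- pbounded (fun m => poly_bound _ _) => apply: (pbounded_comp (pbounded_pb _))
  | |- pbounded (muln ?k) => exact: (pbounded_mul (pbounded_const k) pbounded_id)
  | |- pbounded (addn ?k) => exact: (pbounded_add (pbounded_const k) pbounded_id)
  | |- pbounded (fun m => addn _ _) => apply: pbounded_add
  | |- pbounded (fun m => muln _ _) => apply: pbounded_mul
  | |- pbounded (fun m => S _) => first [exact: pbounded_const | apply: (pbounded_add (pbounded_const 1))]
  | |- _ => exact: pbounded_const
  end.

(** * Structured stack programs *)

(** Stack 0 carries the data, stacks 1 and 2 are scratch space for copying and exchanging trees, and
    stack 3 counts. Each stack becomes one tape. *)
Inductive ix := I0 | I1 | I2 | I3.

Record store := S4 { s0 : word; s1 : word; s2 : word; s3 : word }.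

Definition get (s : store) (i : ix) : word :=
  match i with I0 => s0 s | I1 => s1 s | I2 => s2 s | I3 => s3 s end.

Definition upd (s : store) (i : ix) (w : word) : store :=
  match i, s with
  | I0, S4 _ b c d => S4 w b c d
  | I1, S4 a _ c d => S4 a w c d
  | I2, S4 a b _ d => S4 a b w d
  | I3, S4 a b c _ => S4 a b c w
  end.

Inductive com :=
| Push of ix & bool
| Pop of ix
| Skip
| Seq of com & com
| If of ix & pred (option bool) & com & com
| While of ix & pred (option bool) & com.

(* The number counts the steps of the machine that the program is compiled
   to. *)
Inductive exec : com -> store -> nat -> store -> Prop :=
| EPush i b s : exec (Push i b) s 2 (upd s i (b :: get s i))
| EPop i s : exec (Pop i) s 1 (upd s i (behead (get s i)))
| ESkip s : exec Skip s 1 s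
| ESeq c1 c2 s s' s'' n m :
    exec c1 s n s' -> exec c2 s' m s'' -> exec (Seq c1 c2) s (n + m) s''
| EIfT i (p : pred (option bool)) c1 c2 s n s' :
    p (ohead (get s i)) -> exec c1 s n s' -> exec (If i p c1 c2) s n.+1 s'
| EIfF i (p : pred (option bool)) c1 c2 s n s' :
    ~~ p (ohead (get s i)) -> exec c2 s n s' -> exec (If i p c1 c2) s n.+1 s'
| EWhileF i (p : pred (option bool)) c s :
    ~~ p (ohead (get s i)) -> exec (While i p c) s 1 s
| EWhileT i (p : pred (option bool)) c s n s' m s'' :
    p (ohead (get s i)) -> exec c s n s' -> exec (While i p c) s' m s'' ->
    exec (While i p c) s (n + m).+1 s''.

(** * Compilation to Turing machines *)

Definition otape (i : ix) : 'I_4 :=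
  match i with I0 => @Ordinal 4 0 isT | I1 => @Ordinal 4 1 isT
  | I2 => @Ordinal 4 2 isT | I3 => @Ordinal 4 3 isT end.

Definition vcell := cell void.
Definition wcell (b : option bool) : vcell := omap inl b.
Definition rcell (c : vcell) : option bool :=
  match c with Some (inl b) => Some b | _ => None end.

Lemma rcellK : cancel rcell wcell. Proof. by case=> [[b|[]]|]. Qed.

Fixpoint cst (c : com) : finType :=
  match c with
  | Push _ _ => bool
  | Pop _ | Skip => unit
  | Seq c1 c2 => (cst c1 + cst c2)%type
  | If _ _ c1 c2 => option (cst c1 + cst c2)%type
  | While _ _ c => option (cst c)
  end.

Fixpoint cstart (c : com) : cst c :=
  match c with
  | Push _ _ => false
  | Pop _ => tt
  | Skip => tt
  | Seq c1 c2 => inl (cstart c1)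
  | If _ _ _ _ => None
  | While _ _ _ => None
  end.

(* An operation writes a symbol on one tape and moves its head; the other tapes
   do not change. *)
Definition op := option (ix * (option bool * move)).

(** A command ends when its next state is [None]. [Push] takes two steps because a machine step
    writes before it moves: the first one restores the scanned cell and goes left, the second one
    writes the bit. *)
Fixpoint ctrans (c : com) (f : {ffun 'I_4 -> vcell}) : cst c -> option (cst c) * op :=
  match c return cst c -> option (cst c) * op with
  | Push i b => fun q : bool =>
      if q then (None, Some (i, (Some b, MoveN)))
      else (Some true, Some (i, (rcell (f (otape i)), MoveL)))
  | Pop i => fun=> (None, Some (i, (None, MoveR)))
  | Skip => fun=> (None, None)
  | Seq c1 c2 => fun q =>
      match q with
      | inl q1 => let: (q', o) := ctrans f q1 in
                  (Some (if q' is Some q2 then inl q2 else inr (cstart c2)), o)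
      | inr q2 => let: (q', o) := ctrans f q2 in (omap inr q', o)
      end
  | If i p c1 c2 => fun q =>
      match q with
      | None => (Some (Some (if p (rcell (f (otape i))) then inl (cstart c1) else inr (cstart c2))), None)
      | Some (inl q1) => let: (q', o) := ctrans f q1 in
                         (omap (fun x => Some (inl x)) q', o)
      | Some (inr q2) => let: (q', o) := ctrans f q2 in
                         (omap (fun x => Some (inr x)) q', o)
      end
  | While i p c => fun q =>
      match q with
      | None => (if p (rcell (f (otape i))) then Some (Some (cstart c)) else None, None)
      | Some q1 => let: (q', o) := ctrans f q1 in (Some q', o)
      end
  end.

Definition tapes := {ffun 'I_4 -> tape void}.

Definition reads (T : tapes) : {ffun 'I_4 -> vcell} := [ffun i => tape_read (T i)].

Definition op_acts (o : op) (f : {ffun 'I_4 -> vcell}) : {ffun 'I_4 -> vcell * move} :=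
  [ffun j => if o is Some (i, (w, mv)) then
     if j == otape i then (wcell w, mv) else (f j, MoveN) else (f j, MoveN)].

Definition op_run (o : op) (T : tapes) : tapes :=
  [ffun j => tape_act (op_acts o (reads T) j) (T j)].

Inductive mrun (c : com) : cst c -> tapes -> nat -> tapes -> Prop :=
| MLast q T o : ctrans (reads T) q = (None, o) -> mrun q T 1 (op_run o T)
| MStep q T o q' n T' : ctrans (reads T) q = (Some q', o) ->
    mrun q' (op_run o T) n T' -> mrun q T n.+1 T'.

Lemma mrun_seq2 c1 c2 q T n T1 :
  @mrun c2 q T n T1 -> @mrun (Seq c1 c2) (inr q) T n T1.
Proof.
move=> H; elim: H => {q T n T1} [q T o e|q T o q' n T' e _ IH].
  by apply: (@MLast (Seq c1 c2)); rewrite /= e.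
by apply: (@MStep (Seq c1 c2) (inr q) T o _ _ _ _ IH); rewrite /= e.
Qed.

Lemma mrun_seq1 c1 c2 q T n T1 m T2 :
  @mrun c1 q T n T1 -> mrun (cstart c2) T1 m T2 ->
  @mrun (Seq c1 c2) (inl q) T (n + m) T2.
Proof.
move=> H; elim: H => {q T n T1} [q T o e|q T o q' n T' e _ IH] H.
  by rewrite add1n; apply: (@MStep (Seq c1 c2) (inl q) T o _ _ _ _ (mrun_seq2 _ H)); rewrite /= e.
by rewrite addSn; apply: (@MStep (Seq c1 c2) (inl q) T o _ _ _ _ (IH H)); rewrite /= e.
Qed.

Lemma mrun_if1 i p c1 c2 q T n T1 :
  @mrun c1 q T n T1 -> @mrun (If i p c1 c2) (Some (inl q)) T n T1.
Proof.
move=> H; elim: H => {q T n T1} [q T o e|q T o q' n T' e _ IH].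
  by apply: (@MLast (If i p c1 c2)); rewrite /= e.
by apply: (@MStep (If i p c1 c2) (Some (inl q)) T o _ _ _ _ IH); rewrite /= e.
Qed.

Lemma mrun_if2 i p c1 c2 q T n T1 :
  @mrun c2 q T n T1 -> @mrun (If i p c1 c2) (Some (inr q)) T n T1.
Proof.
move=> H; elim: H => {q T n T1} [q T o e|q T o q' n T' e _ IH].
  by apply: (@MLast (If i p c1 c2)); rewrite /= e.
by apply: (@MStep (If i p c1 c2) (Some (inr q)) T o _ _ _ _ IH); rewrite /= e.
Qed.

Lemma mrun_while i p c q T n T1 m T2 :
  @mrun c q T n T1 -> @mrun (While i p c) None T1 m T2 ->
  @mrun (While i p c) (Some q) T (n + m) T2.
Proof.
move=> H; elim: H => {q T n T1} [q T o e|q T o q' n T' e _ IH] H.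
  by rewrite add1n; apply: (@MStep (While i p c) (Some q) T o _ _ _ _ H); rewrite /= e.
by rewrite addSn; apply: (@MStep (While i p c) (Some q) T o _ _ _ _ (IH H)); rewrite /= e.
Qed.

(* The head of a tape is at the top of the stack; what is to its left is
   irrelevant. *)
Definition rep (t : tape void) (w : word) :=
  exists m, t.2 = [seq wcell (Some b) | b <- w] ++ nseq m None.

Definition reps (T : tapes) (s : store) := forall i, rep (T (otape i)) (get s i).

Lemma reads_reps T s i : reps T s -> rcell (reads T (otape i)) = ohead (get s i).
Proof. by rewrite ffunE /tape_read => /(_ i)[m ->]; case: (get s i) => //=; case: m. Qed.

Lemma get_upd s i w j :
  get (upd s i w) j = if otape j == otape i then w else get s j.
Proof. by case: s i j => a b c d [] []. Qed.

(** Keeping a tape still rewrites its scanned cell, which materializes a blank if that cell lay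
    beyond the zipper; only the number of trailing blanks changes. *)
Lemma rep_keep t w : rep t w -> rep (tape_act (tape_read t, MoveN) t) w.
Proof.
case: t => l r [m /= ->]; rewrite /rep /tape_act /tape_read /=.
case: w => [|b w] /=; last by exists m.
by exists m.-1.+1; case: m.
Qed.

Lemma reps_op i a T s w :
  reps T s -> rep (tape_act (wcell a.1, a.2) (T (otape i))) w ->
  reps (op_run (Some (i, a)) T) (upd s i w).
Proof.
move=> H Hw j; rewrite /op_run get_upd ffunE /op_acts ffunE; case: a Hw => x mv /= Hw.
have [->//|ne] := eqVneq (otape j) (otape i).
by rewrite ffunE; apply/rep_keep/H.
Qed.

Lemma reps_none T s : reps T s -> reps (op_run None T) s.
Proof. by move=> H j; rewrite /op_run !ffunE; apply/rep_keep/H. Qed.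

Lemma exec_mrun c s n s' : exec c s n s' ->
  forall T, reps T s -> exists2 T', reps T' s' & mrun (cstart c) T n T'.
Proof.
elim=> {c s n s'} [i b s|i s|s|c1 c2 s s' s'' n m _ IH1 _ IH2
  |i p c1 c2 s n s' ps _ IH|i p c1 c2 s n s' ps _ IH|i p c s ps
  |i p c s n s' m s'' ps _ IH1 _ IH2] T HT.
- pose o1 : op := Some (i, (rcell (reads T (otape i)), MoveL)).
  pose o2 : op := Some (i, (Some b, MoveN)).
  exists (op_run o2 (op_run o1 T)); last first.
    by apply: (@MStep (Push i b) false T o1 true 1) => //; apply: (@MLast (Push i b)).
  have E (x : ix) (a : option bool * move) (T1 : tapes) j : op_run (Some (x, a)) T1 j =
      tape_act (if j == otape x then (wcell a.1, a.2) else (tape_read (T1 j), MoveN)) (T1 j).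
    by rewrite /op_run !ffunE; case: a => ? ?; case: eqP => // _; rewrite ffunE.
  move=> j; rewrite get_upd !E.
  have [->|ne] := eqVneq (otape j) (otape i); last by do 2 apply: rep_keep; apply: HT.
  have [m e] := HT i; rewrite rcellK ffunE /tape_act /tape_read /= e /rep /=.
  case: (get s i) => [|x w] /=; last by exists m.
  by exists m.-1.+1; case: m {e}.
- exists (op_run (Some (i, (None, MoveR))) T); last exact: (@MLast (Pop i)).
  apply: reps_op => //=; have [m e] := HT i.
  rewrite /tape_act /rep /= e; case: (get s i) => [|x w] /=; last by exists m.
  by exists m.-1; case: m {e}.
- by exists (op_run None T); [exact: reps_none | exact: (@MLast Skip)].
- have [T1 H1 R1] := IH1 T HT; have [T2 H2 R2] := IH2 T1 H1.
  by exists T2 => //; apply: mrun_seq1 R1 R2.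
- have [T2 H2 R2] := IH _ (reps_none HT); exists T2 => //.
  apply: (@MStep (If i p c1 c2) None T None (Some (inl (cstart c1))) _ _ _ (mrun_if1 _ _ _ R2)).
  by rewrite /= (reads_reps _ HT) ps.
- have [T2 H2 R2] := IH _ (reps_none HT); exists T2 => //.
  apply: (@MStep (If i p c1 c2) None T None (Some (inr (cstart c2))) _ _ _ (mrun_if2 _ _ _ R2)).
  by rewrite /= (reads_reps _ HT) (negbTE ps).
- exists (op_run None T); first exact: reps_none.
  by apply: (@MLast (While i p c)); rewrite /= (reads_reps _ HT) (negbTE ps).
- have [T1 H1 R1] := IH1 _ (reps_none HT); have [T2 H2 R2] := IH2 T1 H1.
  exists T2 => //.
  apply: (@MStep (While i p c) None T None (Some (cstart c)) _ _ _ (mrun_while R1 R2)).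
  by rewrite /= (reads_reps _ HT) ps.
Qed.

Definition tm_of (c : com) : tm :=
  @TM 3 (option (cst c)) void (Some (cstart c)) (fun q f =>
    if q is Some q1 then
      let: (q', o) := ctrans f q1 in Some (q', op_acts o f)
    else None).

Lemma tm_of_step c (q : cst c) T q' o :
  ctrans (reads T) q = (q', o) ->
  @tm_step (tm_of c) (Some q, T) = (q', op_run o T).
Proof. by move=> e; rewrite /tm_step /tm_next /= -/(reads T) e. Qed.

Lemma mrun_iter c (q : cst c) T n T' :
  mrun q T n T' -> iter n (@tm_step (tm_of c)) (Some q, T) = (None, T').
Proof.
elim=> {q T n T'} [q T o e|q T o q' n T' e _ IH]; rewrite ?iterSr /= (tm_of_step e) //.
Qed.

Lemma iter_halted M t (x : config M) : tm_halted x -> iter t (@tm_step M) x = x.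
Proof.
move=> h; elim: t => //= t ->; move: h.
by rewrite /tm_halted /tm_step; case: tm_next.
Qed.

Lemma computes_within_mono M t t' w v :
  t <= t' -> computes_within M t w v -> computes_within M t' w v.
Proof.
move=> le [h o]; rewrite /computes_within -(subnK le) iterD.
by rewrite iter_halted.
Qed.

Lemma rep_read_bits t w : rep t w -> read_bits t.2 = w.
Proof. by move=> [m ->]; elim: w => [|b w IH] /=; [case: m | rewrite IH]. Qed.

Lemma exec_computes c w n v a b d :
  exec c (S4 w [::] [::] [::]) n (S4 v a b d) -> computes_within (tm_of c) n w v.
Proof.
move=> e; pose T0 := (tm_init (tm_of c) w).2.
have r0 : reps T0 (S4 w [::] [::] [::]).
  by case; rewrite /rep ffunE /=; exists 0; rewrite ?cats0 //=; apply: eq_map.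
have [T' r' m] := exec_mrun e r0.
rewrite /computes_within.
have -> : tm_init (tm_of c) w = (Some (cstart c), T0) by [].
rewrite (mrun_iter m); split=> //.
rewrite /tm_output /= -[RHS](rep_read_bits (r' I0)).
by congr (read_bits (T' _).2); apply: val_inj.
Qed.

(** * Stack programs on prefix-coded binary trees *)

Fixpoint loopfree (c : com) : bool :=
  match c with
  | Seq c1 c2 | If _ _ c1 c2 => loopfree c1 && loopfree c2
  | While _ _ _ => false
  | _ => true
  end.

(** An interpreter with a step count for loop-free code, so that runs of straight-line fragments
    hold by computation. *)
Fixpoint slrun (c : com) (s : store) : store * nat :=
  match c with
  | Push i b => (upd s i (b :: get s i), 2)
  | Pop i => (upd s i (behead (get s i)), 1)
  | Skip => (s, 1)
  | Seq c1 c2 => let: (s', n) := slrun c1 s in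
                 let: (s'', m) := slrun c2 s' in (s'', n + m)
  | If i p c1 c2 => let: (s', n) := if p (ohead (get s i)) then slrun c1 s else slrun c2 s in (s', n.+1)
  | While _ _ _ => (s, 0)
  end.

Lemma exec_sl c s : loopfree c -> exec c s (slrun c s).2 (slrun c s).1.
Proof.
elim: c s => /= [i b|i||c1 IH1 c2 IH2|i p c1 IH1 c2 IH2|i p c IH] s //.
- by move=> _; constructor.
- by move=> _; constructor.
- by move=> _; constructor.
- case/andP=> /(IH1 s) h1 l2; have := fun s => IH2 s l2; case: slrun h1 => s' n /= h1 h2; have {h2} := h2 s'.
  by case: slrun => s'' m /= h2; apply: ESeq h1 h2.
- case/andP=> /(IH1 s) h1 /(IH2 s) h2; case: ifP => ps.
    by case: slrun h1 => s' n /=; apply: EIfT.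
  by case: slrun h2 => s' n /=; apply: EIfF; rewrite ps.
Qed.

Definition runs c s s' B := exists2 n, exec c s n s' & n <= B.

Lemma runs_le c s s' B B' : runs c s s' B -> B <= B' -> runs c s s' B'.
Proof. by move=> [n e l] l'; exists n => //; apply: leq_trans l l'. Qed.

Lemma runs_seq c1 c2 s s' s'' B1 B2 :
  runs c1 s s' B1 -> runs c2 s' s'' B2 -> runs (Seq c1 c2) s s'' (B1 + B2).
Proof. by move=> [n e l] [m f k]; exists (n + m); [apply: ESeq e f | apply: leq_add]. Qed.

Lemma runs_sl c s s' B : loopfree c -> (slrun c s).1 = s' -> (slrun c s).2 <= B ->
  runs c s s' B.
Proof. by move=> l <- le; exists (slrun c s).2 => //; apply: exec_sl. Qed.

Lemma runs_whileT i (p : pred (option bool)) c s s' s'' B1 B2 :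
  p (ohead (get s i)) -> runs c s s' B1 -> runs (While i p c) s' s'' B2 ->
  runs (While i p c) s s'' (B1 + B2).+1.
Proof.
move=> h [n e l] [m f k]; exists (n + m).+1; first exact: EWhileT h e f.
by rewrite ltnS leq_add.
Qed.

Lemma runs_whileF i (p : pred (option bool)) c s :
  ~~ p (ohead (get s i)) -> runs (While i p c) s s 1.
Proof. by move=> h; exists 1 => //; apply: EWhileF. Qed.

Lemma runs_ifT i (p : pred (option bool)) c1 c2 s s' B :
  p (ohead (get s i)) -> runs c1 s s' B -> runs (If i p c1 c2) s s' B.+1.
Proof. by move=> h [n e l]; exists n.+1 => //; apply: EIfT. Qed.

Lemma runs_ifF i (p : pred (option bool)) c1 c2 s s' B :
  ~~ p (ohead (get s i)) -> runs c2 s s' B -> runs (If i p c1 c2) s s' B.+1.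
Proof. by move=> h [n e l]; exists n.+1 => //; apply: EIfF. Qed.

Definition top1 : pred (option bool) := fun o => o == Some true.

Declare Scope com_scope.
Infix ";;" := Seq (at level 61, right associativity) : com_scope.
Local Open Scope com_scope.

Inductive tree := Leaf | Node of tree & tree.

Fixpoint tcode (t : tree) : word :=
  match t with Leaf => [:: false] | Node a b => true :: tcode a ++ tcode b end.

Lemma tcode_gt0 t : 0 < size (tcode t). Proof. by case: t. Qed.

(* The counter on stack 3 is the number of subtrees still to be read; a false
   bit below it protects the rest of the stack. *)
Definition mvbody d : com :=
  Pop I3 ;;
  If I0 top1 (Pop I0 ;; Push d true ;; Push d true ;; Push I3 true ;; Push I3 true)
            (Pop I0 ;; Push d false ;; Push d true).

Definition mv d : com :=
  Push d false ;; Push I3 false ;; Push I3 true ;; While I3 top1 (mvbody d) ;; Pop I3.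

(** Scratch stacks store words by [enc_word], each bit behind a [true] and the end marked by
    [false], so that a word can be taken off without disturbing what lies below. Moving a word
    reverses it, and so does moving it back. *)
Definition un d : com :=
  While d top1 (Pop d ;;
    If d top1 (Pop d ;; Push I0 true) (Pop d ;; Push I0 false)) ;; Pop d.

Definition undup : com :=
  Push I2 false ;;
  While I1 top1 (Pop I1 ;;
    If I1 top1 (Pop I1 ;; Push I0 true ;; Push I2 true ;; Push I2 true)
              (Pop I1 ;; Push I0 false ;; Push I2 false ;; Push I2 true)) ;; Pop I1.

Definition mv21 : com :=
  Push I1 false ;;
  While I2 top1 (Pop I2 ;;
    If I2 top1 (Pop I2 ;; Push I1 true ;; Push I1 true)
              (Pop I2 ;; Push I1 false ;; Push I1 true)) ;; Pop I2.

Definition clr : com := While I1 top1 (Pop I1 ;; Pop I1) ;; Pop I1.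

(** Treats the two scratch stacks symmetrically, so that one lemma covers both. *)
Definition st12 (b : bool) r0 w1 w2 r3 := if b then S4 r0 w1 w2 r3 else S4 r0 w2 w1 r3.
Definition ix12 (b : bool) := if b then I1 else I2.

Lemma mv_runs b x r0 w1 w2 r3 :
  runs (mv (ix12 b)) (st12 b (tcode x ++ r0) w1 w2 r3)
    (st12 b r0 (enc_word (rev (tcode x)) ++ w1) w2 r3) (20 * size (tcode x)).
Proof.
(* Stated with the rest of the run as a hypothesis: reading [y] uses up one [true] of the counter
   and hands over to any continuation, so that the two subtrees of a node can be chained. *)
have loop y : forall r v r0' s' B,
    runs (While I3 top1 (mvbody (ix12 b))) (st12 b r0' (enc_word (rev (tcode y) ++ v) ++ w1) w2 r) s' B ->
    runs (While I3 top1 (mvbody (ix12 b))) (st12 b (tcode y ++ r0') (enc_word v ++ w1) w2 (true :: r)) s'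
      (B + 12 * size (tcode y)).
  elim: y => [|y IHy z IHz] r v r' s' B H.
    apply: (@runs_le _ _ _ (10 + B).+1); last by rewrite /=; lia.
    apply: runs_whileT H; first by case: (b).
    by apply: runs_sl => //=; case: (b).
  apply: (@runs_le _ _ _ (11 + ((B + 12 * size (tcode z)) + 12 * size (tcode y))).+1); last first.
    by rewrite /= size_cat; lia.
  apply: (@runs_whileT _ _ _ _
    (st12 b (tcode y ++ tcode z ++ r') (enc_word (true :: v) ++ w1) w2 (true :: true :: r))).
  - by case: (b).
  - by apply: runs_sl => //=; case: (b); rewrite -?catA.
  - apply: IHy; apply: IHz; move: H; rewrite /= rev_cons rev_cat -cats1 -!catA //.
apply: (@runs_le _ _ _ (2 + (2 + (2 + ((1 + 12 * size (tcode x)) + 1))))); last first.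
  by have := tcode_gt0 x; lia.
apply: (@runs_seq _ _ _ (st12 b (tcode x ++ r0) (false :: w1) w2 r3)); first by apply: runs_sl => //; case: (b).
apply: (@runs_seq _ _ _ (st12 b (tcode x ++ r0) (false :: w1) w2 (false :: r3))); first by apply: runs_sl => //; case: (b).
apply: (@runs_seq _ _ _ (st12 b (tcode x ++ r0) (false :: w1) w2 (true :: false :: r3))); first by apply: runs_sl => //; case: (b).
apply: (@runs_seq _ _ _ (st12 b r0 (enc_word (rev (tcode x)) ++ w1) w2 (false :: r3))); last first.
  by apply: runs_sl => //; case: (b).
apply: (loop x _ [::]); rewrite cats0; apply: runs_whileF; by case: (b).
Qed.

Lemma un_runs b w r0 w1 w2 r3 :
  runs (un (ix12 b)) (st12 b r0 (enc_word w ++ w1) w2 r3)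
    (st12 b (rev w ++ r0) w1 w2 r3) (8 * (size w).+1).
Proof.
apply: (@runs_le _ _ _ ((1 + 7 * size w) + 1)); last by lia.
apply: (@runs_seq _ _ _ (st12 b (rev w ++ r0) (false :: w1) w2 r3)); last first.
  by apply: runs_sl => //; case: (b).
elim: w r0 => [|x w IH] r0; first by apply: runs_whileF; case: (b).
apply: (@runs_le _ _ _ (5 + (1 + 7 * size w)).+1); last by rewrite /=; lia.
apply: (@runs_whileT _ _ _ _ (st12 b (x :: r0) (enc_word w ++ w1) w2 r3)); first by case: (b).
  by apply: runs_sl => //; case: (b); case: x.
by rewrite rev_cons !cat_rcons; apply: IH.
Qed.

Lemma undup_runs w r0 r1 r2 r3 :
  runs undup (S4 r0 (enc_word w ++ r1) r2 r3)
    (S4 (rev w ++ r0) r1 (enc_word (rev w) ++ r2) r3) (14 * (size w).+1).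
Proof.
apply: (@runs_le _ _ _ (2 + ((1 + 12 * size w) + 1))); last by lia.
apply: (@runs_seq _ _ _ (S4 r0 (enc_word w ++ r1) (enc_word [::] ++ r2) r3)); first exact: runs_sl.
apply: (@runs_seq _ _ _ (S4 (rev w ++ r0) (false :: r1) (enc_word (rev w ++ [::]) ++ r2) r3)); last first.
  by apply: runs_sl; rewrite //= cats0.
elim: w r0 [::] => [|x w IH] r0 v; first exact: runs_whileF.
apply: (@runs_le _ _ _ (9 + (1 + 12 * size w)).+1); last by rewrite /=; lia.
apply: (@runs_whileT _ _ _ _ (S4 (x :: r0) (enc_word w ++ r1) (enc_word (x :: v) ++ r2) r3)) => //.
  by apply: runs_sl => //; case: x.
by rewrite rev_cons !cat_rcons; apply: IH.
Qed.

Lemma mv21_runs w r0 r1 r2 r3 :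
  runs mv21 (S4 r0 r1 (enc_word w ++ r2) r3)
    (S4 r0 (enc_word (rev w) ++ r1) r2 r3) (12 * (size w).+1).
Proof.
apply: (@runs_le _ _ _ (2 + ((1 + 10 * size w) + 1))); last by lia.
apply: (@runs_seq _ _ _ (S4 r0 (enc_word [::] ++ r1) (enc_word w ++ r2) r3)); first exact: runs_sl.
apply: (@runs_seq _ _ _ (S4 r0 (enc_word (rev w ++ [::]) ++ r1) (false :: r2) r3)); last first.
  by apply: runs_sl; rewrite //= cats0.
elim: w [::] => [|x w IH] v; first exact: runs_whileF.
apply: (@runs_le _ _ _ (7 + (1 + 10 * size w)).+1); last by rewrite /=; lia.
apply: (@runs_whileT _ _ _ _ (S4 r0 (enc_word (x :: v) ++ r1) (enc_word w ++ r2) r3)) => //.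
  by apply: runs_sl => //; case: x.
by rewrite rev_cons !cat_rcons; apply: IH.
Qed.

Lemma clr_runs w r0 r1 r2 r3 :
  runs clr (S4 r0 (enc_word w ++ r1) r2 r3) (S4 r0 r1 r2 r3) (4 * (size w).+1).
Proof.
apply: (@runs_le _ _ _ ((1 + 3 * size w) + 1)); last by lia.
apply: (@runs_seq _ _ _ (S4 r0 (false :: r1) r2 r3)); last exact: runs_sl.
elim: w => [|x w IH]; first exact: runs_whileF.
apply: (@runs_le _ _ _ (2 + (1 + 3 * size w)).+1); last by rewrite /=; lia.
by apply: (@runs_whileT _ _ _ _ (S4 r0 (enc_word w ++ r1) r2 r3)) => //; apply: runs_sl.
Qed.

Definition dup := mv I1 ;; undup ;; mv21 ;; un I1.
Definition swap := mv I1 ;; mv I2 ;; un I1 ;; un I2.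
Definition dropt := mv I1 ;; clr.

Lemma dup_runs x r0 r1 r2 r3 :
  runs dup (S4 (tcode x ++ r0) r1 r2 r3) (S4 (tcode x ++ tcode x ++ r0) r1 r2 r3)
    (100 * size (tcode x)).
Proof.
set c := tcode x; have c0 : 0 < size c by apply: tcode_gt0.
apply: (@runs_le _ _ _ (20 * size c + (14 * (size c).+1 + (12 * (size c).+1 + 8 * (size c).+1)))).
  2: by lia.
apply: runs_seq (mv_runs true _ _ _ _ _) _.
apply: runs_seq; first by have := undup_runs (rev c) r0 r1 r2 r3; rewrite size_rev revK; apply.
apply: runs_seq; first exact: mv21_runs.
by have := un_runs true (rev c) (c ++ r0) r1 r2 r3; rewrite size_rev revK; apply.
Qed.

Lemma swap_runs x y r0 r1 r2 r3 :
  runs swap (S4 (tcode x ++ tcode y ++ r0) r1 r2 r3) (S4 (tcode y ++ tcode x ++ r0) r1 r2 r3)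
    (50 * (size (tcode x) + size (tcode y))).
Proof.
have x0 := tcode_gt0 x; have y0 := tcode_gt0 y.
apply: (@runs_le _ _ _ (20 * size (tcode x) + (20 * size (tcode y) +
  (8 * (size (tcode x)).+1 + 8 * (size (tcode y)).+1)))); last by lia.
apply: runs_seq (mv_runs true _ _ _ _ _) _.
apply: runs_seq (mv_runs false _ _ _ _ _) _.
apply: runs_seq.
  by have := un_runs true (rev (tcode x)) r0 r1 (enc_word (rev (tcode y)) ++ r2) r3; rewrite size_rev revK; apply.
by have := un_runs false (rev (tcode y)) (tcode x ++ r0) r2 r1 r3; rewrite size_rev revK; apply.
Qed.

Lemma dropt_runs x r0 r1 r2 r3 :
  runs dropt (S4 (tcode x ++ r0) r1 r2 r3) (S4 r0 r1 r2 r3) (50 * size (tcode x)).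
Proof.
have x0 := tcode_gt0 x.
apply: (@runs_le _ _ _ (20 * size (tcode x) + 4 * (size (tcode x)).+1)); last by lia.
apply: runs_seq (mv_runs true _ _ _ _ _) _.
by rewrite -size_rev; apply: clr_runs.
Qed.

Fixpoint pushw (w : word) : com := if w is b :: w' then pushw w' ;; Push I0 b else Skip.

Lemma pushw_runs w r0 r1 r2 r3 :
  runs (pushw w) (S4 r0 r1 r2 r3) (S4 (w ++ r0) r1 r2 r3) (2 * size w + 1).
Proof.
elim: w => [|b w IH] /=; first exact: runs_sl.
apply: (@runs_le _ _ _ ((2 * size w + 1) + 2)); last by lia.
by apply: runs_seq IH _; apply: runs_sl.
Qed.

(** * Polynomial time functions on encodable types *)

Class Enc (A : Type) := tenc : A -> tree.

#[export] Instance enc_unit : Enc unit := fun=> Leaf.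
#[export] Instance enc_bool : Enc bool := fun b => if b then Node Leaf Leaf else Leaf.
#[export] Instance enc_pair A B {EA : Enc A} {EB : Enc B} : Enc (A * B) :=
  fun p => Node (tenc p.1) (tenc p.2).
#[export] Instance enc_list A {EA : Enc A} : Enc (seq A) :=
  foldr (fun x t => Node (tenc x) t) Leaf.
(* Numbers are unary here. *)
#[export] Instance enc_unat : Enc nat := fun n => iter n (Node Leaf) Leaf.

Definition tcd {A} {EA : Enc A} (a : A) : word := tcode (tenc a).
Definition tsz {A} {EA : Enc A} (a : A) : nat := size (tcd a).

(** Codes of trees are prefix-free, so an argument can sit on top of arbitrary data. Preserving the
    rest of all stacks is what makes programs composable. *)
Definition FP {A B} {EA : Enc A} {EB : Enc B} (f : A -> B) :=
  exists c k, forall a r0 r1 r2 r3,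
    runs c (S4 (tcd a ++ r0) r1 r2 r3) (S4 (tcd (f a) ++ r0) r1 r2 r3)
      (poly_bound k (tsz a)).

Lemma tsz_gt0 A {EA : Enc A} (a : A) : 0 < tsz a.
Proof. exact: tcode_gt0. Qed.

Lemma tsz_pair A B {EA : Enc A} {EB : Enc B} (a : A) (b : B) :
  tsz (a, b) = (tsz a + tsz b).+1.
Proof. by rewrite /tsz /tcd /= size_cat. Qed.

Lemma tcd_pair A B {EA : Enc A} {EB : Enc B} (a : A) (b : B) r :
  tcd (a, b) ++ r = true :: tcd a ++ tcd b ++ r.
Proof. by rewrite /tcd /= -catA. Qed.

Lemma tsz_nil A {EA : Enc A} : tsz ([::] : seq A) = 1.
Proof. by []. Qed.

Lemma tsz_cons A {EA : Enc A} (x : A) s : tsz (x :: s) = (tsz x + tsz s).+1.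
Proof. by rewrite /tsz /tcd /= size_cat. Qed.

Lemma tsz_nat n : tsz n = n.*2.+1.
Proof. by elim: n => // n IH; rewrite doubleS -IH. Qed.

Lemma tsz_bool (b : bool) : tsz b <= 3.
Proof. by case: b. Qed.

Lemma tsz_true : tsz true = 3. Proof. by []. Qed.

Lemma tsz_false : tsz false = 1. Proof. by []. Qed.

Lemma tsz_cat A {EA : Enc A} (s t : seq A) : (tsz (s ++ t)).+1 = tsz s + tsz t.
Proof. by elim: s => //= x s IH; rewrite !tsz_cons -addnS IH addSn addnA. Qed.

Lemma tsz_rcons A {EA : Enc A} (s : seq A) x : tsz (rcons s x) = (tsz s + tsz x).+1.
Proof. by rewrite -cats1; apply: succn_inj; rewrite tsz_cat tsz_cons tsz_nil; lia. Qed.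

Lemma size_tsz A {EA : Enc A} (s : seq A) : (size s).*2 < tsz s.
Proof. by elim: s => [|x s IH] //; rewrite tsz_cons [size _]/= doubleS; have := @tsz_gt0 _ EA x; lia. Qed.

Lemma tsz_drop A {EA : Enc A} (s : seq A) i : tsz (drop i s) <= tsz s.
Proof.
elim: s i => [|x s IH] [|i] //=; rewrite tsz_cons.
by apply: leq_trans (IH i) _; lia.
Qed.

Lemma tsz_mem A (EA : Enc A) (T : eqType) (h : T -> A) (s : seq T) x :
  x \in s -> tsz (h x) < tsz (map h s).
Proof.
elim: s => //= y s IH; rewrite inE tsz_cons => /orP[/eqP-> | /IH h1]; first by rewrite ltnS leq_addr.
by apply: leq_trans h1 _; apply: leqW; rewrite leq_addl.
Qed.

Lemma FP_intro A B {EA : Enc A} {EB : Enc B} (f : A -> B) c p : pbounded p ->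
  (forall a r0 r1 r2 r3,
    runs c (S4 (tcd a ++ r0) r1 r2 r3) (S4 (tcd (f a) ++ r0) r1 r2 r3) (p (tsz a))) ->
  FP f.
Proof. by move=> [k kP] h; exists c, k => a r0 r1 r2 r3; apply: runs_le (h _ _ _ _ _) _. Qed.

Lemma FP_ext A B {EA : Enc A} {EB : Enc B} (f g : A -> B) : f =1 g -> FP f -> FP g.
Proof. by move=> e [c [k h]]; exists c, k => a; rewrite -e; apply: h. Qed.

Definition stsize s := size (s0 s) + size (s1 s) + size (s2 s) + size (s3 s).

Lemma exec_stsize c s n s' : exec c s n s' -> stsize s' <= stsize s + n.
Proof.
elim=> {c s n s'}; try by move=> *; lia.
- by case=> b [s t u v]; rewrite /stsize /=; lia.
- by case=> -[s t u v]; rewrite /stsize /= size_behead; lia.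
Qed.

(** A program adds at most one cell per step, so the time bound also bounds the result. Compositions
    use this to bound the input of the second program. *)
Lemma FP_size A B {EA : Enc A} {EB : Enc B} (f : A -> B) : FP f ->
  exists k, forall a, tsz (f a) <= poly_bound k (tsz a).
Proof.
move=> [c [k h]]; have [l lP] := pbounded_add pbounded_id (pbounded_pb k).
exists l => a; apply: leq_trans (lP _).
have [n /exec_stsize] := h a [::] [::] [::] [::].
rewrite /stsize /= !cats0 !addn0 => e le; apply: leq_trans e _.
by rewrite leq_add2l.
Qed.

Lemma FP_recode A B {EA : Enc A} {EB : Enc B} (f : A -> B) :
  (forall a, tenc (f a) = tenc a) -> FP f.
Proof.
move=> e; apply: (@FP_intro _ _ _ _ _ Skip (fun=> 1)); first exact: pbounded_const.
by move=> a r0 r1 r2 r3; rewrite /tcd e; apply: runs_sl.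
Qed.

Lemma FP_id A {EA : Enc A} : FP (fun a : A => a).
Proof. exact: FP_recode. Qed.

Lemma FP_comp A B C {EA : Enc A} {EB : Enc B} {EC : Enc C} (g : B -> C) (f : A -> B) :
  FP g -> FP f -> FP (fun a => g (f a)).
Proof.
move=> [cg [kg hg]] Ff; have [l lP] := FP_size Ff; case: Ff => cf [kf hf].
apply: (@FP_intro _ _ _ _ _ (Seq cf cg)
  (fun m => poly_bound kf m + poly_bound kg (poly_bound l m))); first by pbd.
move=> a r0 r1 r2 r3; apply: runs_seq (hf _ _ _ _ _) _.
by apply: runs_le (hg _ _ _ _ _) _; apply: poly_bound_mono.
Qed.

Lemma FP_const A B {EA : Enc A} {EB : Enc B} (b : B) : FP (fun _ : A => b).
Proof.
apply: (@FP_intro _ _ _ _ _ (Seq dropt (pushw (tcd b))) (fun m => 50 * m + (2 * tsz b + 1))).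
  by pbd.
by move=> a r0 r1 r2 r3; apply: runs_seq (dropt_runs _ _ _ _ _) _; apply: pushw_runs.
Qed.

Lemma FP_pair A B C {EA : Enc A} {EB : Enc B} {EC : Enc C} (f : A -> B) (g : A -> C) :
  FP f -> FP g -> FP (fun a => (f a, g a)).
Proof.
move=> [cf [kf hf]] Fg; have [l lP] := FP_size Fg; case: Fg => cg [kg hg].
apply: (@FP_intro _ _ _ _ _ (Seq dup (Seq cg (Seq swap (Seq cf (Push I0 true)))))
  (fun m => 100 * m + (poly_bound kg m + (50 * (poly_bound l m + m) + (poly_bound kf m + 2))))).
  by pbd.
move=> a r0 r1 r2 r3; apply: runs_seq (dup_runs _ _ _ _ _) _.
apply: runs_seq (hg _ _ _ _ _) _.
apply: runs_seq.
  by apply: runs_le (swap_runs _ _ _ _ _ _) _; rewrite leq_mul2l /= leq_add2r lP.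
apply: runs_seq (hf _ _ _ _ _) _.
by apply: runs_sl => //=; rewrite /tcd /= -catA.
Qed.

Lemma FP_fst A B C {EA : Enc A} {EB : Enc B} {EC : Enc C} (f : A -> B * C) :
  FP f -> FP (fun a => (f a).1).
Proof.
apply: (@FP_comp _ _ _ _ _ _ fst).
apply: (@FP_intro _ _ _ _ _ (Seq (Pop I0) (Seq swap dropt)) (fun m => 1 + (50 * m + 50 * m))).
  by pbd.
case=> b c r0 r1 r2 r3; rewrite tsz_pair.
apply: (@runs_seq _ _ _ (S4 (tcode (tenc b) ++ tcode (tenc c) ++ r0) r1 r2 r3)).
  by apply: runs_sl; rewrite //= -catA.
apply: (@runs_seq _ _ _ (S4 (tcode (tenc c) ++ tcode (tenc b) ++ r0) r1 r2 r3)).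
  by apply: runs_le (swap_runs _ _ _ _ _ _) _; rewrite /tsz /tcd; lia.
by apply: runs_le (dropt_runs _ _ _ _ _) _; rewrite /tsz /tcd; lia.
Qed.

Lemma FP_snd A B C {EA : Enc A} {EB : Enc B} {EC : Enc C} (f : A -> B * C) :
  FP f -> FP (fun a => (f a).2).
Proof.
apply: (@FP_comp _ _ _ _ _ _ snd).
apply: (@FP_intro _ _ _ _ _ (Seq (Pop I0) dropt) (fun m => 1 + 50 * m)).
  by pbd.
case=> b c r0 r1 r2 r3; rewrite tsz_pair.
apply: (@runs_seq _ _ _ (S4 (tcode (tenc b) ++ tcode (tenc c) ++ r0) r1 r2 r3)).
  by apply: runs_sl; rewrite //= -catA.
by apply: runs_le (dropt_runs _ _ _ _ _) _; rewrite /tsz /tcd; lia.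
Qed.

Lemma FP_cons A B {EA : Enc A} {EB : Enc B} (f : A -> B) (s : A -> seq B) :
  FP f -> FP s -> FP (fun a => f a :: s a).
Proof.
move=> Ff Fs; apply: (@FP_comp _ _ _ _ _ _ (fun p : B * seq B => p.1 :: p.2) (fun a => (f a, s a))).
  exact: FP_recode.
exact: FP_pair.
Qed.

(** Matching on a list in the form of a function, so that it has a closure lemma; the conditional,
    [head] and [behead] are reduced to it. *)
Definition scase X B (s : seq X) (h : B) (g : X -> seq X -> B) : B :=
  if s is x :: s' then g x s' else h.

Lemma FP_scase A B X {EA : Enc A} {EB : Enc B} {EX : Enc X}
    (s : A -> seq X) (h : A -> B) (g : A -> X -> seq X -> B) :
  FP s -> FP h -> FP (fun p : A * (X * seq X) => g p.1 p.2.1 p.2.2) ->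
  FP (fun a => scase (s a) (h a) (g a)).
Proof.
move=> Fs [ch [kh hh]] [cg [kg hg]]; have [l lP] := FP_size Fs; case: Fs => cs [ks hs].
apply: (@FP_intro _ _ _ _ _ (Seq dup (Seq cs (If I0 top1
    (Seq swap (Seq (Push I0 true) cg)) (Seq (Pop I0) ch))))
  (fun m => 100 * m + (poly_bound ks m +
     ((50 * (poly_bound l m + m) + (2 + poly_bound kg (m + poly_bound l m + 1))) +
     (1 + poly_bound kh m) + 1)))).
  pbd.
move=> a r0 r1 r2 r3; apply: runs_seq (dup_runs _ _ _ _ _) _.
apply: runs_seq (hs _ _ _ _ _) _; move: (lP a); case: (s a) => [|x s'] /= la.
  apply: (@runs_le _ _ _ (1 + poly_bound kh (tsz a)).+1); last by lia.
  apply: runs_ifF => //; apply: runs_seq (hh _ _ _ _ _).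
  exact: runs_sl.
apply: (@runs_le _ _ _ (50 * (poly_bound l (tsz a) + tsz a) +
  (2 + poly_bound kg (tsz a + poly_bound l (tsz a) + 1))).+1); last by lia.
apply: runs_ifT => //; apply: runs_seq.
  apply: runs_le (swap_runs (tenc (x :: s')) (tenc a) _ _ _ _) _.
  by rewrite leq_mul2l /= leq_add2r la.
apply: runs_seq.
  (* A nonempty list has the code of the pair of its head and tail, so one pushed bit yields the
     code of [(a, (x, s'))]. *)
  by apply: (@runs_sl _ _ (S4 (tcd (a, (x, s')) ++ r0) r1 r2 r3)) => //; rewrite tcd_pair.
apply: runs_le (hg (a, (x, s')) _ _ _ _) _; apply: poly_bound_mono => //.
by rewrite tsz_pair -addn1 leq_add2r leq_add2l.
Qed.

Definition fbounded A X C {EA : Enc A} {EX : Enc X} {EC : Enc C}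
    (f : A -> C -> X -> C) (z : A -> C) (s : A -> seq X) :=
  exists k, forall a i, tsz (foldl (f a) (z a) (take i (s a))) <= poly_bound k (tsz a).

(** Polynomially many polynomial steps may still blow up, as when each of them doubles the
    accumulator; hence the bound on all intermediate accumulators. *)
Lemma FP_foldl A X C {EA : Enc A} {EX : Enc X} {EC : Enc C}
    (f : A -> C -> X -> C) (z : A -> C) (s : A -> seq X) :
  FP (fun p : A * (C * X) => f p.1 p.2.1 p.2.2) -> FP z -> FP s -> fbounded f z s ->
  FP (fun a => foldl (f a) (z a) (s a)).
Proof.
move=> Ff Fz Fs [kb hb]; have [l lP] := FP_size Fs.
pose T := (seq X * (A * C))%type.
pose step (t : T) : T :=
  scase t.1 ([::], t.2) (fun x s' => (s', (t.2.1, f t.2.1 t.2.2 x))).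
have Fp : FP (fun a => ((s a, (a, z a)) : T)).
  by apply: FP_pair => //; apply: FP_pair => //; apply: FP_id.
have Fstep : FP step.
  apply: FP_scase.
  - exact/FP_fst/FP_id.
  - by apply: FP_pair; [apply: FP_const | apply/FP_snd/FP_id].
  - apply: FP_pair; first by do 2 apply: FP_snd; apply: FP_id.
    have F1 : FP (fun p : T * (X * seq X) => p.1.2.1) by apply/FP_fst/FP_snd/FP_fst/FP_id.
    have F2 : FP (fun p : T * (X * seq X) => p.1.2.2) by apply/FP_snd/FP_snd/FP_fst/FP_id.
    have F3 : FP (fun p : T * (X * seq X) => p.2.1) by apply/FP_fst/FP_snd/FP_id.
    apply: FP_pair => //.
    exact: (FP_comp Ff (FP_pair F1 (FP_pair F2 F3))).
case: Fstep => cs [ks hs]; case: Fp => cp [kp hp].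
(* The stack holds the remaining list followed by the pair of [a] and the accumulator, without the
   leading bit of the outer pair, so that the loop test sees whether the list is empty. *)
pose loop := While I0 top1 (Seq (Push I0 true) (Seq cs (Pop I0))).
enough (F : FP (fun a => (a, foldl (f a) (z a) (s a)))) by exact (FP_snd F).
pose q m := poly_bound ks (poly_bound l m + (m + poly_bound kb m + 1) + 1) + 4.
have qb : pbounded q by rewrite /q; pbd.
apply: (@FP_intro _ _ _ _ _ (Seq cp (Seq (Pop I0) (Seq loop (Pop I0))))
  (fun m => poly_bound kp m + (1 + ((1 + poly_bound l m * q m) + 1)))); first by pbd.
move=> a r0 r1 r2 r3; apply: runs_seq (hp _ _ _ _ _) _.
apply: (@runs_seq _ _ _ (S4 (tcd (s a) ++ tcd (a, z a) ++ r0) r1 r2 r3)).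
  by apply: runs_sl => //=; rewrite -catA.
set c' := foldl _ _ _.
apply: (@runs_seq _ _ _ (S4 (tcd ([::] : seq X) ++ tcd (a, c') ++ r0) r1 r2 r3)); last first.
  exact: runs_sl.
have sP := lP.
have {}lP : size (s a) <= poly_bound l (tsz a).
  by apply: leq_trans (lP a); have := @size_tsz _ EX (s a); lia.
apply: (@runs_le _ _ _ (1 + size (s a) * q (tsz a))); last by rewrite leq_add2l leq_mul2r lP orbT.
have main i : i <= size (s a) -> runs loop
    (S4 (tcd (drop i (s a)) ++ tcd (a, foldl (f a) (z a) (take i (s a))) ++ r0) r1 r2 r3)
    (S4 (tcd ([::] : seq X) ++ tcd (a, c') ++ r0) r1 r2 r3) (1 + (size (s a) - i) * q (tsz a)).
  move ej : (size (s a) - i) => j; elim: j i ej => [|j IH] i ej le.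
    have -> : i = size (s a) by lia.
    rewrite drop_size take_size; exact: runs_whileF.
  have lt : i < size (s a) by lia.
  have x : X by case: (s a) lt.
  set ci := foldl (f a) (z a) (take i (s a)).
  have es : step (drop i (s a), (a, ci)) =
      (drop i.+1 (s a), (a, foldl (f a) (z a) (take i.+1 (s a)))).
    by rewrite /step (drop_nth x lt) /= (take_nth x lt) foldl_rcons.
  have ci_le : tsz ci <= poly_bound kb (tsz a) by apply: hb.
  have T_le : tsz ((drop i (s a), (a, ci)) : T) <=
      poly_bound l (tsz a) + (tsz a + poly_bound kb (tsz a) + 1) + 1.
    rewrite !tsz_pair; have := @tsz_drop _ EX (s a) i; have := sP a; lia.
  apply: (@runs_le _ _ _ ((q (tsz a) - 1) + (1 + j * q (tsz a))).+1); last first.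
    by rewrite mulSn /q; lia.
  apply: runs_whileT; last by apply: (IH i.+1) => //; lia.
    by rewrite (drop_nth x lt).
  apply: (@runs_le _ _ _ (2 + (poly_bound ks (tsz ((drop i (s a), (a, ci)) : T)) + 1))); last first.
    by rewrite /q; have := poly_bound_mono (leqnn ks) T_le; lia.
  apply: (@runs_seq _ _ _ (S4 (tcd ((drop i (s a), (a, ci)) : T) ++ r0) r1 r2 r3)).
    by apply: runs_sl => //; rewrite !tcd_pair.
  apply: runs_seq (hs _ _ _ _ _) _; rewrite es.
  by apply: runs_sl => //; rewrite !tcd_pair.
by have := main 0 (leq0n _); rewrite drop0 take0 subn0.
Qed.

(** * A library of polynomial time functions *)

(** Known functions are registered as instances by their arity, so that the tactic [fp] finds them
    from the form of a term. *)
Class FP1 {A B} {EA : Enc A} {EB : Enc B} (F : A -> B) := fp1 : FP F.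
Class FP2 {A B C} {EA : Enc A} {EB : Enc B} {EC : Enc C} (F : A -> B -> C) :=
  fp2 : FP (fun p : A * B => F p.1 p.2).
Class FP3 {A B C D} {EA : Enc A} {EB : Enc B} {EC : Enc C} {ED : Enc D}
  (F : A -> B -> C -> D) := fp3 : FP (fun p : A * (B * C) => F p.1 p.2.1 p.2.2).

Lemma FP_app1 Z A B {EZ : Enc Z} {EA : Enc A} {EB : Enc B} (F : A -> B) {HF : FP1 F}
  (u : Z -> A) : FP u -> FP (fun z => F (u z)).
Proof. exact: FP_comp. Qed.

Lemma FP_app2 Z A B C {EZ : Enc Z} {EA : Enc A} {EB : Enc B} {EC : Enc C}
  (F : A -> B -> C) {HF : FP2 F} (u : Z -> A) (v : Z -> B) :
  FP u -> FP v -> FP (fun z => F (u z) (v z)).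
Proof. by move=> Fu Fv; apply: (FP_comp HF (FP_pair Fu Fv)). Qed.

Lemma FP_app3 Z A B C D {EZ : Enc Z} {EA : Enc A} {EB : Enc B} {EC : Enc C} {ED : Enc D}
  (F : A -> B -> C -> D) {HF : FP3 F} (u : Z -> A) (v : Z -> B) (w : Z -> C) :
  FP u -> FP v -> FP w -> FP (fun z => F (u z) (v z) (w z)).
Proof. by move=> Fu Fv Fw; apply: (FP_comp HF (FP_pair Fu (FP_pair Fv Fw))). Qed.

Lemma FP_if A B {EA : Enc A} {EB : Enc B} (b : A -> bool) (f g : A -> B) :
  FP b -> FP f -> FP g -> FP (fun a => if b a then f a else g a).
Proof.
move=> Fb Ff Fg.
apply: (@FP_ext _ _ _ _ (fun a => scase (nseq (b a) tt) (g a) (fun _ _ => f a))).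
  by move=> a; case: (b a).
apply: FP_scase => //; last by apply: (@FP_app1 _ _ _ _ _ _ f Ff); apply/FP_fst/FP_id.
apply: (@FP_comp _ _ _ _ _ _ (fun b : bool => nseq b tt)) => //.
by apply: FP_recode; case.
Qed.

(** A step adds an amount that depends on [a] and on the list entry but not on the accumulator.
    There is no feedback, so the total growth is at most the length of the list times one
    polynomial. *)
Lemma fbounded_add A X C {EA : Enc A} {EX : Enc X} {EC : Enc C}
    (f : A -> C -> X -> C) (z : A -> C) (s : A -> seq X) :
  FP z -> FP s ->
  (exists k, forall a c x, tsz (f a c x) <= tsz c + poly_bound k (tsz a + tsz x)) ->
  fbounded f z s.
Proof.
move=> Fz Fs [k h]; have [l lP] := FP_size Fs; have [m mP] := FP_size Fz.
pose q n := poly_bound m n + poly_bound l n * poly_bound k (n + poly_bound l n).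
have [kq kqP] : pbounded q by rewrite /q; pbd.
exists kq => a i; apply: leq_trans (kqP _); rewrite /q.
have main t c : tsz t <= tsz (s a) ->
    tsz (foldl (f a) c t) <= tsz c + size t * poly_bound k (tsz a + poly_bound l (tsz a)).
  elim: t c => [|x t IH] c /=; first by rewrite addn0.
  rewrite tsz_cons => le; apply: leq_trans (IH _ _) _; first by lia.
  rewrite mulSn addnA leq_add2r; apply: leq_trans (h _ _ _) _.
  rewrite leq_add2l; apply: poly_bound_mono => //; have := lP a; lia.
have tk : tsz (take i (s a)) <= tsz (s a).
  elim: (s a) i => [|x s' IH] [|i]; [exact: leqnn | exact: leqnn | exact: (@tsz_gt0 _ _ (x :: s')) |].
  by rewrite [take _ _]/= !tsz_cons ltnS leq_add2l; apply: IH.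
apply: leq_trans (main _ _ tk) _; apply: leq_add; first exact: mP.
rewrite leq_mul2r; apply/orP; right; apply: leq_trans (lP a).
by have := @size_tsz _ EX (take i (s a)); lia.
Qed.

Lemma FP_foldl_add A X C {EA : Enc A} {EX : Enc X} {EC : Enc C}
    (f : A -> C -> X -> C) (z : A -> C) (s : A -> seq X) :
  FP (fun p : A * (C * X) => f p.1 p.2.1 p.2.2) -> FP z -> FP s ->
  (exists k, forall a c x, tsz (f a c x) <= tsz c + poly_bound k (tsz a + tsz x)) ->
  FP (fun a => foldl (f a) (z a) (s a)).
Proof. by move=> *; apply: FP_foldl => //; apply: fbounded_add. Qed.

Lemma bound1 (p : nat -> nat) A X C {EA : Enc A} {EX : Enc X} {EC : Enc C}
    (f : A -> C -> X -> C) : pbounded p ->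
  (forall a c x, tsz (f a c x) <= tsz c + p (tsz a + tsz x)) ->
  exists k, forall a c x, tsz (f a c x) <= tsz c + poly_bound k (tsz a + tsz x).
Proof.
by move=> [k kP] h; exists k => a c x; apply: leq_trans (h _ _ _) _; rewrite leq_add2l.
Qed.

Lemma FP_rev A B {EA : Enc A} {EB : Enc B} (s : A -> seq B) : FP s -> FP (fun a => rev (s a)).
Proof.
apply: (@FP_comp _ _ _ _ _ _ rev).
apply: (@FP_ext _ _ _ _ (fun s => foldl (fun c x => x :: c) [::] s)).
  by move=> t; rewrite /rev; elim: t [::] => //= x t IH u; rewrite IH.
apply: (@FP_foldl_add _ _ _ _ _ _ (fun _ c x => x :: c)) => //.
- by apply: FP_cons; [apply/FP_snd/FP_snd/FP_id | apply/FP_fst/FP_snd/FP_id].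
- exact: FP_const.
- exact: FP_id.
- by apply: (@bound1 S); [pbd | move=> a c x; rewrite tsz_cons; lia].
Qed.

Lemma FP_map A X Y {EA : Enc A} {EX : Enc X} {EY : Enc Y} (g : A -> X -> Y) (s : A -> seq X) :
  FP (fun p : A * X => g p.1 p.2) -> FP s -> FP (fun a => map (g a) (s a)).
Proof.
move=> Fg Fs.
apply: (@FP_ext _ _ _ _ (fun a => rev (foldl (fun c x => g a x :: c) [::] (s a)))).
  move=> a; rewrite -[RHS]revK; congr rev; rewrite -[RHS]cats0.
  by elim: (s a) [::] => [|x t IH] u //=; rewrite IH rev_cons cat_rcons.
apply/FP_rev/FP_foldl_add => //.
- apply: FP_cons; last by apply/FP_fst/FP_snd/FP_id.
  by apply: (@FP_app2 _ _ _ _ _ _ _ _ g Fg); [apply/FP_fst/FP_id | apply/FP_snd/FP_snd/FP_id].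
- exact: FP_const.
- have [k kP] := FP_size Fg; apply: (@bound1 (fun n => (poly_bound k n.+1).+1)); last first.
    by move=> a c x; rewrite tsz_cons; have /= := kP (a, x); rewrite tsz_pair; lia.
  apply: (pbounded_add (pbounded_const 1)); apply: (pbounded_comp (pbounded_pb k)).
  by pbd.
Qed.

(** A hook in the recursion on the body of a function; it is redefined when closure lemmas for
    further forms of terms are available. *)
Ltac fp_ext := fail.

Ltac fp_fun :=
  match goal with
  | |- FP (fun x => ?F (@?u x) (@?v x) (@?w x)) =>
      apply (FP_app3 (F := F) (u := u) (v := v) (w := w))
  | |- FP (fun x => ?F (@?u x) (@?v x)) => apply (FP_app2 (F := F) (u := u) (v := v))
  | |- FP (fun x => ?F (@?u x)) => apply (FP_app1 (F := F) (u := u))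
  end.

Ltac fp_hyp := match goal with H : FP _ |- FP _ => exact H end.

Ltac fp_eta :=
  cbv beta;
  lazymatch goal with
  | |- @FP ?A ?B ?EA ?EB ?f =>
    lazymatch f with
    | (fun x => _) => idtac
    | _ => change (@FP A B EA EB (fun x => f x))
    end
  end.

Ltac fp_step :=
  fp_eta;
  lazymatch goal with
  | |- FP (fun x => x) => apply FP_id
  | |- FP (fun x => fst (@?f x)) => apply (FP_fst (f := f))
  | |- FP (fun x => snd (@?f x)) => apply (FP_snd (f := f))
  | |- FP (fun x => pair (@?f x) (@?g x)) => apply (FP_pair (f := f) (g := g))
  | _ => first
    [ apply FP_const
    | fp_hyp
    | fp_ext
    | lazymatch goal with
      | |- FP (fun x => cons (@?f x) (@?g x)) => apply (FP_cons (f := f) (s := g))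
      | |- FP (fun x => scase (@?s x) (@?h x) (@?g x)) => apply (FP_scase (s := s) (h := h) (g := g))
      | |- FP (fun x => map (@?g x) (@?s x)) => apply (FP_map (g := g) (s := s))
      | |- FP (fun x => rev (@?s x)) => apply (FP_rev (s := s))
      end
    | fp_fun
    | apply FP_if ]
  end.
Ltac fp := repeat fp_step.

Lemma FP_nseq_tt A {EA : Enc A} (n : A -> nat) : FP n -> FP (fun a => nseq (n a) tt).
Proof.
apply: (@FP_comp _ _ _ _ _ _ (fun n => nseq n tt)); apply: FP_recode.
by elim=> // n0 IH; congr (Node Leaf _).
Qed.

Lemma FP_iter A C {EA : Enc A} {EC : Enc C} (n : A -> nat) (f : A -> C -> C) (z : A -> C) :
  FP (fun p : A * C => f p.1 p.2) -> FP z -> FP n ->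
  (exists k, forall a i, i <= n a -> tsz (iter i (f a) (z a)) <= poly_bound k (tsz a)) ->
  FP (fun a => iter (n a) (f a) (z a)).
Proof.
move=> Ff Fz Fn [k kP].
have e i m (a : A) : foldl (fun c (_ : unit) => f a c) (z a) (take i (nseq m tt)) =
    iter (minn i m) (f a) (z a).
  have -> : take i (nseq m tt) = nseq (minn i m) tt.
    have [le|lt] := leqP i m; first by rewrite take_nseq.
    by rewrite take_oversize // size_nseq ltnW.
  by elim: (minn i m) (z a) => //= j IH z'; rewrite IH -iterSr.
apply: (@FP_ext _ _ _ _ (fun a => foldl (fun c _ => f a c) (z a) (nseq (n a) tt))).
  by move=> a; have := e (n a) (n a) a; rewrite take_oversize ?size_nseq // minnn.
apply: (@FP_foldl _ _ _ _ _ _ (fun a c _ => f a c)).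
- by apply: (@FP_app2 _ _ _ _ _ _ _ _ f Ff); fp.
- by [].
- exact: FP_nseq_tt.
- exists k => a i; rewrite e; apply: kP; exact: geq_minr.
Qed.

#[export] Instance fp_size X {EX : Enc X} : FP1 (@size X).
Proof.
apply: (@FP_ext _ _ _ _ (fun s => size (foldl (fun c (_ : X) => tt :: c) [::] s))).
  move=> s; rewrite -[RHS]add0n -[X in _ = X + _]/(size (Nil unit)).
  by elim: s [::] => [|x s IH] c /=; rewrite ?addn0 // IH /= addSnnS.
apply: (@FP_comp _ _ _ _ _ _ (fun s : seq unit => size s)).
  by apply: FP_recode; elim=> //= -[] s; rewrite /tenc /= => ->.
apply: (@FP_foldl_add _ _ _ _ _ _ (fun _ c _ => tt :: c)); fp.
by apply: (@bound1 (fun=> 2)); [pbd | move=> a c x; rewrite tsz_cons -addSn addnC leq_add2l].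
Qed.

#[export] Instance fp_succ : FP1 S.
Proof.
apply: (@FP_ext _ _ _ _ (fun n => size (tt :: nseq n tt))).
  by move=> n /=; rewrite size_nseq.
by fp; apply/FP_nseq_tt/FP_id.
Qed.

#[export] Instance fp_pred : FP1 predn.
Proof.
apply: (@FP_ext _ _ _ _ (fun n => scase (nseq n tt) 0 (fun _ s => size s))).
  by case=> //= n; rewrite size_nseq.
by apply: FP_scase; [apply/FP_nseq_tt/FP_id | fp | fp].
Qed.

#[export] Instance fp_addn : FP2 addn.
Proof.
apply: (@FP_ext _ _ _ _ (fun p => iter p.1 S p.2)) => [[m n] /=|].
  by rewrite iter_succn addnC.
apply: (@FP_iter _ _ _ _ _ (fun _ => S)); fp.
exists 4 => -[m n] i /= le; rewrite iter_succn tsz_pair !tsz_nat.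
apply: (@leq_trans (poly_bound 1 (m.*2.+1 + n.*2.+1).+1)).
  by rewrite /poly_bound mul1n expn1; lia.
exact: poly_bound_mono.
Qed.

#[export] Instance fp_subn : FP2 subn.
Proof.
apply: (@FP_ext _ _ _ _ (fun p => iter p.2 predn p.1)) => [[m n] /=|].
  by rewrite iter_predn.
apply: (@FP_iter _ _ _ _ _ (fun _ => predn)); fp.
exists 1 => -[m n] i /= le; rewrite iter_predn tsz_pair !tsz_nat.
by rewrite /poly_bound mul1n expn1; lia.
Qed.

#[export] Instance fp_muln : FP2 muln.
Proof.
apply: (@FP_ext _ _ _ _ (fun p => iter p.1 (addn p.2) 0)) => [[m n] /=|].
  by rewrite iter_addn_0 mulnC.
apply: (@FP_iter _ _ _ _ _ (fun p => addn p.2)); fp.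
exists 3 => -[m n] i /= le; rewrite iter_addn_0 tsz_pair !tsz_nat /poly_bound.
set x := (_ + _).+2; have h : n * i <= x ^ 2 by rewrite /x expnS expn1; nia.
have : 1 < x by []; rewrite (expnS _ 2); nia.
Qed.

#[export] Instance fp_nilp X {EX : Enc X} : FP1 (@nilp X).
Proof.
apply: (@FP_ext _ _ _ _ (fun s => scase s true (fun _ _ => false))); first by case.
by fp.
Qed.

#[export] Instance fp_negb : FP1 negb.
Proof.
by apply: (@FP_ext _ _ _ _ (fun b : bool => if b then false else true)); [case | fp].
Qed.

#[export] Instance fp_andb : FP2 andb.
Proof.
by apply: (@FP_ext _ _ _ _ (fun p : bool * bool => if p.1 then p.2 else false)); [do 2 case | fp].
Qed.

#[export] Instance fp_orb : FP2 orb.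
Proof.
by apply: (@FP_ext _ _ _ _ (fun p : bool * bool => if p.1 then true else p.2)); [do 2 case | fp].
Qed.

#[export] Instance fp_addb : FP2 addb.
Proof.
by apply: (@FP_ext _ _ _ _ (fun p : bool * bool => if p.1 then ~~ p.2 else p.2)); [do 2 case | fp].
Qed.

#[export] Instance fp_leq : FP2 leq.
Proof.
apply: (@FP_ext _ _ _ _ (fun p => nilp (nseq (p.1 - p.2) tt))) => [[m n]|].
  by rewrite /nilp size_nseq.
by fp; apply: FP_nseq_tt; fp.
Qed.

#[export] Instance fp_eqn : FP2 (fun m n : nat => m == n).
Proof.
apply: (@FP_ext _ _ _ _ (fun p => (p.1 <= p.2) && (p.2 <= p.1))) => [[m n]|].
  by rewrite eqn_leq.
by fp.
Qed.

#[export] Instance fp_eqb : FP2 (fun m n : bool => m == n).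
Proof.
by apply: (@FP_ext _ _ _ _ (fun p => ~~ (p.1 (+) p.2))) => [[[] []]|] //; fp.
Qed.

#[export] Instance fp_cat X {EX : Enc X} : FP2 (@cat X).
Proof.
apply: (@FP_ext _ _ _ _ (fun p => foldl (fun c x => x :: c) p.2 (rev p.1))) => [[s t] /=|].
  elim: s t => [|x s IH] t //=; rewrite rev_cons -cats1 foldl_cat /= IH //.
apply: (@FP_foldl_add _ _ _ _ _ _ (fun _ c x => x :: c)); fp.
by apply: (@bound1 S); [pbd | move=> a c x; rewrite tsz_cons; lia].
Qed.

#[export] Instance fp_rcons X {EX : Enc X} : FP2 (@rcons X).
Proof. by apply: (@FP_ext _ _ _ _ (fun p => p.1 ++ [:: p.2])) => [[s x]|]; rewrite ?cats1 //; fp. Qed.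

#[export] Instance fp_flatten X {EX : Enc X} : FP1 (@flatten X).
Proof.
apply: (@FP_ext _ _ _ _ (fun ss => foldl (fun c s => c ++ s) [::] ss)) => [ss|].
  rewrite -[RHS]cat0s; elim: ss [::] => [|s ss IH] t /=; first by rewrite cats0.
  by rewrite IH catA.
apply: (@FP_foldl_add _ _ _ _ _ _ (fun _ c s => c ++ s)); fp.
apply: (@bound1 id); [pbd | move=> a c x]; have := @tsz_cat _ EX c x; lia.
Qed.

Lemma FP_expn A {EA : Enc A} (u : A -> nat) k : FP u -> FP (fun a => u a ^ k).
Proof.
move=> Fu; elim: k => [|k IH]; first exact: FP_const.
apply: (@FP_ext _ _ _ _ (fun a => u a * u a ^ k)); first by move=> a; rewrite expnS.
exact: (@FP_app2 _ _ _ _ _ _ _ _ muln).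
Qed.

Lemma FP_filter A X {EA : Enc A} {EX : Enc X} (g : A -> X -> bool) (s : A -> seq X) :
  FP2 g -> FP s -> FP (fun a => filter (g a) (s a)).
Proof.
move=> Fg Fs.
apply: (@FP_ext _ _ _ _ (fun a => flatten (map (fun x => if g a x then [:: x] else [::]) (s a)))).
  by move=> a; elim: (s a) => //= x t ->; case: (g a x).
by fp.
Qed.

Ltac fp_ext ::= lazymatch goal with
  | |- FP (fun x => filter (@?g x) (@?s x)) => apply (FP_filter (g := g) (s := s)); [unfold FP2|]
  end.

Lemma FP_has A X {EA : Enc A} {EX : Enc X} (g : A -> X -> bool) (s : A -> seq X) :
  FP2 g -> FP s -> FP (fun a => has (g a) (s a)).
Proof.
move=> Fg Fs; apply: (@FP_ext _ _ _ _ (fun a => ~~ nilp (filter (g a) (s a)))).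
  by move=> a; elim: (s a) => //= x t IH; case: (g a x).
by fp.
Qed.

Ltac fp_ext ::= lazymatch goal with
  | |- FP (fun x => filter (@?g x) (@?s x)) => apply (FP_filter (g := g) (s := s)); [unfold FP2|]
  | |- FP (fun x => eq_op (@?u x) (@?v x)) => first
      [ apply (FP_app2 (F := fun m n : nat => m == n) (u := u) (v := v))
      | apply (FP_app2 (F := fun m n : bool => m == n) (u := u) (v := v))
      | apply (FP_app2 (F := fun m n : nat * nat * nat => m == n) (u := u) (v := v)) ]
  | |- FP (fun x => has (@?g x) (@?s x)) => apply (FP_has (g := g) (s := s)); [unfold FP2|]
  | |- FP (fun x => nseq (@?n x) tt) => apply (FP_nseq_tt (n := n))
  | |- FP (fun x => expn (@?n x) ?k) => apply (FP_expn (u := n))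
  end.

#[export] Instance fp_behead X {EX : Enc X} : FP1 (@behead X).
Proof.
by apply: (@FP_ext _ _ _ _ (fun s => scase s [::] (fun _ t => t))); [case | fp].
Qed.

#[export] Instance fp_head X {EX : Enc X} : FP2 (@head X).
Proof.
by apply: (@FP_ext _ _ _ _ (fun p => scase p.2 p.1 (fun x _ => x))); [case=> ? [] | fp].
Qed.

#[export] Instance fp_drop X {EX : Enc X} : FP2 (@drop X).
Proof.
have e n (s : seq X) : iter n behead s = drop n s.
  by elim: n s => [|n IH] s; rewrite ?drop0 // iterSr IH; case: s.
apply: (@FP_ext _ _ _ _ (fun p => iter p.1 behead p.2)) => [[n s] //|].
apply: (@FP_iter _ _ _ _ _ (fun _ => behead)); fp.
exists 1 => -[m n] i /= le; rewrite e tsz_pair /poly_bound mul1n expn1.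
by have := @tsz_drop _ EX n i; lia.
Qed.

#[export] Instance fp_nth X {EX : Enc X} : FP3 (@nth X).
Proof.
apply: (@FP_ext _ _ _ _ (fun p => head p.1 (drop p.2.2 p.2.1))); last by fp.
by case=> x [s i] /=; rewrite -nth0 nth_drop addn0.
Qed.

#[export] Instance fp_take X {EX : Enc X} : FP2 (@take X).
Proof.
apply: (@FP_ext _ _ _ _ (fun p => rev (drop (size p.2 - p.1) (rev p.2)))) => [[n s] /=|].
  have [le|lt] := leqP n (size s).
    by rewrite -rev_take ?revK ?leq_subr // subKn.
  by rewrite take_oversize ?(ltnW lt) // (eqP (ltnW lt)) drop0 revK.
by fp.
Qed.

#[export] Instance fp_iota : FP2 iota.
Proof.
have e m n : iter n (fun s => rcons s (m + size s)) [::] = iota m n.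
  by elim: n => // n IH; rewrite iterS IH size_iota -cats1 -(addn1 n) iotaD.
apply: (@FP_ext _ _ _ _ (fun p => iter p.2 (fun s => rcons s (p.1 + size s)) [::])) => [[m n]|] //.
apply: (@FP_iter _ _ _ _ _ (fun p s => rcons s (p.1 + size s))); fp.
have h m n : tsz (iota m n) <= n * (m + n).+1.*2 + 1.
  elim: n m => [|n IH] m //=; rewrite tsz_cons tsz_nat; have := IH m.+1; nia.
exists 3 => -[m n] i /= le; rewrite e; apply: leq_trans (h _ _) _.
rewrite tsz_pair !tsz_nat /poly_bound; set x := (_ + _).+2.
have : i * (m + i).+1.*2 <= 2 * x ^ 2 by rewrite /x expnS expn1; nia.
have : 1 < x by []; rewrite (expnS _ 2); nia.
Qed.

#[export] Instance fp_nseq X {EX : Enc X} : FP2 (@nseq X).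
Proof.
apply: (@FP_ext _ _ _ _ (fun p => map (fun _ => p.2) (nseq p.1 tt))) => [[n x] /=|].
  by elim: n => //= n ->.
by apply: FP_map; [fp | apply: FP_nseq_tt; fp].
Qed.

#[export] Instance fp_poly_bound k : FP1 (poly_bound k).
Proof. by apply: (@FP_app2 _ _ _ _ _ _ _ _ muln); [fp | apply: FP_expn; fp]. Qed.

(** * Words *)

Definition mvw (i j : ix) : com :=
  While i isSome (If i top1 (Pop i ;; Push j true) (Pop i ;; Push j false)).

(** The input and output words are not self-delimiting: their end is recognized by an empty stack.
    These two conversions therefore run with all other stacks empty. *)
Definition to_tree : com :=
  mvw I0 I1 ;; Push I0 false ;;
  While I1 isSome (If I1 top1
    (Pop I1 ;; Push I0 false ;; Push I0 false ;; Push I0 true ;; Push I0 true)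
    (Pop I1 ;; Push I0 false ;; Push I0 true)).

Definition of_tree : com :=
  While I0 top1 (Pop I0 ;; If I0 top1
    (Pop I0 ;; Pop I0 ;; Pop I0 ;; Push I1 true) (Pop I0 ;; Push I1 false)) ;;
  Pop I0 ;; mvw I1 I0.

Lemma mvw01_runs w v :
  runs (mvw I0 I1) (S4 w v [::] [::]) (S4 [::] (rev w ++ v) [::] [::]) (1 + 5 * size w).
Proof.
elim: w v => [|x w IH] v; first by apply: runs_whileF.
apply: (@runs_le _ _ _ (4 + (1 + 5 * size w)).+1); last by rewrite /=; lia.
apply: (@runs_whileT _ _ _ _ (S4 w (x :: v) [::] [::])) => //.
  by apply: runs_sl => //; case: x.
by rewrite rev_cons cat_rcons; apply: IH.
Qed.

Lemma mvw10_runs w v :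
  runs (mvw I1 I0) (S4 v w [::] [::]) (S4 (rev w ++ v) [::] [::] [::]) (1 + 5 * size w).
Proof.
elim: w v => [|x w IH] v; first by apply: runs_whileF.
apply: (@runs_le _ _ _ (4 + (1 + 5 * size w)).+1); last by rewrite /=; lia.
apply: (@runs_whileT _ _ _ _ (S4 (x :: v) w [::] [::])) => //.
  by apply: runs_sl => //; case: x.
by rewrite rev_cons cat_rcons; apply: IH.
Qed.

Lemma to_tree_runs w :
  runs to_tree (S4 w [::] [::] [::]) (S4 (tcd w) [::] [::] [::]) (20 * (size w).+1).
Proof.
apply: (@runs_le _ _ _ ((1 + 5 * size w) + (2 + (1 + 11 * size w)))); last by lia.
apply: (@runs_seq _ _ _ (S4 [::] (rev w ++ [::]) [::] [::])).
  exact: mvw01_runs.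
rewrite cats0; apply: (@runs_seq _ _ _ (S4 (tcd ([::] : word)) (rev w) [::] [::])).
  exact: runs_sl.
enough (h : forall t v, runs (While I1 isSome (If I1 top1
    (Pop I1 ;; Push I0 false ;; Push I0 false ;; Push I0 true ;; Push I0 true)
    (Pop I1 ;; Push I0 false ;; Push I0 true))) (S4 (tcd v) t [::] [::])
    (S4 (tcd (rev t ++ v)) [::] [::] [::]) (1 + 11 * size t)).
  by have := h (rev w) [::]; rewrite revK cats0 size_rev.
elim=> [|x t IH] v; first exact: runs_whileF.
apply: (@runs_le _ _ _ (10 + (1 + 11 * size t)).+1); last by rewrite /=; lia.
apply: (@runs_whileT _ _ _ _ (S4 (tcd (x :: v)) t [::] [::])) => //.
  by apply: runs_sl => //; case: x.
by rewrite rev_cons cat_rcons; apply: IH.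
Qed.

Lemma of_tree_runs w :
  runs of_tree (S4 (tcd w) [::] [::] [::]) (S4 w [::] [::] [::]) (20 * (size w).+1).
Proof.
apply: (@runs_le _ _ _ ((1 + 9 * size w) + (1 + (1 + 5 * size w)))); last by lia.
apply: (@runs_seq _ _ _ (S4 [:: false] (rev w ++ [::]) [::] [::])).
  enough (h : forall v, runs (While I0 top1 (Pop I0 ;; If I0 top1
      (Pop I0 ;; Pop I0 ;; Pop I0 ;; Push I1 true) (Pop I0 ;; Push I1 false)))
      (S4 (tcd w) v [::] [::]) (S4 [:: false] (rev w ++ v) [::] [::]) (1 + 9 * size w)) by exact: h.
  elim: w => [|x w IH] v; first exact: runs_whileF.
  apply: (@runs_le _ _ _ (8 + (1 + 9 * size w)).+1); last by rewrite /=; lia.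
  apply: (@runs_whileT _ _ _ _ (S4 (tcd w) (x :: v) [::] [::])) => //.
    by apply: runs_sl => //; case: x.
  by rewrite rev_cons cat_rcons; apply: IH.
rewrite cats0; apply: (@runs_seq _ _ _ (S4 [::] (rev w) [::] [::])).
  exact: runs_sl.
by have := mvw10_runs (rev w) [::]; rewrite revK cats0 size_rev.
Qed.

Lemma tsz_word (w : word) : tsz w <= 4 * size w + 1.
Proof. by elim: w => // b w IH; rewrite tsz_cons /=; have := tsz_bool b; lia. Qed.

Lemma size_le_tsz (w : word) : size w <= tsz w.
Proof. by have := @size_tsz _ enc_bool w; lia. Qed.

Lemma FP_polytime (f : word -> word) : FP f ->
  exists (M : tm) (k : nat), forall w, computes_within M (poly_bound k (size w)) w (f w).
Proof.
move=> Ff; have [l lP] := FP_size Ff; case: Ff => c [k h].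
pose t m := 20 * m.+1 + (poly_bound k (4 * m + 1) + 20 * (poly_bound l (4 * m + 1)).+1).
have [K KP] : pbounded t.
  by rewrite /t; pbd.
exists (tm_of (to_tree ;; c ;; of_tree)), K => w.
apply: computes_within_mono (KP _) _.
have [n e le] : runs (to_tree ;; c ;; of_tree) (S4 w [::] [::] [::]) (S4 (f w) [::] [::] [::]) (t (size w)).
  apply: runs_seq (to_tree_runs _) _.
  apply: runs_seq.
    have := h w [::] [::] [::] [::]; rewrite !cats0 => h'; apply: runs_le h' _.
    by apply: poly_bound_mono (leqnn _) (tsz_word _).
  apply: runs_le (of_tree_runs _) _; rewrite leq_mul2l /= ltnS.
  apply: leq_trans (size_le_tsz _) _; apply: leq_trans (lP _) _.
  by apply: poly_bound_mono (leqnn _) (tsz_word _).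
by apply: computes_within_mono le _; apply: exec_computes e.
Qed.

Lemma polytime_FP (f : word -> word) : FP f -> polytime f.
Proof. by move=> /FP_polytime[M [k h]]; exists M, k. Qed.

(** * Encodings *)

#[export] Instance fp_half : FP1 half.
Proof.
apply: (@FP_ext _ _ _ _ (fun n => (iter n (fun p : bool * nat => (~~ p.1, if p.1 then p.2.+1 else p.2)) (false, 0)).2)).
  move=> n; suff -> : iter n (fun p : bool * nat => (~~ p.1, if p.1 then p.2.+1 else p.2)) (false, 0) = (odd n, n./2) by [].
  by elim: n => //= n ->; congr (_, _); rewrite uphalf_half; case: odd.
apply: FP_snd; apply: (@FP_iter _ _ _ _ _ (fun _ p => (~~ p.1, if p.1 then p.2.+1 else p.2))); fp.
exists 6 => n i le.
have -> : iter i (fun p : bool * nat => (~~ p.1, if p.1 then p.2.+1 else p.2)) (false, 0) = (odd i, i./2).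
  by elim: i {le} => //= i ->; congr (_, _); rewrite uphalf_half; case: odd.
rewrite tsz_pair !tsz_nat; have b3 := tsz_bool (odd i).
apply: (@leq_trans (6 * n.*2.+2)); first by lia.
by rewrite /poly_bound leq_mul2l /= -{1}(expn1 n.*2.+2) leq_pexp2l.
Qed.

#[export] Instance fp_odd : FP1 odd.
Proof.
apply: (@FP_ext _ _ _ _ (fun n => ~~ (n == (n./2 + n./2)))).
  by move=> n; rewrite addnn -{1}(odd_double_half n); case: odd => /=; lia.
by fp.
Qed.

Lemma iter_edivn d i :
  iter i (fun p : nat * nat => if p.2.+1 == d then (p.1.+1, 0) else (p.1, p.2.+1)) (0, 0) =
  (i %/ d, i %% d).
Proof.
elim: i => [|i IH]; first by rewrite div0n mod0n.
(* For [d = 0] the remainder is never reset, in agreement with [i %/ 0 = 0] and [i %% 0 = i]. *)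
rewrite iterS IH /=; case: d {IH} => [|d]; first by rewrite !divn0 !modn0.
rewrite [i.+1 in RHS](_ : _ = i %/ d.+1 * d.+1 + (i %% d.+1).+1); last by rewrite addnS -divn_eq.
have := ltn_pmod i (ltn0Sn d); rewrite leq_eqVlt divnMDl // modnMDl => /orP[/eqP->|lt].
  by rewrite eqxx divnn modnn addn1.
by rewrite (ltn_eqF lt) (divn_small lt) (modn_small lt) addn0.
Qed.

Lemma fp_edivn : FP (fun p : nat * nat => (p.1 %/ p.2, p.1 %% p.2)).
Proof.
apply: (@FP_ext _ _ _ _ (fun p => iter p.1 (fun c : nat * nat =>
    if c.2.+1 == p.2 then (c.1.+1, 0) else (c.1, c.2.+1)) (0, 0))) => [[m d] /=|].
  exact: iter_edivn.
apply: (@FP_iter _ _ _ _ _ (fun p c => if c.2.+1 == p.2 then (c.1.+1, 0) else (c.1, c.2.+1))); fp.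
exists 5 => -[m d] i /= le; rewrite iter_edivn !tsz_pair !tsz_nat.
apply: (@leq_trans (5 * (m.*2.+1 + d.*2.+1).+2)).
  by have := leq_div i d; have := leq_mod i d; lia.
by rewrite /poly_bound leq_mul2l /= -{1}(expn1 _.+2) leq_pexp2l.
Qed.

#[export] Instance fp_divn : FP2 divn.
Proof. exact: (FP_fst fp_edivn). Qed.

#[export] Instance fp_modn : FP2 modn.
Proof. exact: (FP_snd fp_edivn). Qed.

#[export] Instance fp_sumn : FP1 sumn.
Proof.
apply: (@FP_ext _ _ _ _ (fun s => foldl addn 0 s)) => [s|].
  suff h n : foldl addn n s = n + sumn s by rewrite h.
  by elim: s n => [|x s IH] n /=; rewrite ?addn0 // IH addnA.
apply: (@FP_foldl_add _ _ _ _ _ _ (fun _ => addn)); fp.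
by apply: (@bound1 id); [pbd | move=> a c x; rewrite !tsz_nat; lia].
Qed.

Lemma bits0 : bits 0 = [::].
Proof. by rewrite /bits up_log1. Qed.

Lemma bits_rec n : 0 < n -> bits n = odd n :: bits n./2.
Proof.
move=> n0; rewrite /bits.
rewrite up_log2S //.
rewrite /mkseq /= expn0 divn1; congr (_ :: _).
rewrite (iotaDl 1 0) -map_comp; apply: eq_map => i /=.
by rewrite expnS divnMA divn2.
Qed.

#[export] Instance fp_bits : FP1 bits.
Proof.
pose step (p : nat * word) := if p.1 == 0 then p else (p.1./2, rcons p.2 (odd p.1)).
have stepP i n w : exists m v, [/\ iter i step (n, w) = (m, v), m <= n,
    v ++ bits m = w ++ bits n, size v <= size w + i & n - i >= m].
  elim: i => [|i [m [v [/= -> mn e s d]]]]; first by exists n, w; rewrite addn0 subn0.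
  rewrite /step /=; case: eqP => [m0|/eqP m0].
    by exists m, v; split => //; rewrite ?m0 //; lia.
  exists m./2, (rcons v (odd m)); split=> //; first by rewrite -divn2; lia.
  - by rewrite cat_rcons -bits_rec ?lt0n // e.
  - by rewrite size_rcons; lia.
  - by rewrite -divn2; lia.
apply: (@FP_ext _ _ _ _ (fun n => (iter n step (n, [::])).2)).
  move=> n; have [m [v [-> _ e _ d]]] := stepP n n [::].
  have m0 : m = 0 by move: d; rewrite subnn leqn0 => /eqP.
  by move: e; rewrite m0 bits0 cats0 => ->.
apply: FP_snd; apply: (@FP_iter _ _ _ _ _ (fun _ => step)); rewrite /step; fp.
exists 10 => n i le; have [m [v [-> mn _ s _]]] := stepP i n [::].
rewrite tsz_pair !tsz_nat; have := tsz_word v; rewrite /= in s => h.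
apply: (@leq_trans (10 * n.*2.+2)); first by lia.
by rewrite /poly_bound leq_mul2l /= -{1}(expn1 n.*2.+2) leq_pexp2l.
Qed.

#[export] Instance fp_enc_word : FP1 enc_word.
Proof. by rewrite /FP1 /enc_word; fp. Qed.

#[export] Instance fp_enc_nat : FP1 enc_nat.
Proof. by rewrite /FP1 /enc_nat; fp. Qed.

#[export] Instance fp_enc_unary : FP1 enc_unary.
Proof. by rewrite /FP1 /enc_unary; fp. Qed.

Lemma FP_enc_seq A X {EA : Enc A} {EX : Enc X} (g : A -> X -> word) (s : A -> seq X) :
  FP (fun p : A * X => g p.1 p.2) -> FP s -> FP (fun a => enc_seq (g a) (s a)).
Proof. by move=> Fg Fs; have ? : FP2 g := Fg; rewrite /enc_seq; fp. Qed.

(** * The Cook-Levin theorem *)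

Definition clause := seq (nat * bool).
Definition lit_true (a : nat -> bool) (l : nat * bool) := a l.1 == l.2.
Definition cnf_true (a : nat -> bool) (F : seq clause) := all (has (lit_true a)) F.

Section Tableau.
Context (M : tm).

Notation cellM := (cell (tm_work M)).

(* The symbol at position i of the tableau row of a configuration: the state
   together with, for each tape, the cells at distance i from the head on
   either side. *)
Definition sym : finType :=
  (tm_state M * {ffun 'I_(tm_tapes M).+1 -> cellM * cellM})%type.

Definition row (x : config M) (i : nat) : sym :=
  (x.1, [ffun j => (nth None (x.2 j).1 i, nth None (x.2 j).2 i)]).

(* z is min(i, 2); h, p, c and n are the symbols at positions 0, i-1, i, i+1. *)
Definition rule (z : nat) (h p c n : sym) : sym :=
  if tm_trans h.1 [ffun j => (h.2 j).2] is Some (q, a) then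
    (q, [ffun j => match (a j).2 with
      | MoveL => ((n.2 j).1, if z == 0 then (c.2 j).1 else if z == 1 then (a j).1 else (p.2 j).2)
      | MoveN => ((c.2 j).1, if z == 0 then (a j).1 else (c.2 j).2)
      | MoveR => (if z == 0 then (a j).1 else (p.2 j).1, (n.2 j).2)
      end])
  else (h.1, c.2).

(** Rows are relative to the heads: instead of a head its tape moves, by one cell. So a new symbol
    depends on its three old neighbours and on position 0, which shows the state and all scanned
    cells. Positions 0 and 1 are special because the two halves of a tape meet there. *)
Lemma rowS x i :
  row (tm_step x) i = rule (minn i 2) (row x 0) (row x i.-1) (row x i) (row x i.+1).
Proof.
rewrite /rule /tm_step /tm_next /=.
have -> : [ffun j => ([ffun j0 => (nth None (x.2 j0).1 0, nth None (x.2 j0).2 0)] j).2] =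
    [ffun j => tape_read (x.2 j)] by apply/ffunP=> j; rewrite !ffunE /= nth0.
case: tm_trans => [[q a]|] //; rewrite /row; congr (_, _); apply/ffunP=> j; rewrite !ffunE /=.
rewrite /tape_act; case: (a j) => w [] /=; case: (x.2 j) => l r /=.
- by rewrite nth_behead; congr (_, _); case: i => [|[|i]] /=; rewrite ?nth_behead ?nth0.
- by congr (_, _); case: i => [|i] //=; rewrite nth_behead; case: i.
- by rewrite nth_behead; congr (_, _); case: i => [|i] //=; case: i.
Qed.

Definition isbit (c : cellM) := if c is Some (inl _) then true else false.

Definition accepting (h n : sym) : bool :=
  [&& ~~ isSome (tm_trans h.1 [ffun j => (h.2 j).2]),
      (h.2 ord0).2 == Some (inl true) & ~~ isbit (n.2 ord0).2].

Lemma acceptingP x :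
  accepting (row x 0) (row x 1) <-> tm_halted x /\ tm_output x = [:: true].
Proof.
rewrite /accepting /tm_halted /tm_next /tm_output /= !ffunE /=.
have -> : [ffun j => ([ffun j0 => (nth None (x.2 j0).1 0, nth None (x.2 j0).2 0)] j).2] =
    [ffun j => tape_read (x.2 j)] by apply/ffunP=> j; rewrite !ffunE /= nth0.
split=> [/and3P[-> /eqP h n]|[-> e]].
  split=> //; case: (x.2 ord0).2 h n => [|c [|d r]] //= -> //=.
  by case: d => [[]|].
move: e; case: (x.2 ord0).2 => [|[[[] |c]|] r] //= [].
by case: r => [|[[]|]].
Qed.

Definition isym (c : cellM) : sym :=
  (tm_start M, [ffun j => (None, if j == ord0 then c else None)]).

Definition icell (w : word) (i : nat) : cellM :=
  if i < size w then Some (inl (nth false w i)) else None.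

Lemma row_init w i : row (tm_init M w) i = isym (icell w i).
Proof.
rewrite /row /isym /=; congr (_, _); apply/ffunP=> j; rewrite !ffunE.
case: eqP => _ /=; last by rewrite !nth_nil.
rewrite nth_nil /icell; case: ltnP => h; last by rewrite nth_default ?size_map.
by rewrite (nth_map false).
Qed.

Definition rk (s : sym) : nat := enum_rank s.
Definition ksym := #|sym|.

Definition var W t i r := (t * W + i) * ksym + r.

Definition unitc (v : nat) : clause := nseq 5 (v, true).

Definition table (z : nat) : seq (nat * (nat * (nat * (nat * nat)))) :=
  [seq (rk q.1.1.1, (rk q.1.1.2, (rk q.1.2, (rk q.2, rk (rule z q.1.1.1 q.1.1.2 q.1.2 q.2)))))
     | q : (sym * sym * sym * sym)%type <- enum {: sym * sym * sym * sym}].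

Definition rejecting : seq (nat * nat) :=
  [seq (rk q.1, rk q.2) | q : (sym * sym)%type <- enum {: sym * sym} & ~~ accepting q.1 q.2].

(* w is the fixed part of the input, P bounds the length of the guessed part
   and T the number of steps. *)
Definition tableau (T P : nat) (w : word) : seq clause :=
  let m := size w in
  let W := T + (m + P) + 3 in
  [seq unitc (var W 0 i (if nth false w i then rk (isym (Some (inl true)))
                         else rk (isym (Some (inl false))))) | i <- iota 0 m] ++
  [seq [:: (var W 0 i (rk (isym (Some (inl true)))), true);
           (var W 0 i (rk (isym (Some (inl false)))), true);
           (var W 0 i (rk (isym None)), true);
           (var W 0 i (rk (isym None)), true);
           (var W 0 i (rk (isym None)), true)] | i <- iota m P] ++
  [seq [:: (var W 0 i (rk (isym None)), false);
           (var W 0 i.+1 (rk (isym None)), true);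
           (var W 0 i.+1 (rk (isym None)), true);
           (var W 0 i.+1 (rk (isym None)), true);
           (var W 0 i.+1 (rk (isym None)), true)] | i <- iota m P] ++
  [seq unitc (var W 0 i (rk (isym None))) | i <- iota (m + P) (T + 3)] ++
  flatten [seq flatten [seq
      [seq [:: (var W t 0 q.1, false); (var W t i.-1 q.2.1, false);
               (var W t i q.2.2.1, false); (var W t i.+1 q.2.2.2.1, false);
               (var W t.+1 i q.2.2.2.2, true)]
         | q <- if i == 0 then table 0 else if i == 1 then table 1 else table 2]
      | i <- iota 0 (W - t.+1)] | t <- iota 0 T] ++
  [seq [:: (var W T 0 q.1, false); (var W T 1 q.2, false); (var W T 1 q.2, false);
           (var W T 1 q.2, false); (var W T 1 q.2, false)] | q <- rejecting].

Lemma has_unitc a v : has (lit_true a) (unitc v) = a v.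
Proof. by rewrite has_nseq /lit_true eqb_id. Qed.

Lemma tableau_size5 T P w : all (fun c => size c == 5) (tableau T P w).
Proof.
rewrite /tableau !all_cat; apply/and5P; split; try by apply/allP=> c /mapP[i _ ->].
apply/andP; split; last by apply/allP=> c /mapP[i _ ->].
by apply/allP=> c /flatten_mapP[t _ /flatten_mapP[i _ /mapP[q _ ->]]].
Qed.

Lemma rk_lt s : rk s < ksym. Proof. exact: ltn_ord. Qed.

Lemma rk_inj : injective rk.
Proof. by move=> s s' /val_inj /enum_rank_inj. Qed.

Lemma icell_cat w u i : i < size w -> icell (w ++ u) i = Some (inl (nth false w i)).
Proof. by move=> h; rewrite /icell size_cat nth_cat h (ltn_addr _ h). Qed.

(** By induction on time, the variable of the symbol that is really present is true. The last group
    of clauses then excludes a rejecting end. *)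
Lemma tableau_sound T P w a : cnf_true a (tableau T P w) ->
  exists2 u, size u <= P & 
    let x := iter T (@tm_step M) (tm_init M (w ++ u)) in
    tm_halted x /\ tm_output x = [:: true].
Proof.
rewrite /cnf_true /tableau; set m := size w; set W := T + (m + P) + 3.
rewrite !all_cat => /and5P[/allP A1 /allP A2 /allP A3 /allP A4 /andP[/allP A5 /allP A6]].
pose B i := a (var W 0 i (rk (isym None))).
(* The guess ends at the first blank among the [P] positions behind [w]. The third and the fourth
   group of clauses make all later positions blank as well. *)
pose q := find (fun j => B (m + j)) (iota 0 P).
have qP : q <= P by rewrite -[X in _ <= X](size_iota 0 P) find_size.
pose u := mkseq (fun j => a (var W 0 (m + j) (rk (isym (Some (inl true)))))) q.
exists u; first by rewrite size_mkseq.
pose X t := iter t (@tm_step M) (tm_init M (w ++ u)).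
have Bq j : q <= j -> j < P + (T + 3) -> B (m + j).
  elim: j => [|j IH] qj jP.
    have q0 : q = 0 by lia.
    case: (posnP P) => [P0|P0].
      have := A4 _ (map_f _ (_ : m + 0 \in iota (m + P) (T + 3))).
      by rewrite mem_iota P0 !addn0 => /(_ ltac:(lia)); rewrite has_unitc.
    have := @nth_find _ 0 (fun j => B (m + j)) (iota 0 P).
    by rewrite -/q q0 nth_iota // add0n; apply; rewrite has_find -/q q0 size_iota.
  have [jP'|jP'] := leqP P j.+1.
    have := A4 _ (map_f _ (_ : m + j.+1 \in iota (m + P) (T + 3))).
    by rewrite mem_iota => /(_ ltac:(lia)); rewrite has_unitc.
  have [lt|ge] := leqP q j.
    have := A3 _ (map_f _ (_ : m + j \in iota m P)).
    rewrite mem_iota => /(_ ltac:(lia)); rewrite /= /lit_true /= eqb_id eqbF_neg orbF !orbb.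
    by rewrite -/(B (m + j)) IH ?addnS //; lia.
  have e : q = j.+1 by lia.
  have := @nth_find _ 0 (fun j => B (m + j)) (iota 0 P).
  by rewrite -/q e nth_iota // add0n; apply; rewrite has_find -/q e size_iota.
have R0 i : i < W -> a (var W 0 i (rk (row (X 0) i))).
  rewrite /X /= row_init => iW; have [im|mi] := ltnP i m.
    rewrite icell_cat //; have := A1 _ (map_f _ (_ : i \in iota 0 m)).
    rewrite mem_iota => /(_ im); rewrite has_unitc.
    by case: (nth _ _ _).
  have ei : i = m + (i - m) by lia.
  have [iq|qi] := ltnP (i - m) q; last first.
    rewrite /icell size_cat size_mkseq -/m ltnNge.
    by rewrite ei leq_add2l qi /=; apply: Bq => //; move: iW; rewrite /W; lia.
  have iu : i < m + q by lia.
  rewrite /icell size_cat size_mkseq -/m iu.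
  rewrite nth_cat -/m ltnNge mi /= nth_mkseq // -ei.
  have := A2 _ (map_f _ (_ : i \in iota m P)); rewrite mem_iota => /(_ ltac:(lia)).
  have := @before_find _ 0 (fun j => B (m + j)) (iota 0 P) _ iq.
  rewrite nth_iota ?add0n; last by lia.
  rewrite -ei /= /lit_true /= !eqb_id /B => ->; rewrite !orbF.
  by case E : (a (var W 0 i (rk (isym (Some (inl true)))))).
(* A symbol depends on its right neighbour, so the controlled part of a row shrinks by one position
   per step; the width [W] leaves more than positions 0 and 1 of row [T]. *)
have R t : t <= T -> forall i, i + t < W -> a (var W t i (rk (row (X t) i))).
  elim: t => [_ i|t IH tT i iW]; first by rewrite addn0; apply: R0.
  rewrite /X iterS -/(X t) rowS.
  have h0 : (0 < W - t)%N by lia.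
  pose qq := (row (X t) 0, row (X t) i.-1, row (X t) i, row (X t) i.+1).
  pose tb := if i == 0 then table 0 else if i == 1 then table 1 else table 2.
  have tbE : tb = table (minn i 2) by rewrite /tb; case: i {qq iW tb} => [|[|i]].
  have in5 : has (lit_true a) [:: (var W t 0 (rk (row (X t) 0)), false);
      (var W t i.-1 (rk (row (X t) i.-1)), false);
      (var W t i (rk (row (X t) i)), false); (var W t i.+1 (rk (row (X t) i.+1)), false);
      (var W t.+1 i (rk (rule (minn i 2) (row (X t) 0) (row (X t) i.-1) (row (X t) i) (row (X t) i.+1))), true)].
    apply: A5; apply/flatten_mapP; exists t; first by rewrite mem_iota.
    apply/flatten_mapP; exists i; first by rewrite mem_iota; lia.
    rewrite -/tb tbE; apply/mapP.
    exists (rk qq.1.1.1, (rk qq.1.1.2, (rk qq.1.2, (rk qq.2,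
      rk (rule (minn i 2) qq.1.1.1 qq.1.1.2 qq.1.2 qq.2))))) => //.
    by apply/mapP; exists qq; rewrite ?mem_enum.
  move: in5; rewrite /= /lit_true /= !IH ?eqb_id //=; try lia.
have main : accepting (row (X T) 0) (row (X T) 1).
  apply: contraT => nacc.
  have := A6 [:: (var W T 0 (rk (row (X T) 0)), false); (var W T 1 (rk (row (X T) 1)), false);
    (var W T 1 (rk (row (X T) 1)), false);
    (var W T 1 (rk (row (X T) 1)), false); (var W T 1 (rk (row (X T) 1)), false)].
  rewrite /= /lit_true /= !R //; try (rewrite /W; lia).
  apply; apply/mapP; exists (rk (row (X T) 0), rk (row (X T) 1)) => //.
  apply/mapP; exists (row (X T) 0, row (X T) 1) => //.
  by rewrite mem_filter mem_enum andbT; apply: nacc.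
by apply/acceptingP.
Qed.

Lemma tableau_complete T P w u : size u <= P ->
  (let x := iter T (@tm_step M) (tm_init M (w ++ u)) in
   tm_halted x /\ tm_output x = [:: true]) ->
  exists a, cnf_true a (tableau T P w).
Proof.
move=> uP /acceptingP acc.
pose m := size w; pose W := T + (m + P) + 3.
pose X t := iter t (@tm_step M) (tm_init M (w ++ u)).
pose a v := v %% ksym == rk (row (X (v %/ ksym %/ W)) (v %/ ksym %% W)).
have aE t i s : i < W -> a (var W t i (rk s)) = (s == row (X t) i).
  move=> iW; have k0 : 0 < ksym by apply: leq_ltn_trans (rk_lt s).
  have W0 : 0 < W by apply: leq_ltn_trans iW.
  rewrite /a /var modnMDl divnMDl // (modn_small (rk_lt s)) (divn_small (rk_lt s)) addn0.
  by rewrite modnMDl divnMDl // (modn_small iW) (divn_small iW) addn0 (inj_eq rk_inj).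
have mW : m + P + T + 2 < W by rewrite /W; lia.
exists a; rewrite /cnf_true /tableau -/m -/W !all_cat.
apply/and5P; split; last (apply/andP; split).
- apply/allP=> c /mapP[i]; rewrite mem_iota => /= im ->.
  rewrite has_unitc -fun_if aE; last by lia.
  rewrite row_init icell_cat //.
  by case: (nth _ _ _); rewrite eqxx.
- apply/allP=> c /mapP[i]; rewrite mem_iota => /= im ->.
  rewrite /= /lit_true /= !aE ?row_init; try lia.
  rewrite /icell; case: ifP => _; last by rewrite eqxx !orbT.
  by case: (nth _ _ _); rewrite eqxx ?orbT.
- apply/allP=> c /mapP[i]; rewrite mem_iota => /= im ->.
  rewrite /= /lit_true /= !aE ?row_init; try lia.
  rewrite /icell; case: ifP => h.
    rewrite (_ : (isym None == isym _) = false) //.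
    by apply/negbTE/eqP=> -[] /ffunP/(_ ord0); rewrite !ffunE eqxx.
  have -> : (i.+1 < size (w ++ u)) = false by lia.
  by rewrite eqxx.
- apply/allP=> c /mapP[i]; rewrite mem_iota => /= im ->.
  rewrite has_unitc aE ?row_init; last by lia.
  rewrite /icell size_cat -/m (_ : (_ < _) = false) ?eqxx //; lia.
- apply/allP=> c /flatten_mapP[t tT /flatten_mapP[i iW /mapP[q]]].
  have -> : (if i == 0 then table 0 else if i == 1 then table 1 else table 2) = table (minn i 2).
    by case: i {iW} => [|[|i]].
  move=> /mapP[[[[h p] c0] n] _ ->] ->.
  rewrite mem_iota in iW; rewrite mem_iota in tT.
  rewrite /= /lit_true /= !aE; try lia.
  rewrite !eqbF_neg eqb_id orbF.
  case: eqP => //= ->; case: eqP => //= ->; case: eqP => //= ->; case: eqP => //= ->.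
  by rewrite -rowS.
- apply/allP=> c /mapP[q /mapP[[h n]]]; rewrite mem_filter /= => /andP[na _] -> ->.
  rewrite /= /lit_true /= !aE ?eqbF_neg; try (rewrite /W; lia).
  case: eqP => //= h0; case: eqP => //= n1.
  by move: na; rewrite h0 n1 acc.
Qed.

End Tableau.

Lemma cook_levin (L : word -> Prop) : in_NP L ->
  exists F : word -> seq clause,
    [/\ FP F, forall w, all (fun c => size c == 5) (F w), forall w, F w != [::] &
        forall w, L w <-> exists a, cnf_true a (F w)].
Proof.
(* The number of steps is a time bound of the verifier for the longest admissible guess. It serves
   all guesses at once because a halted machine does not change. *)
move=> [V [k [[M [k' VM]] LP]]].
pose T w := poly_bound k' (size (enc_word w) + poly_bound k (size w)).
exists (fun w => tableau M (T w) (poly_bound k (size w)) (enc_word w)); split.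
- rewrite /tableau /T /unitc /var; fp.
- by move=> w; apply: tableau_size5.
- move=> w; apply/eqP=> /(congr1 size); rewrite /tableau size_cat size_map size_iota.
  have : 0 < size (enc_word w) by rewrite /enc_word size_cat addn1.
  by case: (size (enc_word w)).
move=> w; split.
  move=> /LP[u su Vu]; apply: (tableau_complete su).
  have := VM (enc_word w ++ u); rewrite Vu => h.
  apply: computes_within_mono h; apply: poly_bound_mono => //.
  by rewrite size_cat leq_add2l.
move=> [a /tableau_sound[u su h]]; apply/LP; exists u => //.
have := VM (enc_word w ++ u) => h'.
have [_ <-] : computes_within M (T w) (enc_word w ++ u) (V (enc_word w ++ u)).
  apply: computes_within_mono h'; apply: poly_bound_mono => //.
  by rewrite size_cat leq_add2l.
by case: h.
Qed.

(** * Instances with n = 2 from weighted edge lists *)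

Notation vert := (nat * nat * nat)%type.
(* An edge of weight (w1, w2) contributes w1 if it is in one of the two
   matchings and w1 + w2 if it is in both. *)
Notation wedge := ((vert * vert) * (nat * nat))%type.

Definition inc (v : vert) (e : wedge) := (v == e.1.1) || (v == e.1.2).

Definition emat (es : seq wedge) (A : pred wedge) := forall v e e',
  e \in es -> e' \in es -> A e -> A e' -> inc v e -> inc v e' -> e = e'.

Definition wvalue (es : seq wedge) (A B : pred wedge) :=
  \sum_(e <- es) (e.2.1 * (A e || B e) + e.2.2 * (A e && B e)).

Record wfgraph (vs : seq vert) (es : seq wedge) : Prop := {
  wf_vs : uniq vs;
  wf_es : uniq es;
  wf_in : forall e, e \in es -> (e.1.1 \in vs) && (e.1.2 \in vs);
  wf_loop : forall e, e \in es -> e.1.1 != e.1.2;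
  wf_simple : forall e e', e \in es -> e' \in es ->
    (e.1.1 = e'.1.1 /\ e.1.2 = e'.1.2) \/ (e.1.1 = e'.1.2 /\ e.1.2 = e'.1.1) -> e = e'
}.

Definition vnorm (vs : seq vert) (e : wedge) : nat * nat :=
  if index e.1.1 vs < index e.1.2 vs then (index e.1.1 vs, index e.1.2 vs)
  else (index e.1.2 vs, index e.1.1 vs).

Definition inst_word (vs : seq vert) (es : seq wedge) : word :=
  enc_unary (size vs) ++
  enc_seq (fun e : nat * nat => enc_nat e.1 ++ enc_nat e.2) (map (vnorm vs) es) ++
  enc_nat 2 ++
  enc_seq (fun z : nat => false :: enc_nat z) (flatten [seq [:: e.2.1; e.2.2] | e <- es]).

#[export] Instance fp_eqv : FP2 (fun u v : vert => u == v).
Proof.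
apply: (@FP_ext _ _ _ _ (fun p : vert * vert => [&& p.1.1.1 == p.2.1.1, p.1.1.2 == p.2.1.2 & p.1.2 == p.2.2])).
  by case=> -[[a b] c] [[a' b'] c'] /=; rewrite !xpair_eqE andbA.
by fp.
Qed.

#[export] Instance fp_index : FP2 (fun (v : vert) (s : seq vert) => index v s).
Proof.
pose f (v : vert) (p : bool * nat) (y : vert) :=
  if p.1 then p else if y == v then (true, p.2) else (false, p.2.+1).
apply: (@FP_ext _ _ _ _ (fun p => (foldl (f p.1) (false, 0) p.2).2)) => [[v s] /=|].
  have t u n : foldl (f v) (true, n) u = (true, n) by elim: u.
  suff h u n : (foldl (f v) (false, n) u).2 = n + index v u by rewrite h.
  elim: u n => [|y u IH] n /=; first by rewrite addn0.
  by rewrite {2}/f /=; case: eqP => _; rewrite ?t ?addn0 // IH addSnnS.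
have ? : FP3 f by rewrite /f /FP3; fp.
apply: FP_snd; apply: (@FP_foldl_add _ _ _ _ _ _ (fun p => f p.1)); fp.
apply: (@bound1 (fun=> 4)); [pbd|] => a [b n] y; rewrite /f /=.
case: b => /=; first by rewrite leq_addr.
by case: ifP => _; rewrite !tsz_pair !tsz_nat ?tsz_true ?tsz_false; lia.
Qed.

#[export] Instance fp_inst_word : FP2 inst_word.
Proof.
rewrite /FP2 /inst_word /vnorm /enc_seq.
have ? (A : Type) (EA : Enc A) (u : A -> vert) (s : A -> seq vert) :
    FP u -> FP s -> FP (fun a => index (u a) (s a)).
  by move=> Fu Fs; apply (FP_app2 (F := fun (v : vert) (s : seq vert) => index v s)).
by fp.
Qed.

Section Instance.
Context (vs : seq vert) (es : seq wedge).
Hypothesis wf : wfgraph vs es.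
Hypothesis vs_gt0 : 0 < size vs.

Let v0 : vert := (0, 0, 0).
Let N := (size vs).-1.

Lemma size_vs : size vs = N.+1. Proof. by rewrite prednK. Qed.

Definition iedge (e : wedge) : 'I_N.+1 * 'I_N.+1 :=
  (inord (vnorm vs e).1, inord (vnorm vs e).2).
Let edges := map_tuple iedge (in_tuple es).

Lemma idx_lt v : v \in vs -> index v vs < N.+1.
Proof. by rewrite -size_vs index_mem. Qed.

Lemma idx_inj u v : u \in vs -> v \in vs -> index u vs = index v vs -> u = v.
Proof. by move=> uin vin e; rewrite -(nth_index v0 uin) e nth_index. Qed.

Lemma vnorm_lt e : e \in es -> (vnorm vs e).1 < (vnorm vs e).2 < N.+1.
Proof.
move=> ein; have /andP[u1 u2] := wf_in wf ein; rewrite /vnorm.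
have h1 := idx_lt u1; have h2 := idx_lt u2.
have ne : index e.1.1 vs <> index e.1.2 vs.
  by move=> /(idx_inj u1 u2) /eqP; apply/negP/(wf_loop wf).
case: (ltnP (index e.1.1 vs) (index e.1.2 vs)) => [lt12|le21] /=; first by rewrite lt12 h2.
rewrite h1 andbT.
by rewrite ltn_neqAle le21 andbT; apply/eqP=> /esym.
Qed.

Lemma edges_lt : all (fun e : 'I_N.+1 * 'I_N.+1 => e.1 < e.2) edges.
Proof.
apply/allP=> p /mapP[e ein ->] /=; have /andP[l1 l2] := vnorm_lt ein.
by rewrite !inordK // (ltn_trans l1).
Qed.

Lemma iedge_inc e v : e \in es -> v \in vs ->
  ((inord (index v vs) == (iedge e).1) || (inord (index v vs) == (iedge e).2)) = inc v e.
Proof.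
move=> ein vin; have /andP[l1 l2] := vnorm_lt ein.
rewrite -!val_eqE /= !inordK ?idx_lt ?(ltn_trans l1 l2) //.
have /andP[u1 u2] := wf_in wf ein; rewrite /vnorm /inc.
have E u : u \in vs -> (index v vs == index u vs) = (v == u).
  by move=> uin; apply/eqP/eqP => [/idx_inj->|->].
by case: ifP => _ /=; rewrite !E // orbC.
Qed.

Lemma edges_uniq : uniq edges.
Proof.
rewrite map_inj_in_uniq ?(wf_es wf) // => e e' ein ein' ee.
have /andP[u1 u2] := wf_in wf ein; have /andP[u1' u2'] := wf_in wf ein'.
have i1 := iedge_inc ein u1; have i2 := iedge_inc ein u2.
have i1' := iedge_inc ein' u1; have i2' := iedge_inc ein' u2.
apply: (wf_simple wf) => //; have := wf_loop wf ein.
rewrite ee in i1 i2; move: i1 i2; rewrite i1' i2' /inc !eqxx orbT /=.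
by case/orP=> /eqP-> /orP[] /eqP->; rewrite ?eqxx //; [left | right].
Qed.

Definition igraph : graph := Graph edges_lt edges_uniq.

Let eN (i : 'I_(ne igraph)) : wedge := nth (v0, v0, (0, 0)) es i.

Lemma eN_in i : eN i \in es. Proof. by rewrite mem_nth. Qed.

Lemma incidentE i v : v \in vs ->
  @incident igraph (inord (index v vs)) i = inc v (eN i).
Proof.
move=> vin; rewrite -iedge_inc ?eN_in // /incident /= tnth_map (tnth_nth (v0, v0, (0, 0))) //.
Qed.

Lemma vertexP (v : 'I_(nv igraph)) : exists2 u, u \in vs & v = inord (index u vs).
Proof.
exists (nth v0 vs v); first by rewrite mem_nth // size_vs.
by rewrite index_uniq ?(wf_vs wf) ?size_vs // inord_val.
Qed.

Definition ic : 'M[int]_(ne igraph, 2) :=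
  (\matrix_(i, j) if j == ord0 then Posz (eN i).2.1 else Posz (eN i).2.2)%R.

Definition sinst : shift_inst := @ShiftInst igraph 2 ic.

Lemma enum_I2 : enum 'I_2 = [:: ord0; ord_max].
Proof. by apply: (inj_map val_inj); rewrite val_enum_ord. Qed.

Lemma enc_sinst : enc_shift_inst sinst = inst_word vs es.
Proof.
rewrite /enc_shift_inst /inst_word [in RHS]size_vs; congr (_ ++ (_ ++ (_ ++ _))).
  rewrite /enc_seq; congr (flatten _ ++ _); rewrite -!map_comp.
  apply/eq_in_map => e ein /=; have /andP[l1 l2] := vnorm_lt ein.
  by rewrite !inordK // (ltn_trans l1).
rewrite /enc_mx /enc_seq; congr (flatten _ ++ _).
rewrite enum_I2 /=.
have -> : [seq ic i j | i <- enum 'I_(size es), j <- [:: ord0; ord_max]] =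
    map Posz (flatten [seq [:: e.2.1; e.2.2] | e <- es]).
  rewrite map_flatten -map_comp; congr flatten.
  rewrite -[in RHS](mkseq_nth (v0, v0, (0, 0)) es) /mkseq -val_enum_ord -!map_comp.
  by apply: eq_map => i /=; rewrite !mxE.
by rewrite -map_comp.
Qed.

Lemma sinst_shifted : (forall e, e \in es -> e.2.2 <= e.2.1) -> shifted (si_c sinst).
Proof.
move=> h; apply/shift_mxP; split=> [i|i j k jk].
  by exists (perm.perm (@inj_id _)) => j; rewrite perm.permE.
rewrite !mxE; have [ek|nk] := eqVneq k ord0; last first.
  by case: ifP => _; [apply: h; apply: eN_in | apply: Order.POrderTheory.lexx].
have -> : j = ord0 by apply/val_inj/eqP; rewrite -leqn0 (leq_trans jk) // ek.
exact: Order.POrderTheory.lexx.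
Qed.

Lemma sinst_cubic : (forall v, v \in vs -> count (inc v) es = 3) -> cubic (si_graph sinst).
Proof.
move=> h v; have [u uin ->] := vertexP v; rewrite -(h _ uin) /degree.
rewrite -sum1_card -sum1_count (big_nth (v0, v0, (0, 0))) big_mkord.
by apply: eq_bigl => i; rewrite inE incidentE.
Qed.

Lemma sinst_bipartite (side : vert -> bool) :
  (forall e, e \in es -> side e.1.1 != side e.1.2) -> bipartite (si_graph sinst).
Proof.
move=> h; exists (fun v => side (nth v0 vs v)) => i /=.
rewrite tnth_map (tnth_nth (v0, v0, (0, 0))) /=.
have ein := eN_in i; have /andP[l1 l2] := vnorm_lt ein.
have /andP[u1 u2] := wf_in wf ein.
rewrite !inordK ?(ltn_trans l1) // /vnorm -/(eN i).
by case: ifP => _; rewrite [X in side (nth _ _ X)]/= !nth_index //; [|rewrite eq_sym]; apply: h.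
Qed.

Definition esel (A : {set 'I_(ne igraph)}) : pred wedge :=
  fun e => [exists i, (i \in A) && (eN i == e)].

Lemma esel_eN A i : esel A (eN i) = (i \in A).
Proof.
apply/existsP/idP => [[j /andP[jA]]|iA]; last by exists i; rewrite iA eqxx.
by rewrite nth_uniq ?(wf_es wf) // => /eqP/val_inj <-.
Qed.

Lemma esP e : e \in es -> exists i, e = eN i.
Proof.
move=> ein; have h : index e es < size es by rewrite index_mem.
by exists (Ordinal h); rewrite /eN nth_index.
Qed.

Lemma emat_esel A : matching A -> emat es (esel A).
Proof.
move=> mA v e e' /esP[i ->] /esP[j ->]; rewrite !esel_eN => iA jA vi vj.
case: (eqVneq i j) => [-> //|ij].
have vin : v \in vs.
  by have /andP[u1 u2] := wf_in wf (eN_in i); case/orP: vi => /eqP->.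
by have := mA i j iA jA ij (inord (index v vs)); rewrite !incidentE // vi vj.
Qed.

Lemma matching_emat A : emat es A -> matching [set i : 'I_(ne igraph) | A (eN i)].
Proof.
move=> mA i j; rewrite !inE => iA jA ij v; have [u uin ->] := vertexP v.
rewrite !incidentE //; apply/negP=> /andP[ui uj].
have /eqP := mA u _ _ (eN_in i) (eN_in j) iA jA ui uj.
by rewrite nth_uniq ?(wf_es wf) //; apply/negP.
Qed.

(** Sorting two bits gives their disjunction and their conjunction; this turns the objective into
    [wvalue]. *)
Lemma shift_row2 (x : 'M[int]_(ne igraph, 2)) i (a b : bool) :
  x i ord0 = Posz a -> x i ord_max = Posz b ->
  shift_mx x i ord0 = Posz (a || b) /\ shift_mx x i ord_max = Posz (a && b).
Proof.
move=> xa xb; rewrite !mxE enum_I2 /= xa xb.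
by case: a b {xa xb} => -[].
Qed.

Lemma sinst_value (x : 'M[int]_(ne igraph, 2)) (A B : pred wedge) :
  (forall i, x i ord0 = Posz (A (eN i))) -> (forall i, x i ord_max = Posz (B (eN i))) ->
  mx_dot (si_c sinst) (shift_mx x) = Posz (wvalue es A B).
Proof.
move=> xA xB; rewrite /mx_dot /wvalue (big_nth (v0, v0, (0, 0))) big_mkord.
rewrite (big_morph Posz PoszD (erefl 0%Z)); apply: eq_bigr => i _.
have [e1 e2] := shift_row2 (xA i) (xB i).
have ord2 (j : 'I_2) : j = ord0 \/ j = ord_max.
  by case: j => -[|[|//]] h; [left | right]; apply: val_inj.
rewrite (_ : \sum_j _ = \sum_(j <- enum 'I_2) ic i j * shift_mx x i j)%R; last first.
  by rewrite big_enum.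
rewrite enum_I2 big_cons big_seq1 e1 e2 !mxE /= -!PoszM -PoszD.
by [].
Qed.

Lemma sinst_yes (t : nat) :
  (exists2 x : sol (m := matching_shifting) sinst, feasible x & (Posz t <= value x)%R) <->
  exists A B, [/\ emat es A, emat es B & t <= wvalue es A B].
Proof.
split=> [[x fx le]|[A [B [mA mB le]]]].
  have [A mA eA] := fx ord0; have [B mB eB] := fx ord_max.
  exists (esel A), (esel B); split; try exact: emat_esel.
  have := @sinst_value x (esel A) (esel B).
  move: le; rewrite /value /= => le h; rewrite -lez_nat -h //.
  - by move=> i; rewrite esel_eN; have /colP/(_ i) := eA; rewrite !mxE => ->; case: (i \in A).
  - by move=> i; rewrite esel_eN; have /colP/(_ i) := eB; rewrite !mxE => ->; case: (i \in B).
pose x : 'M[int]_(ne igraph, 2) := (\matrix_(i, j) (Posz (if j == ord0 then A (eN i) else B (eN i))))%R.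
exists x.
  move=> j; exists [set i | if j == ord0 then A (eN i) else B (eN i)].
    by case: (j == ord0); apply: matching_emat.
  by apply/colP=> i; rewrite !mxE inE; case: (j == ord0); [case: (A _) | case: (B _)].
by rewrite /value /= (@sinst_value x A B) ?lez_nat // => i; rewrite mxE.
Qed.

End Instance.

(** * Counting around the vertices *)

Lemma star_perm es v st : uniq es -> uniq st ->
  (forall e, e \in st <-> e \in es /\ inc v e) -> perm_eq (filter (inc v) es) st.
Proof.
move=> ues ust h; apply: uniq_perm => //; first exact: filter_uniq.
move=> e; rewrite mem_filter; apply/andP/idP => [[i ein]|/h[ein i]] //.
exact/h.
Qed.

(** Splits what an edge contributes between its ends. The objective becomes a sum over vertices, and
    at each vertex the matching condition bounds the summand. *)
Lemma double_count vs es (f : vert -> wedge -> nat) : wfgraph vs es ->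
  \sum_(e <- es) (f e.1.1 e + f e.1.2 e) = \sum_(v <- vs) \sum_(e <- es | inc v e) f v e.
Proof.
move=> wf; rewrite [RHS](eq_bigr (fun v => \sum_(e <- es) (if inc v e then f v e else 0))); last first.
  by move=> v _; rewrite big_mkcond.
rewrite exchange_big /= !big_seq; apply: eq_bigr => e ein.
have /andP[u1 u2] := wf_in wf ein; have ne := wf_loop wf ein.
rewrite (bigD1_seq _ u1 (wf_vs wf)) /= {1}/inc eqxx; congr (_ + _).
rewrite -big_filter (bigD1_seq e.1.2) /= ?filter_uniq ?(wf_vs wf) //; last first.
  by rewrite mem_filter eq_sym ne.
rewrite {1}/inc eqxx orbT big1_seq ?addn0 // => v /andP[n2]; rewrite mem_filter => /andP[n1 _].
by rewrite /inc (negbTE n1) (negbTE n2).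
Qed.

(** Applied with [c] the largest possible contribution of a vertex: a solution that reaches the sum
    of these bounds attains each of them. *)
Lemma sum_tight (T : eqType) (s : seq T) (f c : T -> nat) :
  (forall x, x \in s -> f x <= c x) -> \sum_(x <- s) c x <= \sum_(x <- s) f x ->
  forall x, x \in s -> f x = c x.
Proof.
elim: s => [//|y s IH] le; rewrite !big_cons => S x.
have ls : \sum_(x <- s) f x <= \sum_(x <- s) c x.
  by rewrite !big_seq; apply: leq_sum => z zs; apply: le; rewrite inE zs orbT.
have ly : f y <= c y by apply: le; rewrite inE eqxx.
rewrite inE => /orP[/eqP->|xs]; first by lia.
by apply: IH => // [z zs|]; [apply: le; rewrite inE zs orbT | lia].
Qed.

Lemma emat_le1 es A v e e' : emat es A -> e \in es -> e' \in es -> inc v e -> inc v e' ->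
  e != e' -> A e + A e' <= 1.
Proof.
move=> mA ein ein' i i'; case a: (A e); case a': (A e') => // /eqP[].
exact: (mA v).
Qed.

Lemma uniq3 (T : eqType) (a b c : T) : a != b -> a != c -> b != c -> uniq [:: a; b; c].
Proof. by move=> ab ac bc; rewrite /= !inE negb_or ab ac bc. Qed.

(** Separates the blocks of a long concatenation by one numerical tag instead of comparing them in
    pairs. *)
Lemma cat_uniq_tag (T : eqType) (t : T -> nat) k (r s : seq T) :
  uniq r -> uniq s -> (forall x, x \in r -> t x = k) -> (forall x, x \in s -> k < t x) ->
  uniq (r ++ s).
Proof.
move=> ur us tr ts; rewrite cat_uniq ur us andbT /=; apply/hasPn=> x xs; apply/negP=> /tr.
by have := ts x xs; lia.
Qed.

(** * Variable cycles *)

Definition grid (m n : nat) : seq (nat * nat) := [seq (x, q) | x <- iota 0 m, q <- iota 0 n].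

Lemma mem_grid m n v : (v \in grid m n) = (v.1 < m) && (v.2 < n).
Proof.
apply/allpairsP/andP => [[[x q] [/= xi qi ->]]|[xm qn]].
  by rewrite !mem_iota in xi qi.
by exists v; rewrite !mem_iota; case: v xm qn.
Qed.

Lemma grid_uniq m n : uniq (grid m n).
Proof. by apply: allpairs_uniq; rewrite ?iota_uniq // => -[a b] [c d] _ _ /= [-> ->]. Qed.

Lemma size_grid m n : size (grid m n) = m * n.
Proof. by rewrite size_allpairs !size_iota. Qed.

(* Occurrence o of a literal owns the positions 4o, ..., 4o+3 of the cycle of
   every variable; clause j consists of the occurrences 5j, ..., 5j+4. *)
Definition nvar (l : clause) := (sumn (unzip1 l)).+1.
Definition lvar (l : clause) o := (nth (0, true) l o).1.
(** The parity of the offset decides which of the two alternating selections contains the port edge: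
    the one that makes the literal false. Four positions have room for the port edge and both of its
    cycle neighbours, at either parity. *)
Definition loff (l : clause) o := if (nth (0, true) l o).2 then 1 else 2.
Definition clen (l : clause) := 4 * size l.

Definition nxq (l : clause) q := if q.+1 == clen l then 0 else q.+1.
Definition prq (l : clause) q := if q == 0 then (clen l).-1 else q.-1.

Lemma loff12 l o : loff l o = 1 \/ loff l o = 2.
Proof. by rewrite /loff; case: ifP; [left | right]. Qed.

Lemma lvar_lt l o : lvar l o < nvar l.
Proof.
rewrite ltnS /lvar; elim: l o => [|p l IH] [|o] //=; first exact: leq_addr.
by apply: leq_trans (IH o) _; apply: leq_addl.
Qed.

Lemma div4 o r : r < 4 -> (4 * o + r) %/ 4 = o.
Proof. by lia. Qed.

Lemma mod4 o r : r < 4 -> (4 * o + r) %% 4 = r.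
Proof. by lia. Qed.

Lemma nxqP l q q' : q < clen l -> q' < clen l -> (nxq l q' = q <-> q' = prq l q).
Proof. by rewrite /nxq /prq /clen; case: eqP; case: eqP; lia. Qed.

Lemma nxq_lt l q : q < clen l -> nxq l q < clen l.
Proof. by rewrite /nxq /clen; case: eqP; lia. Qed.

Lemma prq_lt l q : q < clen l -> prq l q < clen l.
Proof. by rewrite /prq /clen; case: eqP; lia. Qed.

Definition nxo o := if o %% 5 == 4 then o - 4 else o.+1.
Definition pvo o := if o %% 5 == 0 then o + 4 else o.-1.

Lemma nxo_lt (l : clause) o : 5 %| size l -> o < size l -> nxo o < size l.
Proof. by rewrite /nxo; case: eqP; lia. Qed.

Lemma pvo_lt (l : clause) o : 5 %| size l -> o < size l -> pvo o < size l.
Proof. by rewrite /pvo; case: eqP; lia. Qed.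

Lemma nxoP o o' : nxo o' = o <-> o' = pvo o.
Proof. by rewrite /nxo /pvo; case: eqP; case: eqP; lia. Qed.

(** * The reduction to cubic graphs *)

Section Cubic.
Context (l : clause).

Notation nV := (nvar l).
Notation K := (clen l).
Notation N := (size l).

Definition isport (v : nat * nat) : bool :=
  (lvar l (v.2 %/ 4) == v.1) &&
  ((v.2 %% 4 == loff l (v.2 %/ 4)) || (v.2 %% 4 == (loff l (v.2 %/ 4)).+1)).

Definition portA o : vert := (lvar l o, 4 * o + loff l o, 0).
Definition portB o : vert := (lvar l o, 4 * o + (loff l o).+1, 0).
Definition hub o : vert := (nV, o, 0).

(** The weights let a cycle vertex receive 1 from each of its cycle edges and 2 from its third edge.
    Two matchings supply at most two edges there, so 3 is the maximum, attained with exactly one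
    cycle edge. A hub receives 2 from each of its edges to ports, and its cap edge is worth
    nothing. *)
Definition cyc_edge (v : nat * nat) : wedge := ((v.1, v.2, 0), (v.1, nxq l v.2, 0), (2, 0)).
Definition out_edge o : wedge := (portB o, hub o, (4, 0)).
Definition in_edge o : wedge := (hub o, portA (nxo o), (4, 0)).
Definition cap_edge (v : nat * nat) : wedge :=
  ((v, 0), (v, 1), (if v.1 == nV then 0 else 2, 0)).
(** On the vertices 1, ..., 5 all degrees are 3, except for degree 2 at vertex 1, where the cap edge
    arrives. It is the smallest such graph: with [k] vertices the degree sum [3 * k - 1] is even,
    and three vertices are too few for degree 3. *)
Definition cap_inner : seq (nat * nat) :=
  [:: (1, 2); (1, 3); (2, 4); (2, 5); (3, 4); (3, 5); (4, 5)].
Definition inner_edge (v ij : nat * nat) : wedge := ((v, ij.1), (v, ij.2), (0, 0)).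

Definition capped : seq (nat * nat) :=
  [seq v <- grid nV K | ~~ isport v] ++ [seq (nV, o) | o <- iota 0 N].

Definition cubic_vs : seq vert :=
  [seq (v, 0) | v <- grid nV K] ++ [seq hub o | o <- iota 0 N] ++
  [seq (v, i) | v <- capped, i <- iota 1 5].

Definition cubic_es : seq wedge :=
  [seq cyc_edge v | v <- grid nV K] ++ [seq out_edge o | o <- iota 0 N] ++
  [seq in_edge o | o <- iota 0 N] ++ [seq cap_edge v | v <- capped] ++
  [seq inner_edge v ij | v <- capped, ij <- cap_inner].

Hypothesis l5 : 5 %| N.

Lemma mem_capped v : v \in capped ->
  (v.1 < nV /\ v.2 < K /\ ~~ isport v) \/ (v.1 = nV /\ v.2 < N).
Proof.
rewrite mem_cat mem_filter mem_grid => /orP[/and3P[? ? ?]|/mapP[o]]; first by left.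
by rewrite mem_iota => h ->; right.
Qed.

Lemma capped_uniq : uniq capped.
Proof.
rewrite cat_uniq filter_uniq ?grid_uniq // map_inj_uniq ?iota_uniq; last by move=> ? ? [].
rewrite andbT; apply/hasPn=> v /mapP[o _ ->]; rewrite mem_filter mem_grid /= ltnn.
by rewrite andbF.
Qed.

Inductive kind : wedge -> Prop :=
| KCyc x q of x < nV & q < K : kind (cyc_edge (x, q))
| KOut o of o < N : kind (out_edge o)
| KIn o of o < N : kind (in_edge o)
| KCap v of v \in capped : kind (cap_edge v)
| KInner v ij of v \in capped & ij \in cap_inner : kind (inner_edge v ij).

Lemma kindP e : e \in cubic_es <-> kind e.
Proof.
rewrite !mem_cat; split.
  case/or4P=> [/mapP[[x q]]|/mapP[o]|/mapP[o]|/orP[/mapP[v vc ->]|/allpairsP[[v ij] [vc ic ->]]]].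
  - by rewrite mem_grid => /andP[? ?] ->; constructor.
  - by rewrite mem_iota => ? ->; constructor.
  - by rewrite mem_iota => ? ->; constructor.
  - by constructor.
  - by constructor.
case=> [x q xn qK|o oN|o oN|v vc|v ij vc ic].
- by rewrite map_f // mem_grid xn.
- by rewrite [_ \in map out_edge _]map_f ?orbT // mem_iota.
- by rewrite [_ \in map in_edge _]map_f ?orbT // mem_iota.
- by rewrite [_ \in map cap_edge _]map_f ?orbT.
- by rewrite [_ \in allpairs _ _ _]allpairs_f ?orbT.
Qed.

Lemma inner_lt ij : ij \in cap_inner -> 0 < ij.1 < ij.2.
Proof. by rewrite !inE => /or4P[/eqP->|/eqP->|/eqP->|/or4P[/eqP->|/eqP->|/eqP->|/eqP->]]. Qed.

Lemma inner_le ij : ij \in cap_inner -> 0 < ij.1 <= 5 /\ 0 < ij.2 <= 5.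
Proof. by rewrite !inE => /or4P[/eqP->|/eqP->|/eqP->|/or4P[/eqP->|/eqP->|/eqP->|/eqP->]]. Qed.

Definition ktag (e : wedge) : nat :=
  if e.1.1.2 != 0 then 4 else if e.1.2.2 != 0 then 3 else if e.1.1.1.1 == nV then 2
  else if e.1.2.1.1 == nV then 1 else 0.

Lemma cubic_es_uniq : uniq cubic_es.
Proof.
have T0 e : e \in [seq cyc_edge v | v <- grid nV K] -> ktag e = 0.
  by move=> /mapP[v]; rewrite mem_grid => /andP[h _] ->; rewrite /ktag /= ltn_eqF.
have T1 e : e \in [seq out_edge o | o <- iota 0 N] -> ktag e = 1.
  by move=> /mapP[o _ ->]; rewrite /ktag /= ltn_eqF ?lvar_lt // eqxx.
have T2 e : e \in [seq in_edge o | o <- iota 0 N] -> ktag e = 2.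
  by move=> /mapP[o _ ->]; rewrite /ktag /= eqxx.
have T3 e : e \in [seq cap_edge v | v <- capped] -> ktag e = 3 by move=> /mapP[v _ ->].
have T4 e : e \in [seq inner_edge v ij | v <- capped, ij <- cap_inner] -> ktag e = 4.
  by move=> /allpairsP[[v ij] [/= _ /inner_lt/andP[h _] ->]]; rewrite /ktag /= -lt0n h.
apply: (@cat_uniq_tag _ ktag 0) => //.
- by rewrite map_inj_uniq ?grid_uniq // => -[a b] [c d] [-> ->].
- apply: (@cat_uniq_tag _ ktag 1) => //.
  + by rewrite map_inj_uniq ?iota_uniq // => a b [].
  + apply: (@cat_uniq_tag _ ktag 2) => //.
    * by rewrite map_inj_uniq ?iota_uniq // => a b [].
    * apply: (@cat_uniq_tag _ ktag 3) => //.
      - by rewrite map_inj_uniq ?capped_uniq // => -[a b] [c d] [-> ->].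
      - apply: allpairs_uniq; rewrite ?capped_uniq //.
        by move=> [[a b] [c d]] [[a' b'] [c' d']] _ _ /= E; case: E => *; subst.
      - by move=> e /T4 ->.
    * by move=> e; rewrite mem_cat => /orP[/T3|/T4] ->.
  + by move=> e; rewrite !mem_cat => /or3P[/T2|/T3|/T4] ->.
- by move=> e; rewrite !mem_cat => /or4P[/T1|/T2|/T3|/T4] ->.
Qed.

(** The weight can be read off the ends, so edges that agree in their ordered ends are equal. *)
Lemma kind_wt e : kind e -> e.2 =
  if e.1.1.2 != 0 then (0, 0) else
  if e.1.2.2 != 0 then (if e.1.1.1.1 == nV then 0 else 2, 0) else
  if (e.1.1.1.1 == nV) || (e.1.2.1.1 == nV) then (4, 0) else (2, 0).
Proof.
case=> [x q xn qK|o oN|o oN|v vc|v ij vc /inner_lt/andP[h _]] //=.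
- by rewrite ltn_eqF.
- by rewrite eqxx orbT.
- by rewrite eqxx.
- by rewrite -lt0n h.
Qed.

Lemma kind_le e : kind e -> e.1.1.2 <= e.1.2.2.
Proof. by case=> [x q xn qK|o oN|o oN|v vc|v ij vc /inner_lt/andP[_ h]] //=; apply: ltnW. Qed.

Lemma cubic_wf : wfgraph cubic_vs cubic_es.
Proof.
have vcyc x q : x < nV -> q < K -> ((x, q), 0) \in cubic_vs.
  by move=> xn qK; rewrite mem_cat map_f // mem_grid xn.
have vhub o : o < N -> hub o \in cubic_vs.
  by move=> oN; rewrite !mem_cat [_ \in map hub _]map_f ?orbT // mem_iota.
have vcap v i : v \in capped -> 0 < i <= 5 -> (v, i) \in cubic_vs.
  by move=> vc i5; rewrite !mem_cat [_ \in allpairs _ _ _]allpairs_f ?orbT // mem_iota.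
have offK o : o < N -> 4 * o + (loff l o).+1 < K.
  by rewrite /clen; case: (loff12 l o) => ->; lia.
have vbase v : v \in capped -> (v, 0) \in cubic_vs.
  case: v => x q /mem_capped /= [[? [? _]]|[-> ?]]; [exact: vcyc | exact: vhub].
split.
- apply: (@cat_uniq_tag _ (fun v : vert => if v.2 == 0 then (v.1.1 == nV : nat) else 2) 0).
  + by rewrite map_inj_uniq ?grid_uniq // => a b [].
  + apply: (@cat_uniq_tag _ (fun v : vert => if v.2 == 0 then (v.1.1 == nV : nat) else 2) 1).
    * by rewrite map_inj_uniq ?iota_uniq // => a b [].
    * apply: allpairs_uniq; rewrite ?capped_uniq ?iota_uniq //.
      by move=> [[a b] c] [[a' b'] c'] _ _ /= E; case: E => *; subst.
    * by move=> v /mapP[o _ ->] /=; rewrite eqxx.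
    * move=> v /allpairsP[[w i] [_ /= h ->]] /=; by case: i h.
  + by move=> v /mapP[w]; rewrite mem_grid => /andP[h _] -> /=; rewrite ltn_eqF.
  + move=> v; rewrite mem_cat => /orP[/mapP[o _ ->]|]; first by rewrite /= eqxx.
    move=> /allpairsP[[w i] [_ /= h ->]] /=; by case: i h.
- exact: cubic_es_uniq.
- move=> e /kindP[x q xn qK|o oN|o oN|v vc|v ij vc /= ic] /=.
  + by rewrite !vcyc // nxq_lt.
  + by rewrite vhub // vcyc ?lvar_lt ?offK.
  + have nN := nxo_lt l5 oN.
    by rewrite vhub // vcyc ?lvar_lt //; apply: leq_trans (offK _ nN); rewrite ltnS leq_add2l.
  + by rewrite vbase // vcap.
  + by have [? ?] := inner_le ic; rewrite !vcap.
- move=> e /kindP[x q xn qK|o oN|o oN|v vc|v ij vc /= /inner_lt ic] /=.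
  + by apply/eqP=> -[]; rewrite /nxq /clen in qK *; case: eqP; lia.
  + by apply/eqP=> -[h]; have := lvar_lt l o; rewrite h ltnn.
  + by apply/eqP=> -[h]; have := lvar_lt l (nxo o); rewrite h ltnn.
  + by apply/eqP=> -[].
  + by apply/eqP=> -[E]; move: ic; rewrite E ltnn andbF.
move=> e e' /kindP k /kindP k' [[E1 E2]|[E1 E2]].
  have E : e.1 = e'.1 by rewrite (surjective_pairing e.1) E1 E2 -surjective_pairing.
  by rewrite (surjective_pairing e) (kind_wt k) E -(kind_wt k') -surjective_pairing.
(* Ends are listed by nondecreasing third coordinate. If two edges have exchanged ends then all
   these coordinates agree, which leaves only cycle edges and the edges between ports and hubs. *)
have := kind_le k; have := kind_le k'; rewrite -E1 -E2 => h1 h2.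
have h : e.1.1.2 = e.1.2.2 by apply/eqP; rewrite eqn_leq h1 h2.
have h' : e'.1.1.2 = e'.1.2.2 by rewrite -E1 -E2.
have lo := loff12 l.
case: k E1 E2 h {h1 h2} => [x q xn qK|o oN|o oN|v vc|v ij vc /inner_lt /= ic] E1 E2 h //; last first.
- by move: ic; rewrite [ij.1]h ltnn andbF.
- case: k' E1 E2 h' => [x' q' xn' qK'|o' oN'|o' oN'|v' vc'|v' ij' vc' /inner_lt /= ic'] E1 E2 h' //.
  + by case: E1 => e1; move: xn'; rewrite -e1 ltnn.
  + case: E2 => e1 e2; case: E1 => e3; subst o'.
    by have := lo o; have := lo (nxo o); rewrite /nxo in e2 *; case: eqP e2; lia.
  + by case: E1 => e1; have := lvar_lt l (nxo o'); rewrite -e1 ltnn.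
  + by move: ic'; rewrite [ij'.1]h' ltnn andbF.
- case: k' E1 E2 h' => [x' q' xn' qK'|o' oN'|o' oN'|v' vc'|v' ij' vc' /inner_lt /= ic'] E1 E2 h' //.
  + by case: E2 => e1; move: xn'; rewrite -e1 ltnn.
  + by case: E2 => e1; have := lvar_lt l o'; rewrite -e1 ltnn.
  + case: E1 => e1 e2; case: E2 => e3; subst o'.
    by have := lo o; have := lo (nxo o); rewrite /nxo in e2 *; case: eqP e2; lia.
  + by move: ic'; rewrite [ij'.1]h' ltnn andbF.
case: k' E1 E2 h' => [x' q' xn' qK'|o' oN'|o' oN'|v' vc'|v' ij' vc' /inner_lt /= ic'] E1 E2 h' //.
- case: E1 => _ e1; case: E2 => _ e2; move: e1 e2 qK qK'; rewrite /nxq /clen.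
  by case: eqP; case: eqP; lia.
- by case: E1 => e1; move: xn; rewrite e1 ltnn.
- by case: E2 => e1; move: xn; rewrite e1 ltnn.
- by move: ic'; rewrite [ij'.1]h' ltnn andbF.
Qed.

Definition third_edge (v : nat * nat) : wedge :=
  let o := v.2 %/ 4 in
  if lvar l o == v.1 then
    if v.2 %% 4 == loff l o then in_edge (pvo o)
    else if v.2 %% 4 == (loff l o).+1 then out_edge o else cap_edge v
  else cap_edge v.

Definition star_cyc v := [:: cyc_edge v; cyc_edge (v.1, prq l v.2); third_edge v].
Definition star_hub o := [:: out_edge o; in_edge o; cap_edge (nV, o)].
Definition star_cap v i :=
  (if i == 1 then [:: cap_edge v] else [::]) ++
  [seq inner_edge v ij | ij <- cap_inner & (ij.1 == i) || (ij.2 == i)].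

Lemma third_noport v : ~~ isport v -> third_edge v = cap_edge v.
Proof.
rewrite /isport /third_edge; case: eqP => //= _.
by case: eqP => //= _; case: eqP.
Qed.

Lemma third_kind x q : x < nV -> q < K ->
  [\/ exists o, [/\ o < N, third_edge (x, q) = in_edge (pvo o), x = lvar l o & q = 4 * o + loff l o],
      exists o, [/\ o < N, third_edge (x, q) = out_edge o, x = lvar l o & q = 4 * o + (loff l o).+1] |
      (x, q) \in capped /\ third_edge (x, q) = cap_edge (x, q)].
Proof.
move=> xn qK; have oN : q %/ 4 < N by move: qK; rewrite /clen; lia.
have c0 : (x, q) \notin capped -> isport (x, q).
  by rewrite mem_cat mem_filter mem_grid xn qK !andbT negb_or negbK => /andP[].
case: (boolP ((x, q) \in capped)) => [xc|/c0].
  apply: Or33; split=> //; have [/= [_ [_ np]]|/= [h _]] := mem_capped xc; first exact: third_noport.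
  by move: xn; rewrite h ltnn.
rewrite /isport /= => /andP[/eqP xl pq].
have lo := loff12 l (q %/ 4); have := divn_eq q 4.
case/orP: pq => /eqP r; rewrite /third_edge /= xl eqxx r => eq.
  apply: Or31; exists (q %/ 4); rewrite eqxx; split=> //; lia.
apply: Or32; exists (q %/ 4); rewrite gtn_eqF ?eqxx //; split=> //; lia.
Qed.

Lemma third_in o : o < N -> third_edge (lvar l o, 4 * o + loff l o) = in_edge (pvo o).
Proof.
move=> oN; have lo := loff12 l o; have r4 : loff l o < 4 by lia.
by rewrite /third_edge /= div4 // mod4 // !eqxx.
Qed.

Lemma third_out o : o < N -> third_edge (lvar l o, 4 * o + (loff l o).+1) = out_edge o.
Proof.
move=> oN; have lo := loff12 l o; have r4 : (loff l o).+1 < 4 by lia.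
by rewrite /third_edge /= div4 // mod4 // !eqxx gtn_eqF.
Qed.

Lemma third_cap v : v \in capped -> v.1 < nV -> third_edge v = cap_edge v.
Proof.
move=> vc xn; have [[_ [_ np]]|[h _]] := mem_capped vc; first exact: third_noport.
by move: xn; rewrite h ltnn.
Qed.

Lemma nxo_pvo o : nxo (pvo o) = o. Proof. exact/nxoP. Qed.
Lemma pvo_nxo o : pvo (nxo o) = o. Proof. by apply/esym/nxoP. Qed.

(** Degrees, upper bounds and colourings are all checked on such explicit lists of the edges at a
    vertex. *)
Lemma star_cycP x q : x < nV -> q < K ->
  perm_eq (filter (inc (x, q, 0)) cubic_es) (star_cyc (x, q)).
Proof.
move=> xn qK; apply: star_perm; first exact: cubic_es_uniq.
  have tg : ktag (third_edge (x, q)) != 0.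
    have [[o [oN -> _ _]]|[o [oN -> _ _]]|[_ ->]] := third_kind xn qK; rewrite /ktag //=.
    - by rewrite eqxx.
    - by rewrite (ltn_eqF (lvar_lt _ _)) eqxx.
  have tc q' : ktag (cyc_edge (x, q')) = 0 by rewrite /ktag /= ltn_eqF.
  apply: uniq3.
  - by apply/eqP=> -[]; move: qK; rewrite /prq /clen; case: eqP; lia.
  - by apply: contraNneq tg => <-; rewrite tc.
  - by apply: contraNneq tg => <-; rewrite tc.
move=> e; split.
  rewrite !inE => /or3P[/eqP->|/eqP->|/eqP->]; rewrite kindP.
  - by split; [constructor | rewrite /inc /= eqxx].
  - split; first by constructor => //; apply: prq_lt.
    by rewrite /inc /= (_ : nxq l (prq l q) = q) ?eqxx ?orbT //; apply/nxqP; rewrite // prq_lt.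
  - have [[o [oN -> e1 e2]]|[o [oN -> e1 e2]]|[vc ->]] := third_kind xn qK.
    + split; first by constructor; apply: pvo_lt.
      by rewrite /inc /= nxo_pvo e1 e2 eqxx orbT.
    + by split; [constructor | rewrite /inc /= e1 e2 eqxx].
    + by split; [constructor | rewrite /inc /= eqxx].
case=> /kindP[x' q' xn' qK'|o oN|o oN|v vc|v ij vc /inner_le[ic ic2]] /orP[/eqP|/eqP] /= E.
- by case: E => -> ->; rewrite !inE eqxx.
- case: E => e1 e2; have e3 := (nxqP qK qK').1 (esym e2).
  by rewrite e1 e3 !inE eqxx orbT.
- by case: E => -> ->; rewrite !inE third_out ?eqxx ?orbT.
- by case: E => e0 _; move: xn; rewrite e0 ltnn.
- by case: E => e0 _; move: xn; rewrite e0 ltnn.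
- by case: E => -> ->; rewrite !inE third_in ?nxo_lt // pvo_nxo eqxx !orbT.
- by case: E => E; rewrite -E in vc *; rewrite !inE third_cap ?eqxx ?orbT.
- by case: E.
- by case: E => _ E; rewrite -E in ic.
- by case: E => _ E; rewrite -E in ic2.
Qed.

Lemma hub_capped o : o < N -> (nV, o) \in capped.
Proof. by move=> oN; rewrite mem_cat [(nV, o) \in map _ _]map_f ?orbT // mem_iota. Qed.

Lemma star_hubP o : o < N -> perm_eq (filter (inc (hub o)) cubic_es) (star_hub o).
Proof.
move=> oN; apply: star_perm; first exact: cubic_es_uniq.
  apply: uniq3.
  - by apply/eqP=> -[e _]; have := lvar_lt l o; rewrite e ltnn.
  - by apply/eqP=> -[].
  - by apply/eqP=> -[].
move=> e; split.
  rewrite !inE => /or3P[/eqP->|/eqP->|/eqP->]; rewrite kindP /inc /= ?eqxx ?orbT;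
    split=> //; constructor => //; exact: hub_capped.
case=> /kindP[x q xn qK|o' oN'|o' oN'|v vc|v ij vc /inner_le[ic ic2]] /orP[/eqP|/eqP] /= E.
- by case: E => e0 _; move: xn; rewrite -e0 ltnn.
- by case: E => e0 _; move: xn; rewrite -e0 ltnn.
- by case: E => e0 _; have := lvar_lt l o'; rewrite -e0 ltnn.
- by case: E => ->; rewrite !inE eqxx.
- by case: E => ->; rewrite !inE eqxx orbT.
- by case: E => e0 _; have := lvar_lt l (nxo o'); rewrite -e0 ltnn.
- by case: E => <-; rewrite !inE eqxx !orbT.
- by case: E.
- by case: E => _ E; rewrite -E in ic.
- by case: E => _ E; rewrite -E in ic2.
Qed.

Lemma star_capP v i : v \in capped -> 0 < i <= 5 ->
  perm_eq (filter (inc (v, i)) cubic_es) (star_cap v i).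
Proof.
move=> vc i5; apply: star_perm; first exact: cubic_es_uniq.
  apply: (@cat_uniq_tag _ ktag 3); first by case: ifP.
  - rewrite map_inj_uniq ?filter_uniq // => -[a b] [c d] [-> ->] //.
  - by move=> e; case: ifP => // _; rewrite inE => /eqP->.
  - by move=> e /mapP[ij]; rewrite mem_filter => /andP[_ /inner_lt/andP[h _]] ->; rewrite /ktag /= -lt0n h.
move=> e; rewrite mem_cat; split.
  case/orP=> [|/mapP[ij]].
    case: eqP => // -> /[!inE]/eqP->; rewrite kindP /inc /= eqxx orbT.
    by split=> //; constructor.
  rewrite mem_filter => /andP[h ic] ->; rewrite kindP; split; first by constructor.
  by rewrite /inc /= !xpair_eqE !eqxx /= ![i == _]eq_sym.
case=> /kindP[x q xn qK|o' oN'|o' oN'|w wc|w ij wc ic] /orP[/eqP|/eqP] E;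
  case: E => *; subst; try by [].
- by rewrite eqxx inE eqxx.
- by rewrite map_f ?orbT // mem_filter eqxx.
- by rewrite map_f ?orbT // mem_filter eqxx orbT.
Qed.

Lemma cubic_vsP v : v \in cubic_vs ->
  [\/ exists x q, [/\ v = (x, q, 0), x < nV & q < K],
      exists2 o, v = hub o & o < N | exists w i, [/\ v = (w, i), w \in capped & 0 < i <= 5]].
Proof.
rewrite !mem_cat => /or3P[/mapP[[x q]]|/mapP[o]|/allpairsP[[w i] [/= wc]]].
- by rewrite mem_grid => /andP[? ?] ->; apply: Or31; exists x, q.
- by rewrite mem_iota => ? ->; apply: Or32; exists o.
- by move=> h ->; apply: Or33; exists w, i; split=> //; case: i h => [|[|[|[|[|[|i]]]]]].
Qed.

Lemma cubic_cubic v : v \in cubic_vs -> count (inc v) cubic_es = 3.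
Proof.
rewrite -size_filter => /cubic_vsP[[x [q [-> xn qK]]]|[o -> oN]|[w [i [-> wc i5]]]].
- by rewrite (perm_size (star_cycP xn qK)).
- by rewrite (perm_size (star_hubP oN)).
- rewrite (perm_size (star_capP wc i5)).
  by case: i i5 => [|[|[|[|[|[|i]]]]]].
Qed.

End Cubic.

(** * Satisfiability of a flat list of literals, and local facts on matchings *)

Definition lpol (l : clause) o := (nth (0, true) l o).2.
Definition ltruth (l : clause) (a : nat -> bool) o := a (lvar l o) == lpol l o.
Definition sat5 (l : clause) a := forall j, 5 * j < size l ->
  exists2 i, i < 5 & ltruth l a (5 * j + i).

Lemma sat5_flatten (F : seq clause) a : all (fun c => size c == 5) F ->
  5 %| size (flatten F) /\ (sat5 (flatten F) a <-> cnf_true a F).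
Proof.
elim: F => [|c F IH] /=; first by move=> _; split=> //; split=> // _ j; rewrite ltn0.
case/andP=> /eqP c5 /IH[d IH']; split; first by rewrite size_cat c5 dvdn_addr.
have E0 i : i < 5 -> ltruth (c ++ flatten F) a i = lit_true a (nth (0, true) c i).
  by move=> i5; rewrite /ltruth /lvar /lpol nth_cat c5 i5.
have E1 j i : i < 5 -> ltruth (c ++ flatten F) a (5 * j.+1 + i) = ltruth (flatten F) a (5 * j + i).
  move=> i5; rewrite /ltruth /lvar /lpol nth_cat c5 ifF; last by lia.
  by have -> : 5 * j.+1 + i - 5 = 5 * j + i by lia.
rewrite /cnf_true /= -/(cnf_true a F); split=> [h|/andP[/(has_nthP (0, true))[i]]].
  apply/andP; split.
    have [|i i5] := h 0; first by rewrite size_cat c5.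
    by rewrite muln0 add0n E0 // => t; apply/(has_nthP (0, true)); exists i; rewrite ?c5.
  apply/IH' => j jF; have [|i i5] := h j.+1; first by rewrite size_cat c5; lia.
  by rewrite E1 // => t; exists i.
rewrite c5 => i5 t /IH' h [|j] jF; first by exists i; rewrite // muln0 add0n E0.
have [|k k5 tk] := h j; first by move: jF; rewrite size_cat c5; lia.
by exists k; rewrite // E1.
Qed.

Lemma emat3 es A v e1 e2 e3 : emat es A -> perm_eq (filter (inc v) es) [:: e1; e2; e3] ->
  uniq es -> A e1 + A e2 + A e3 <= 1.
Proof.
move=> mA P u; have uf : uniq [:: e1; e2; e3] by rewrite -(perm_uniq P) filter_uniq.
have M e : e \in [:: e1; e2; e3] -> (e \in es) /\ inc v e.
  by rewrite -(perm_mem P) mem_filter => /andP[].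
have [m1 i1] := M e1 (mem_head _ _).
have [m2 i2] : e2 \in es /\ inc v e2 by apply: M; rewrite !inE eqxx orbT.
have [m3 i3] : e3 \in es /\ inc v e3 by apply: M; rewrite !inE eqxx !orbT.
move: uf; rewrite /= !inE negb_or => /and3P[/andP[n12 n13] n23 _].
have := emat_le1 mA m1 m2 i1 i2 n12; have := emat_le1 mA m1 m3 i1 i3 n13.
have := emat_le1 mA m2 m3 i2 i3 n23.
by case: (A e1); case: (A e2); case: (A e3).
Qed.

(* The second matching element on e is determined by the first one, so the
   matchings alternate along a path of selected edges. *)
Lemma emat_alt es A B v e e' : emat es A -> emat es B -> e \in es -> e' \in es ->
  inc v e -> inc v e' -> e != e' -> A e || B e -> A e' || B e' -> A e' = ~~ A e.
Proof.
move=> mA mB m m' i i' n; have := emat_le1 mA m m' i i' n.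
have := emat_le1 mB m m' i i' n.
by case: (A e); case: (A e'); case: (B e); case: (B e').
Qed.

Lemma sum_star es v st (F : wedge -> nat) : perm_eq (filter (inc v) es) st ->
  \sum_(e <- es | inc v e) F e = \sum_(e <- st) F e.
Proof. by move=> P; rewrite -big_filter (perm_big _ P). Qed.

(** * Correctness of the cubic reduction *)

Section CubicCorrect.
Context (l : clause).
Hypothesis l5 : 5 %| size l.

Notation nV := (nvar l).
Notation K := (clen l).
Notation N := (size l).
Notation es := (cubic_es l).
Notation vs := (cubic_vs l).

(** Cycle edges and edges between ports and hubs are halved; a cap edge gives all its weight to the
    vertex that it completes, and nothing to the inner vertices of the cap. *)
Definition half_weight (v : vert) (e : wedge) : nat :=
  if v.2 != 0 then 0 else
  match ktag l e with 0 => 1 | 1 | 2 => 2 | _ => e.2.1 end.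

Definition vcap (v : vert) := if v.2 == 0 then if v.1.1 == nV then 4 else 3 else 0.

Definition cubic_target := 3 * (nV * K) + 4 * N.

Lemma sum_vcap : \sum_(v <- vs) vcap v = cubic_target.
Proof.
rewrite /cubic_vs !big_cat !big_map big_allpairs /= /cubic_target.
rewrite [\sum_(v <- grid _ _) _](eq_big_seq (fun=> 3)); last first.
  by move=> v; rewrite mem_grid /vcap => /andP[h _] /=; rewrite ltn_eqF.
rewrite [\sum_(o <- iota 0 N) _](eq_bigr (fun=> 4)); last by move=> o _; rewrite /vcap /= eqxx.
rewrite [\sum_(v <- capped _) _]big1 ?addn0; last by move=> v _; rewrite !big_cons big_nil.
by rewrite !big_const_seq !count_predT size_grid size_iota !iter_addn_0.
Qed.

Lemma tag_cyc x q : x < nV -> ktag l (cyc_edge l (x, q)) = 0.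
Proof. by move=> xn; rewrite /ktag /= ltn_eqF. Qed.

Lemma tag_out o : ktag l (out_edge l o) = 1.
Proof. by rewrite /ktag /= (ltn_eqF (lvar_lt _ _)) eqxx. Qed.

Lemma tag_in o : ktag l (in_edge l o) = 2.
Proof. by rewrite /ktag /= eqxx. Qed.

Lemma tag_inner v ij : ij \in cap_inner -> ktag l (inner_edge v ij) = 4.
Proof. by move=> /inner_lt/andP[h _]; rewrite /ktag /= -lt0n h. Qed.

Lemma wvalue_star A B : wvalue es A B =
  \sum_(v <- vs) \sum_(e <- es | inc v e) half_weight v e * (A e || B e).
Proof.
rewrite -(double_count (fun v e => half_weight v e * (A e || B e)) (cubic_wf l5)).
rewrite /wvalue !big_seq; apply: eq_bigr => e /kindP k.
rewrite -mulnDl (_ : e.2.2 = 0) ?mul0n ?addn0; last first.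
  by case: k.
congr (_ * _); case: k => [x q xn qK|o oN|o oN|v vc|v ij vc ic]; rewrite /half_weight.
- by rewrite tag_cyc.
- by rewrite tag_out.
- by rewrite tag_in.
- by rewrite /= addn0.
- by rewrite (tag_inner _ ic); case: ifP; case: ifP.
Qed.

Lemma half_third x q : x < nV -> q < K -> half_weight (x, q, 0) (third_edge l (x, q)) = 2.
Proof.
move=> xn qK; rewrite /half_weight /=.
have [[o [oN -> _ _]]|[o [oN -> _ _]]|[_ ->]] := third_kind l5 xn qK.
- by rewrite tag_in.
- by rewrite tag_out.
- by rewrite /ktag /= ltn_eqF.
Qed.

Lemma sum_star_cyc x q (F : wedge -> nat) : x < nV -> q < K ->
  \sum_(e <- es | inc (x, q, 0) e) half_weight (x, q, 0) e * F e =
  F (cyc_edge l (x, q)) + F (cyc_edge l (x, prq l q)) + 2 * F (third_edge l (x, q)).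
Proof.
move=> xn qK; rewrite (sum_star _ (star_cycP l5 xn qK)) !big_cons big_nil addn0.
by rewrite half_third // /half_weight !tag_cyc //= !mul1n addnA.
Qed.

Lemma sum_star_hub o (F : wedge -> nat) : o < N ->
  \sum_(e <- es | inc (hub l o) e) half_weight (hub l o) e * F e =
  2 * F (out_edge l o) + 2 * F (in_edge l o).
Proof.
move=> oN; rewrite (sum_star _ (star_hubP oN)) !big_cons big_nil addn0.
by rewrite /half_weight tag_out tag_in /= eqxx !mul0n addn0.
Qed.

Lemma sum_star_cap (w : nat * nat) i (F : wedge -> nat) : 0 < i ->
  \sum_(e <- es | inc (w, i) e) half_weight (w, i) e * F e = 0.
Proof. by move=> i0; rewrite big1 // => e _; rewrite /half_weight /= -lt0n i0. Qed.

Lemma cubic_sound A B : emat es A -> emat es B -> cubic_target <= wvalue es A B ->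
  exists a, sat5 l a.
Proof.
move=> mA mB; rewrite -sum_vcap wvalue_star => le.
pose s e := A e || B e.
have tight := sum_tight _ le.
have {tight}T v : v \in vs -> \sum_(e <- es | inc v e) half_weight v e * s e = vcap v.
  apply: tight => {}v /(cubic_vsP)[[x [q [-> xn qK]]]|[o -> oN]|[w [i [-> wc /andP[i0 i5]]]]].
  - rewrite sum_star_cyc // /vcap /= ltn_eqF // /s.
    have := emat3 mA (star_cycP l5 xn qK) (cubic_es_uniq l).
    have := emat3 mB (star_cycP l5 xn qK) (cubic_es_uniq l).
    by move: (A _) (A _) (A _) (B _) (B _) (B _) => [] [] [] [] [] [].
  - rewrite sum_star_hub // /vcap /= eqxx; by case: (A _); case: (B _); case: (A _); case: (B _).
  - by rewrite sum_star_cap.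
(* A total of 3 out of 1, 1 and 2 is only possible with the 2 and exactly one 1. *)
have Tc x q : x < nV -> q < K -> s (third_edge l (x, q)) /\
    s (cyc_edge l (x, q)) = ~~ s (cyc_edge l (x, prq l q)).
  move=> xn qK; have := T (x, q, 0); rewrite sum_star_cyc // /vcap /= ltn_eqF // => h.
  have {h} : s (cyc_edge l (x, q)) + s (cyc_edge l (x, prq l q)) + 2 * s (third_edge l (x, q)) = 3.
    by apply: h; rewrite mem_cat map_f // mem_grid xn.
  by move: (s _) (s _) (s _) => [] [] [].
have Th o : o < N -> s (out_edge l o) /\ s (in_edge l o).
  move=> oN; have := T (hub l o); rewrite sum_star_hub // /vcap /= eqxx => h.
  have {h} : 2 * s (out_edge l o) + 2 * s (in_edge l o) = 4.
    by apply: h; rewrite !mem_cat [_ \in map (hub l) _]map_f ?orbT // mem_iota.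
  by move: (s _) (s _) => [] [].
pose a x := s (cyc_edge l (x, 0)).
have alt x q : x < nV -> q < K -> s (cyc_edge l (x, q)) = a x (+) odd q.
  move=> xn; elim: q => [|q IH] qK; first by rewrite addbF.
  by have [_ ->] := Tc x q.+1 xn qK; rewrite /prq /= IH ?(ltnW qK) // addbN.
have offK o i : o < N -> i <= 3 -> 4 * o + i < K by rewrite /clen; lia.
have lo := loff12 l.
have port o : o < N -> s (cyc_edge l (lvar l o, 4 * o + loff l o)) = ~~ ltruth l a o.
  move=> oN; rewrite alt ?lvar_lt ?offK //; last by have := lo o; lia.
  rewrite oddD oddM /= /ltruth /loff -/(lpol l o).
  by case: (lpol l o); rewrite /= ?addbT ?addbF ?eqb_id ?eqbF_neg ?negbK.
exists a => j jN; case: (boolP (has (fun i => ltruth l a (5 * j + i)) (iota 0 5))).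
  by move=> /hasP[i]; rewrite mem_iota => i5 ti; exists i.
move=> /hasPn allF; exfalso.
pose P o := cyc_edge l (lvar l o, 4 * o + loff l o).
have stepA o : 5 * j <= o < 5 * j + 5 -> [/\ A (out_edge l o) = ~~ A (P o),
    A (in_edge l o) = ~~ A (out_edge l o) & A (P (nxo o)) = ~~ A (in_edge l o)].
  move=> oj; have oN : o < N by have := divnK l5; lia.
  have nN := nxo_lt l5 oN.
  have sP o' : o' < N -> 5 * j <= o' < 5 * j + 5 -> s (P o').
    move=> o'N h; rewrite port //; have := allF (o' - 5 * j).
    by rewrite subnKC; [apply; rewrite mem_iota; lia | lia].
  have nj : 5 * j <= nxo o < 5 * j + 5 by rewrite /nxo; case: eqP; lia.
  have [so si] := Th o oN.
  have inP o' : o' < N -> P o' \in es.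
    by move=> o'N; apply/kindP; constructor; rewrite ?lvar_lt // offK //; have := lo o'; lia.
  have ino : out_edge l o \in es by apply/kindP; constructor.
  have ini : in_edge l o \in es by apply/kindP; constructor.
  have neP e o' : ktag l e != 0 -> P o' != e.
    by apply: contraNneq => <-; rewrite tag_cyc ?lvar_lt.
  split.
  - apply: (emat_alt (v := portB l o) mA mB) => //; rewrite ?inP ?neP ?tag_out //.
    + rewrite /inc /= /portB /nxq ifF ?addnS ?eqxx ?orbT //.
      by apply/negbTE; rewrite neq_ltn; have := offK o (loff l o).+1 oN; have := lo o; lia.
    + by rewrite /inc /= eqxx.
    + exact: sP.
  - apply: (emat_alt (v := hub l o) mA mB) => //; rewrite /inc /= ?eqxx ?orbT //.
    by apply/eqP=> E; have := tag_in o; rewrite -E tag_out.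
  - apply: (emat_alt (v := portA l (nxo o)) mA mB) => //; rewrite ?inP //.
    + by rewrite /inc /= eqxx orbT.
    + by rewrite /inc /= eqxx.
    + by rewrite eq_sym neP // tag_in.
    + exact: sP.
(* Membership in [A] changes three times from one port edge to the next. Going round the five
   occurrences of the clause changes it an odd number of times in all, which is absurd. *)
have step o : 5 * j <= o < 5 * j + 5 -> A (P (nxo o)) = ~~ A (P o).
  by move=> /stepA[-> -> ->]; rewrite !negbK.
have E i : i < 4 -> nxo (5 * j + i) = 5 * j + i.+1.
  by move=> i4; rewrite /nxo; case: eqP; lia.
have E4 : nxo (5 * j + 4) = 5 * j + 0 by rewrite /nxo; case: eqP; lia.
have := step (5 * j + 0); have := step (5 * j + 1); have := step (5 * j + 2).
have := step (5 * j + 3); have := step (5 * j + 4).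
rewrite (E 0) // (E 1) // (E 2) // (E 3) // E4 => h4 h3 h2 h1 h0.
have := h4 ltac:(lia); rewrite h3 ?h2 ?h1 ?h0; try lia.
Qed.

Lemma good3 (sel col : wedge -> bool) e1 e2 e3 e e' :
  (sel e1 -> sel e2 -> col e1 != col e2) -> (sel e1 -> sel e3 -> col e1 != col e3) ->
  (sel e2 -> sel e3 -> col e2 != col e3) ->
  e \in [:: e1; e2; e3] -> e' \in [:: e1; e2; e3] -> sel e -> sel e' -> col e = col e' -> e = e'.
Proof.
move=> h12 h13 h23; rewrite !inE => /or3P[]/eqP-> /or3P[]/eqP-> //.
- by move=> a b c; have := h12 a b; rewrite c eqxx.
- by move=> a b c; have := h13 a b; rewrite c eqxx.
- by move=> a b c; have := h12 b a; rewrite c eqxx.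
- by move=> a b c; have := h23 a b; rewrite c eqxx.
- by move=> a b c; have := h13 b a; rewrite c eqxx.
- by move=> a b c; have := h23 b a; rewrite c eqxx.
Qed.

(* In each clause the edges of the odd cycle are coloured alternately, starting
   behind the port edge of the first true literal. *)
Section Complete.
Context (a : nat -> bool).
Hypothesis sat : sat5 l a.

Definition first_true j := find (fun i => ltruth l a (5 * j + i)) (iota 0 5).
Definition delay o := (o %% 5 + 5 - first_true (o %/ 5)) %% 5.

Lemma first_trueP o : o < N -> first_true (o %/ 5) < 5 /\
  ltruth l a (5 * (o %/ 5) + first_true (o %/ 5)).
Proof.
move=> oN; have [|i i5 ti] := sat (j := o %/ 5); first by lia.
have h : has (fun i => ltruth l a (5 * (o %/ 5) + i)) (iota 0 5).
  by apply/hasP; exists i; rewrite ?mem_iota.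
have f5 : first_true (o %/ 5) < 5 by rewrite -[X in _ < X](size_iota 0 5) -has_find.
by split=> //; have := nth_find 0 h; rewrite nth_iota.
Qed.

(** From [pvo o] to [o] the delay grows by one, except at the first true literal, where it drops
    from 4 to 0 and keeps its parity. A false literal is never that exception. *)
Lemma odd_delay o : o < N -> ~~ ltruth l a o -> odd (delay o) = ~~ odd (delay (pvo o)).
Proof.
move=> oN nt; have [f5 tf] := first_trueP oN.
have ne : o %% 5 != first_true (o %/ 5).
  by apply: contraNneq nt => e; rewrite (divn_eq o 5) mulnC e.
have dp : pvo o %/ 5 = o %/ 5 by rewrite /pvo; case: eqP; lia.
have : delay o = (delay (pvo o)).+1.
  rewrite /delay dp; move: f5 ne; set f := first_true _ => f5 ne.
  by rewrite /pvo; case: eqP; lia.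
by move=> ->.
Qed.

Definition cyc_sel (v : nat * nat) := a v.1 (+) odd v.2.
(** Selected cycle edges do not meet, so the only conflicts are with third edges. Near a port the
    colour is opposite to that of the edge to the hub; elsewhere it is arbitrary, and the cap edge
    takes the colour opposite to the selected cycle edge at its vertex. An unselected port edge has
    no conflict, which is why a true literal breaks the odd cycle. *)
Definition cyc_col (v : nat * nat) :=
  let o := v.2 %/ 4 in
  if lvar l o == v.1 then
    if (v.2 %% 4 == loff l o) || (v.2 %% 4 == (loff l o).+1) then ~~ odd (delay o)
    else if (v.2 %% 4).+1 == loff l o then odd (delay (pvo o)) else false
  else false.

Definition sel (e : wedge) : bool :=
  match ktag l e with
  | 0 => cyc_sel e.1.1.1 | 1 | 2 => true | 3 => e.1.1.1.1 != nV | _ => false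
  end.

Definition col (e : wedge) : bool :=
  match ktag l e with
  | 0 => cyc_col e.1.1.1
  | 1 => odd (delay e.1.2.1.2)
  | 2 => ~~ odd (delay e.1.1.1.2)
  | 3 => let v := e.1.1.1 in
         ~~ (if cyc_sel v then cyc_col v else cyc_col (v.1, prq l v.2))
  | _ => false
  end.

Lemma cyc_sel_prq x q : q < K -> cyc_sel (x, prq l q) = ~~ cyc_sel (x, q).
Proof.
move=> qK; rewrite /cyc_sel /= -addbN; congr (_ (+) _).
by move: qK; rewrite /prq /clen; case: q => [|q] /=; rewrite ?negbK //; lia.
Qed.

Lemma sel_cyc x q : x < nV -> sel (cyc_edge l (x, q)) = cyc_sel (x, q).
Proof. by move=> xn; rewrite /sel tag_cyc. Qed.

Lemma col_cyc x q : x < nV -> col (cyc_edge l (x, q)) = cyc_col (x, q).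
Proof. by move=> xn; rewrite /col tag_cyc. Qed.

Lemma sel_third x q : x < nV -> q < K -> sel (third_edge l (x, q)).
Proof.
move=> xn qK; rewrite /sel.
have [[o [oN -> _ _]]|[o [oN -> _ _]]|[_ ->]] := third_kind l5 xn qK.
- by rewrite tag_in.
- by rewrite tag_out.
- by rewrite /= ltn_eqF.
Qed.

Lemma port_sel o : cyc_sel (lvar l o, 4 * o + loff l o) = ~~ ltruth l a o.
Proof.
rewrite /cyc_sel /= oddD oddM /= /ltruth /loff -/(lpol l o).
by case: (lpol l o); rewrite /= ?addbT ?addbF ?eqb_id ?eqbF_neg ?negbK.
Qed.

Lemma col_third1 x q : x < nV -> q < K -> cyc_sel (x, q) ->
  cyc_col (x, q) != col (third_edge l (x, q)).
Proof.
move=> xn qK cs; have lo := loff12 l.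
have [[o [oN -> e1 e2]]|[o [oN -> e1 e2]]|[_ ->]] := third_kind l5 xn qK.
- rewrite /col tag_in /cyc_col /= e2 e1 div4 ?mod4; try by have := lo o; lia.
  rewrite !eqxx /= odd_delay ?negbK; first by case: (odd _).
    by [].
  by rewrite -port_sel -e1 -e2.
- rewrite /col tag_out /cyc_col /= e2 e1 div4 ?mod4; try by have := lo o; lia.
  by rewrite !eqxx orbT; case: (odd _).
- by rewrite /col /= cs; case: (cyc_col _).
Qed.

Lemma col_third2 x q : x < nV -> q < K -> ~~ cyc_sel (x, q) ->
  cyc_col (x, prq l q) != col (third_edge l (x, q)).
Proof.
move=> xn qK cs; have lo := loff12 l.
have [[o [oN -> e1 e2]]|[o [oN -> e1 e2]]|[_ ->]] := third_kind l5 xn qK.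
- have -> : prq l q = 4 * o + (loff l o).-1 by rewrite /prq; have := lo o; case: eqP; lia.
  rewrite /col tag_in /cyc_col /= e1 div4 ?mod4; try by have := lo o; lia.
  rewrite eqxx prednK; last by have := lo o; lia.
  rewrite eqxx ifF; first by case: (odd _).
  by have := lo o; case=> ->.
- have -> : prq l q = 4 * o + loff l o by rewrite /prq; have := lo o; case: eqP; lia.
  rewrite /col tag_out /cyc_col /= e1 div4 ?mod4; try by have := lo o; lia.
  by rewrite !eqxx; case: (odd _).
- by rewrite /col /= (negbTE cs); case: (cyc_col _).
Qed.

Lemma proper v e e' : e \in es -> e' \in es -> inc v e -> inc v e' ->
  sel e -> sel e' -> col e = col e' -> e = e'.
Proof.
move=> ein ein' i i'.
have vin : v \in vs.
  by have /andP[u1 u2] := wf_in (cubic_wf l5) ein; case/orP: i => /eqP->.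
have fe : e \in filter (inc v) es by rewrite mem_filter i.
have fe' : e' \in filter (inc v) es by rewrite mem_filter i'.
have [[x [q [E xn qK]]]|[o E oN]|[w [k [E wc k5]]]] := cubic_vsP vin; rewrite E in fe fe'.
- rewrite (perm_mem (star_cycP l5 xn qK)) in fe; rewrite (perm_mem (star_cycP l5 xn qK)) in fe'.
  apply: (good3 _ _ _ fe fe'); rewrite !sel_cyc // ?cyc_sel_prq //.
  + by move=> ->.
  + by move=> cs _; rewrite col_cyc // col_third1.
  + by move=> cs _; rewrite col_cyc // col_third2.
- rewrite (perm_mem (star_hubP oN)) in fe; rewrite (perm_mem (star_hubP oN)) in fe'.
  apply: (good3 _ _ _ fe fe').
  + by rewrite /col tag_in tag_out /=; case: (odd _).
  + by rewrite {2}/sel /= eqxx.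
  + by rewrite {2}/sel /= eqxx.
have S f : f \in filter (inc (w, k)) es -> sel f -> f = cap_edge l w.
  rewrite (perm_mem (star_capP wc k5)) mem_cat => /orP[|/mapP[ij]].
    by case: ifP => // _; rewrite inE => /eqP.
  by rewrite mem_filter => /andP[_ ic] ->; rewrite /sel tag_inner.
by move=> /(S _ fe)-> /(S _ fe')->.
Qed.

Lemma cubic_complete : exists A B, [/\ emat es A, emat es B & cubic_target <= wvalue es A B].
Proof.
exists (fun e => sel e && col e), (fun e => sel e && ~~ col e); split.
- move=> v e e' ein ein' /andP[s c] /andP[s' c'] i i'.
  by apply: (proper ein ein' i i') => //; rewrite c c'.
- move=> v e e' ein ein' /andP[s /negbTE c] /andP[s' /negbTE c'] i i'.
  by apply: (proper ein ein' i i') => //; rewrite c c'.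
rewrite wvalue_star -sum_vcap !big_seq; apply: leq_sum => v.
have S e : (sel e && col e) || (sel e && ~~ col e) = sel e by case: (sel e); case: (col e).
rewrite (eq_bigr (fun e => half_weight v e * sel e)); last by move=> e _; rewrite S.
case/(cubic_vsP)=> [[x [q [-> xn qK]]]|[o -> oN]|[w [i [-> wc /andP[i0 i5]]]]].
- rewrite (sum_star_cyc (fun e => nat_of_bool (sel e))) // !sel_cyc // cyc_sel_prq // sel_third //.
  by rewrite /vcap /= ltn_eqF //; case: (cyc_sel _).
- rewrite (sum_star_hub (fun e => nat_of_bool (sel e))) // /sel tag_in tag_out.
  by rewrite /vcap /= eqxx.
- by rewrite /vcap /= gtn_eqF.
Qed.

End Complete.
End CubicCorrect.

#[export] Instance fp_cubic_vs : FP1 cubic_vs.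
Proof.
rewrite /FP1 /cubic_vs /capped /isport /hub /grid /nvar /clen /lvar /loff /unzip1.
by fp.
Qed.

#[export] Instance fp_cubic_es : FP1 cubic_es.
Proof.
rewrite /FP1 /cubic_es /capped /cyc_edge /out_edge /in_edge /cap_edge /inner_edge /portA
  /portB /isport /hub /grid /nxq /nxo /nvar /clen /lvar /loff /unzip1.
by fp.
Qed.

(** The common frame of both reductions: a gadget has to supply lists and a target that are
    computable in polynomial time, and the equivalence for nonempty lists of literals whose length
    is divisible by five. *)
Lemma NP_hard_wedges (P : shift_inst -> Prop) (vs : clause -> seq vert)
    (es : clause -> seq wedge) (target : clause -> nat) :
  FP vs -> FP es -> FP target ->
  (forall l, 5 %| size l -> l != [::] ->
    [/\ 0 < size (vs l), 
        exists (w : wfgraph (vs l) (es l)), forall h : 0 < size (vs l), P (sinst w h) &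
        (exists a, sat5 l a) <->
        (exists A B, [/\ emat (es l) A, emat (es l) B & target l <= wvalue (es l) A B])]) ->
  NP_hard_max (Q := matching_shifting) P.
Proof.
move=> Fvs Fes Ft H L /cook_levin[F [FF F5 F0 LF]].
pose f w := let l := flatten (F w) in
  inst_word (vs l) (es l) ++ false :: enc_nat (target l).
have ? : FP1 vs := Fvs.
have ? : FP1 es := Fes.
have ? : FP1 target := Ft.
have ? : FP1 F := FF.
exists f; first by apply: polytime_FP; rewrite /f; fp.
move=> w; have [d h] : 5 %| size (flatten (F w)) /\ ((exists a, sat5 (flatten (F w)) a) <-> L w).
  split; first by have [] := sat5_flatten (fun=> true) (F5 w).
  rewrite LF; split=> -[a ha]; exists a; have [_ e] := sat5_flatten a (F5 w); exact/e.
have n0 : flatten (F w) != [::].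
  have := F5 w; have := F0 w; case: (F w) => // c G _ /= /andP[]; by case: c.
have [s0 [wf PI] e] := H _ d n0.
exists (sinst wf s0, Posz (target (flatten (F w)))); first exact: PI.
split; first by rewrite /f -(enc_sinst wf s0).
have Y := sinst_yes wf s0 (target (flatten (F w))).
by split=> [/h/e/Y|/Y/e/h].
Qed.

Lemma cubic_hard : NP_hard_max (Q := matching_shifting)
  (fun I : shift_inst => [/\ cubic (si_graph I), shifted (si_c I) & si_n I = 2]).
Proof.
apply: (@NP_hard_wedges _ cubic_vs cubic_es cubic_target).
- exact: fp_cubic_vs.
- exact: fp_cubic_es.
- by rewrite /cubic_target /nvar /clen /unzip1; fp.
move=> l l5 l0; split.
- rewrite size_cat size_map size_grid addn_gt0 muln_gt0 /clen muln_gt0 /=.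
  by case: l l0 {l5}.
- exists (cubic_wf l5) => h; split=> //.
    by apply: sinst_cubic; apply: cubic_cubic.
  apply: sinst_shifted => e /kindP[] //.
split=> [[a sat]|[A [B [mA mB le]]]]; first exact: cubic_complete sat.
exact: cubic_sound le.
Qed.

(** * The reduction to bipartite graphs *)

Lemma emat_sum_le1 (T : eqType) (s : seq T) (A : pred T) : uniq s ->
  (forall e e', e \in s -> e' \in s -> A e -> A e' -> e = e') -> \sum_(e <- s) A e <= 1.
Proof.
elim: s => [|e s IH]; first by rewrite big_nil.
rewrite /= big_cons => /andP[es us] h; case Ae: (A e); last first.
  by apply: IH => // x y xs ys; apply: h; rewrite inE ?xs ?ys orbT.
rewrite big1_seq // => x /andP[_ xs]; case Ax: (A x) => //.
by move: es; rewrite (h e x) ?xs // inE ?eqxx // xs orbT.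
Qed.

Section Bipartite.
Context (l : clause).

Notation nV := (nvar l).
Notation K := (clen l).
Notation N := (size l).

(** The tap of [o] ends at position [4 * o + 1], between the cycle edges number [4 * o] and
    [4 * o + 1]. The thin one is the one selected when the literal is true. It earns its weight in a
    single matching and so leaves the vertex free in the other one. *)
Definition thin (v : nat * nat) : bool :=
  (lvar l (v.2 %/ 4) == v.1) && ((v.2 %% 4).+1 == loff l (v.2 %/ 4)).

Definition vcyc_edge (v : nat * nat) : wedge :=
  ((v.1, v.2, 0), (v.1, nxq l v.2, 0), if thin v then (2, 0) else (0, 2)).
Definition tap_edge o : wedge := ((lvar l o, 4 * o + 1, 0), (nV, o %/ 5, 0), (1, 0)).
(** The full profit 3 of a clause vertex requires the leaf edge in one matching and a tap in the
    other: two taps, or the leaf edge twice, give at most 2. *)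
Definition leaf_edge j : wedge := ((nV, j, 0), (nV, j, 1), (2, 0)).

Definition bip_vs : seq vert :=
  [seq (v, 0) | v <- grid nV K] ++ [seq (nV, j, 0) | j <- iota 0 (N %/ 5)] ++
  [seq (nV, j, 1) | j <- iota 0 (N %/ 5)].

Definition bip_es : seq wedge :=
  [seq vcyc_edge v | v <- grid nV K] ++ [seq tap_edge o | o <- iota 0 N] ++
  [seq leaf_edge j | j <- iota 0 (N %/ 5)].

Hypothesis l5 : 5 %| N.

Inductive bkind : wedge -> Prop :=
| BCyc x q of x < nV & q < K : bkind (vcyc_edge (x, q))
| BTap o of o < N : bkind (tap_edge o)
| BLeaf j of j < N %/ 5 : bkind (leaf_edge j).

Lemma bkindP e : e \in bip_es <-> bkind e.
Proof.
rewrite !mem_cat; split.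
  case/or3P=> [/mapP[[x q]]|/mapP[o]|/mapP[j]].
  - by rewrite mem_grid => /andP[? ?] ->; constructor.
  - by rewrite mem_iota => ? ->; constructor.
  - by rewrite mem_iota => ? ->; constructor.
case=> [x q xn qK|o oN|j jN].
- by rewrite map_f // mem_grid xn.
- by rewrite [_ \in map tap_edge _]map_f ?orbT // mem_iota.
- by rewrite [_ \in map leaf_edge _]map_f ?orbT // mem_iota.
Qed.

Definition btag (e : wedge) : nat :=
  if e.1.2.2 != 0 then 2 else if e.1.2.1.1 == nV then 1 else 0.

Lemma btag_cyc x q : x < nV -> btag (vcyc_edge (x, q)) = 0.
Proof. by move=> xn; rewrite /btag /= ltn_eqF. Qed.

Lemma btag_tap o : btag (tap_edge o) = 1. Proof. by rewrite /btag /= eqxx. Qed.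

Lemma bip_es_uniq : uniq bip_es.
Proof.
apply: (@cat_uniq_tag _ btag 0).
- by rewrite map_inj_uniq ?grid_uniq // => -[a b] [c d] [-> ->].
- apply: (@cat_uniq_tag _ btag 1).
  + by rewrite map_inj_uniq ?iota_uniq // => a b [] _ h _; lia.
  + by rewrite map_inj_uniq ?iota_uniq // => a b [].
  + by move=> e /mapP[o _ ->]; rewrite btag_tap.
  + by move=> e /mapP[j _ ->].
- by move=> e /mapP[[x q]]; rewrite mem_grid => /andP[h _] ->; rewrite btag_cyc.
- by move=> e; rewrite mem_cat => /orP[]/mapP[o _ ->] //; rewrite btag_tap.
Qed.

Lemma tap_lt o : o < N -> 4 * o + 1 < K. Proof. by rewrite /clen; lia. Qed.

Lemma bip_wf : wfgraph bip_vs bip_es.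
Proof.
have vcyc x q : x < nV -> q < K -> ((x, q), 0) \in bip_vs.
  by move=> xn qK; rewrite mem_cat map_f // mem_grid xn.
have vcl j i : j < N %/ 5 -> (i == 0) || (i == 1) -> (nV, j, i) \in bip_vs.
  move=> jN /orP[]/eqP->; rewrite !mem_cat.
    by rewrite [_ \in map (fun j => (nV, j, 0)) _]map_f ?orbT // mem_iota.
  by rewrite [_ \in map (fun j => (nV, j, 1)) _]map_f ?orbT // mem_iota.
pose t (v : vert) := if v.2 == 0 then (v.1.1 == nV : nat) else 2.
split.
- apply: (@cat_uniq_tag _ t 0).
  + by rewrite map_inj_uniq ?grid_uniq // => a b [].
  + apply: (@cat_uniq_tag _ t 1).
    * by rewrite map_inj_uniq ?iota_uniq // => a b [].
    * by rewrite map_inj_uniq ?iota_uniq // => a b [].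
    * by move=> v /mapP[o _ ->]; rewrite /t /= eqxx.
    * by move=> v /mapP[o _ ->].
  + by move=> v /mapP[w]; rewrite mem_grid => /andP[h _] ->; rewrite /t /= ltn_eqF.
  + by move=> v; rewrite mem_cat => /orP[]/mapP[o _ ->] //; rewrite /t /= eqxx.
- exact: bip_es_uniq.
- move=> e /bkindP[x q xn qK|o oN|j jN] /=.
  + by rewrite !vcyc // nxq_lt.
  + by rewrite vcyc ?lvar_lt ?tap_lt // vcl //; lia.
  + by rewrite !vcl.
- move=> e /bkindP[x q xn qK|o oN|j jN] /=.
  + by apply/eqP=> -[]; rewrite /nxq /clen in qK *; case: eqP; lia.
  + by apply/eqP=> -[h]; have := lvar_lt l o; rewrite h ltnn.
  + by apply/eqP=> -[].
have lv := lvar_lt l.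
move=> e e' /bkindP[x q xn qK|o oN|j jN] /bkindP[x' q' xn' qK'|o' oN'|j' jN'] [] [E1 E2] //.
- by case: E1 => -> ->.
- case: E1 => _ e1; case: E2 => _ e2; move: e1 e2 qK qK'; rewrite /nxq /clen.
  by case: eqP; case: eqP; lia.
- by case: E2 => e1; move: xn; rewrite e1 ltnn.
- by case: E1 => e1; move: xn; rewrite e1 ltnn.
- by case: E2 => e1; move: xn'; rewrite -e1 ltnn.
- by case: E2 => e1; move: xn'; rewrite -e1 ltnn.
- by case: E1 => _ e1; have -> : o = o' by lia.
- by case: E1 => e1; have := lv o; rewrite e1 ltnn.
- by case: E1 => ->.
Qed.

(** Cycles have even length, and taps join odd positions to clause vertices, which lie on the side
    of the even positions. *)
Lemma bip_bipartite : exists side : vert -> bool,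
  forall e, e \in bip_es -> side e.1.1 != side e.1.2.
Proof.
exists (fun v => if v.1.1 == nV then v.2 != 0 else odd v.1.2).
move=> e /bkindP[x q xn qK|o oN|j jN] /=.
- rewrite ltn_eqF // /nxq; case: (q.+1 =P K) => e1 /=; last by case: (odd q).
  by have := congr1 odd e1; rewrite /= /clen oddM /=; case: (odd q).
- by rewrite ltn_eqF ?lvar_lt // eqxx oddD oddM.
- by rewrite eqxx.
Qed.

Definition star_vcyc (v : nat * nat) :=
  [:: vcyc_edge v; vcyc_edge (v.1, prq l v.2)] ++
  (if (lvar l (v.2 %/ 4) == v.1) && (v.2 %% 4 == 1) then [:: tap_edge (v.2 %/ 4)] else [::]).
Definition star_clause j := leaf_edge j :: [seq tap_edge (5 * j + i) | i <- iota 0 5].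

Lemma star_vcycP x q : x < nV -> q < K ->
  perm_eq (filter (inc (x, q, 0)) bip_es) (star_vcyc (x, q)).
Proof.
move=> xn qK; apply: star_perm; first exact: bip_es_uniq.
  apply: (@cat_uniq_tag _ btag 0).
  - rewrite /= inE andbT; apply/eqP=> -[] + _ _.
    by move: qK; rewrite /prq /clen; case: eqP; lia.
  - by case: ifP.
  - by move=> e; rewrite !inE => /orP[]/eqP->; rewrite btag_cyc.
  - by move=> e; case: ifP => // _; rewrite inE => /eqP->; rewrite btag_tap.
move=> e; rewrite mem_cat !inE -orbA; split.
  case/or3P=> [/eqP->|/eqP->|]; rewrite bkindP.
  - by split; [constructor | rewrite /inc /= eqxx].
  - split; first by constructor => //; apply: prq_lt.
    by rewrite /inc /= (_ : nxq l (prq l q) = q) ?eqxx ?orbT //; apply/nxqP; rewrite // prq_lt.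
  - case: ifP => // /andP[/eqP e1 /eqP e2]; rewrite inE => /eqP->.
    rewrite /= in e1 e2 *; split; first by apply: BTap; move: qK; rewrite /clen; lia.
    by rewrite /inc /= e1 (_ : 4 * (q %/ 4) + 1 = q) ?eqxx //; lia.
case=> /bkindP[x' q' xn' qK'|o oN|j jN] /orP[/eqP|/eqP] E; case: E.
- by move=> -> ->; rewrite eqxx.
- move=> e1 e2; have e3 := (nxqP qK qK').1 (esym e2).
  by rewrite e1 e3 eqxx orbT.
- by move=> -> -> /=; rewrite div4 // mod4 // !eqxx !inE eqxx !orbT.
- by move=> e0 _; move: xn; rewrite e0 ltnn.
- by move=> e0 _; move: xn; rewrite e0 ltnn.
- by move=> e0.
Qed.

Lemma star_clauseP j : j < N %/ 5 ->
  perm_eq (filter (inc (nV, j, 0)) bip_es) (star_clause j).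
Proof.
move=> jN; apply: star_perm; first exact: bip_es_uniq.
  rewrite cons_uniq map_inj_uniq ?iota_uniq ?andbT.
    by apply/mapP=> -[i _ /(congr1 btag)]; rewrite btag_tap.
  by move=> a b [] _ h _; lia.
move=> e; rewrite inE; split.
  case/orP=> [/eqP->|/mapP[i]]; rewrite bkindP; first by split; [constructor | rewrite /inc /= eqxx].
  rewrite mem_iota => i5 ->; split; first by constructor; lia.
  rewrite /inc /= [in X in _ || X](_ : (5 * j + i) %/ 5 = j) ?eqxx ?orbT //; lia.
case=> /bkindP[x' q' xn' qK'|o oN|j' jN'] /orP[/eqP|/eqP] E; case: E.
- by move=> e0 _; move: xn'; rewrite -e0 ltnn.
- by move=> e0 _; move: xn'; rewrite -e0 ltnn.
- by move=> e0 _; have := lvar_lt l o; rewrite -e0 ltnn.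
- move=> ->; apply/orP; right; apply/mapP; exists (o %% 5).
    by rewrite mem_iota; lia.
  by congr tap_edge; lia.
- by move=> ->; rewrite eqxx.
- by [].
Qed.

(** Each edge has exactly one nonzero weight component, so its contribution is all or nothing. *)
Definition chosen (A B : pred wedge) (e : wedge) : bool :=
  if e.2.1 == 0 then A e && B e else A e || B e.

Definition bweight (v : vert) (e : wedge) : nat :=
  match btag e with
  | 0 => 1 | 1 => (v.1.1 == nV) | _ => if v.2 == 0 then 2 else 0
  end.

Definition bcap (v : vert) := if v.2 == 0 then if v.1.1 == nV then 3 else 1 else 0.

Definition bip_target := nV * K + 3 * (N %/ 5).

Lemma sum_bcap : \sum_(v <- bip_vs) bcap v = bip_target.
Proof.
rewrite /bip_vs !big_cat !big_map /= /bip_target.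
rewrite [\sum_(v <- grid _ _) _](eq_big_seq (fun=> 1)); last first.
  by move=> v; rewrite mem_grid /bcap => /andP[h _] /=; rewrite ltn_eqF.
rewrite [\sum_(o <- iota 0 _) _](eq_bigr (fun=> 3)); last by move=> o _; rewrite /bcap /= eqxx.
rewrite [\sum_(o <- iota 0 _) bcap (_, _, 1)]big1 ?addn0 //.
by rewrite !big_const_seq !count_predT size_grid size_iota !iter_addn_0 mul1n.
Qed.

Lemma bwvalue_star A B : wvalue bip_es A B =
  \sum_(v <- bip_vs) \sum_(e <- bip_es | inc v e) bweight v e * chosen A B e.
Proof.
rewrite -(double_count (fun v e => bweight v e * chosen A B e) bip_wf).
rewrite /wvalue !big_seq; apply: eq_bigr => e /bkindP k.
rewrite -mulnDl; case: k => [x q xn qK|o oN|j jN]; rewrite /bweight /chosen.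
- by rewrite btag_cyc //=; case: ifP; rewrite /= ?mul0n ?addn0 ?add0n.
- by rewrite btag_tap /= eqxx (ltn_eqF (lvar_lt _ _)) mul0n addn0.
- by rewrite /= mul0n addn0.
Qed.

Lemma bsum_cyc x q A B : x < nV -> q < K ->
  \sum_(e <- bip_es | inc (x, q, 0) e) bweight (x, q, 0) e * chosen A B e =
  chosen A B (vcyc_edge (x, q)) + chosen A B (vcyc_edge (x, prq l q)).
Proof.
move=> xn qK; rewrite (sum_star _ (star_vcycP xn qK)) big_cat /= !big_cons big_nil addn0.
rewrite /bweight !btag_cyc // !mul1n big1_seq ?addn0 // => e /andP[_].
by case: ifP => // _; rewrite inE => /eqP->; rewrite btag_tap /= ltn_eqF.
Qed.

Lemma bsum_clause j A B : j < N %/ 5 ->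
  \sum_(e <- bip_es | inc (nV, j, 0) e) bweight (nV, j, 0) e * chosen A B e =
  2 * (A (leaf_edge j) || B (leaf_edge j)) +
  \sum_(i <- iota 0 5) (A (tap_edge (5 * j + i)) || B (tap_edge (5 * j + i))).
Proof.
move=> jN; rewrite (sum_star _ (star_clauseP jN)) big_cons big_map; congr (_ + _).
by apply: eq_bigr => i _; rewrite /bweight btag_tap /= eqxx mul1n.
Qed.

Lemma bip_vsP v : v \in bip_vs ->
  [\/ exists x q, [/\ v = (x, q, 0), x < nV & q < K],
      exists2 j, v = (nV, j, 0) & j < N %/ 5 | exists2 j, v = (nV, j, 1) & j < N %/ 5].
Proof.
rewrite !mem_cat => /or3P[/mapP[[x q]]|/mapP[o]|/mapP[o]].
- by rewrite mem_grid => /andP[? ?] ->; apply: Or31; exists x, q.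
- by rewrite mem_iota => ? ->; apply: Or32; exists o.
- by rewrite mem_iota => ? ->; apply: Or33; exists o.
Qed.

(** Adjacent thin edges could both be chosen, one in each matching, which would break the bound 1 at
    their common vertex. *)
Lemma thin_prq x q : q < K -> thin (x, q) -> ~~ thin (x, prq l q).
Proof.
rewrite /thin /= => qK /andP[/eqP e1 /eqP e2]; apply/negP=> /andP[/eqP e3 /eqP e4].
have := loff12 l (q %/ 4); have := loff12 l (prq l q %/ 4).
have [q0|q0] := posnP (q %% 4).
  by move: e4 qK; rewrite /prq /clen; case: eqP; lia.
have e5 : prq l q %/ 4 = q %/ 4 by rewrite /prq; case: eqP; lia.
by rewrite e5 in e4 *; move: e4; rewrite /prq; case: eqP; lia.
Qed.

Lemma bip_sound A B : emat bip_es A -> emat bip_es B -> bip_target <= wvalue bip_es A B ->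
  exists a, sat5 l a.
Proof.
move=> mA mB; rewrite -sum_bcap bwvalue_star => le.
have tight := sum_tight _ le.
have ce (v : nat * nat) : chosen A B (vcyc_edge v) =
    if thin v then A (vcyc_edge v) || B (vcyc_edge v) else A (vcyc_edge v) && B (vcyc_edge v).
  by rewrite /chosen (_ : _.2.1 = if thin v then 2 else 0) /=; case: (thin v).
have cin x q : x < nV -> q < K -> vcyc_edge (x, q) \in bip_es.
  by move=> xn qK; apply/bkindP; constructor.
have i1 x q : inc (x, q, 0) (vcyc_edge (x, q)) by rewrite /inc eqxx.
have i2 x q : q < K -> inc (x, q, 0) (vcyc_edge (x, prq l q)).
  move=> qK; rewrite /inc /= (_ : nxq l (prq l q) = q) ?eqxx ?orbT //.
  by apply/nxqP; rewrite // prq_lt.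
have n12 x q : q < K -> vcyc_edge (x, q) != vcyc_edge (x, prq l q).
  move=> qK; apply/eqP=> -[] + _ _; move: qK; rewrite /prq /clen; case: eqP; lia.
have {tight}T v : v \in bip_vs ->
    \sum_(e <- bip_es | inc v e) bweight v e * chosen A B e = bcap v.
  apply: tight => {}v /bip_vsP[[x [q [-> xn qK]]]|[j -> jN]|[j -> jN]].
  - rewrite bsum_cyc // /bcap /= ltn_eqF // !ce.
    have := emat_le1 mA (cin x q xn qK) (cin x (prq l q) xn (prq_lt qK)) (i1 x q) (i2 x q qK) (n12 x q qK).
    have := emat_le1 mB (cin x q xn qK) (cin x (prq l q) xn (prq_lt qK)) (i1 x q) (i2 x q qK) (n12 x q qK).
    have := @thin_prq x q qK.
    case: (thin (x, q)) => [/(_ isT)/negbTE->|_]; last case: (thin _);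
      by case: (A _); case: (A _); case: (B _); case: (B _).
  - rewrite bsum_clause // /bcap /= eqxx.
    have S C : emat bip_es C -> C (leaf_edge j) + \sum_(i <- iota 0 5) C (tap_edge (5 * j + i)) <= 1.
      move=> mC; have P := star_clauseP jN.
      have := @emat_sum_le1 _ (star_clause j) C; rewrite big_cons big_map; apply.
        by rewrite -(perm_uniq P) filter_uniq ?bip_es_uniq.
      move=> e e'; rewrite -!(perm_mem P) !mem_filter => /andP[h1 h2] /andP[h3 h4] h5 h6.
      exact: (mC _ _ _ h2 h4 h5 h6 h1 h3).
    have := S A mA; have := S B mB; clear.
    have : \sum_(i <- iota 0 5) (A (tap_edge (5 * j + i)) || B (tap_edge (5 * j + i)))
        <= \sum_(i <- iota 0 5) A (tap_edge (5 * j + i)) + \sum_(i <- iota 0 5) B (tap_edge (5 * j + i)).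
      by rewrite -big_split; apply: leq_sum => i _; case: (A _); case: (B _).
    by case: (A (leaf_edge j)); case: (B (leaf_edge j)); rewrite /=; lia.
  - rewrite big_seq_cond big1 // => e /andP[/bkindP k]; rewrite /bweight.
    case: k => [x q xn qK|o oN|k kN] /orP[/eqP|/eqP] E; case: E => //; rewrite /= ?mul0n //.
pose c x q := chosen A B (vcyc_edge (x, q)).
have Tc x q : x < nV -> q < K -> c x q = ~~ c x (prq l q).
  move=> xn qK; have := T (x, q, 0); rewrite bsum_cyc // /bcap /= ltn_eqF // => h.
  have {h} : c x q + c x (prq l q) = 1 by apply: h; rewrite mem_cat map_f // mem_grid xn.
  by case: (c x q); case: (c x _).
pose a x := c x 0.
have alt x q : x < nV -> q < K -> c x q = a x (+) odd q.
  move=> xn; elim: q => [|q IH] qK; first by rewrite addbF.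
  by rewrite Tc // /prq /= IH ?(ltnW qK) // addbN.
exists a => j jN; have jN5 : j < N %/ 5 by have := divnK l5; lia.
have := T (nV, j, 0); rewrite bsum_clause // /bcap /= eqxx => h.
have {}h := h ltac:(rewrite !mem_cat [_ \in map (fun j => (nV, j, 0)) _]map_f ?orbT // mem_iota //).
have : 0 < \sum_(i <- iota 0 5) (A (tap_edge (5 * j + i)) || B (tap_edge (5 * j + i))).
  by move: h; case: (_ || _); rewrite /=; lia.
rewrite lt0n sum_nat_seq_neq0 => /hasP[i]; rewrite mem_iota => i5 /=.
rewrite eqb0 negbK => st; exists i => //.
set o := 5 * j + i in st *; have oN : o < N by rewrite /o; have := divnK l5; lia.
have tin : tap_edge o \in bip_es by apply/bkindP; constructor.
have xn := lvar_lt l o; have qK := tap_lt oN.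
have iT : inc (lvar l o, 4 * o + 1, 0) (tap_edge o) by rewrite /inc eqxx.
have ne q : tap_edge o != vcyc_edge (lvar l o, q).
  by apply/eqP=> E; have := btag_tap o; rewrite E btag_cyc.
have p1 : prq l (4 * o + 1) = 4 * o by rewrite /prq; case: eqP; lia.
(* A tap occupies its cycle vertex in one of the matchings, so a thick edge there cannot lie in
   both. The chosen cycle edge at that vertex is therefore thin, and the literal is true. *)
have nthick q : q < K -> ~~ thin (lvar l o, q) -> inc (lvar l o, 4 * o + 1, 0) (vcyc_edge (lvar l o, q)) ->
    ~~ c (lvar l o) q.
  move=> q0K nt iq; rewrite /c ce (negbTE nt).
  have := emat_le1 mA tin (cin _ _ xn q0K) iT iq (ne q).
  have := emat_le1 mB tin (cin _ _ xn q0K) iT iq (ne q).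
  by move: st; case: (A _); case: (B _); case: (A _); case: (B _).
rewrite /ltruth; have tE r : r < 4 -> thin (lvar l o, 4 * o + r) = (r.+1 == loff l o).
  by move=> r4; rewrite /thin /= div4 // mod4 // eqxx.
have := tE 0 isT; have := tE 1 isT; rewrite addn0 /loff -/(lpol l o).
case: (lpol l o) => /= t1 t0.
  have := nthick (4 * o + 1) qK (negbT t1) (i1 _ _).
  by rewrite alt // oddD oddM /= addbT negbK eqb_id.
have : ~~ c (lvar l o) (4 * o).
  by rewrite -p1; apply: nthick; [exact: prq_lt | rewrite p1 t0 | exact: i2].
rewrite alt ?(ltn_trans _ qK) ?addn1 // oddM /= addbF eqbF_neg //.
Qed.

(** One matching takes all selected cycle edges and all leaf edges. The other one takes the thick
    selected edges and, for each clause, the tap of the first true literal. *)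
Lemma bip_complete a : sat5 l a ->
  exists A B, [/\ emat bip_es A, emat bip_es B & bip_target <= wvalue bip_es A B].
Proof.
move=> sat; pose cs := cyc_sel a.
pose pick o := o == 5 * (o %/ 5) + first_true l a (o %/ 5).
pose A (e : wedge) := match btag e with 0 => cs e.1.1.1 | 1 => false | _ => true end.
pose B (e : wedge) := match btag e with
  | 0 => cs e.1.1.1 && ~~ thin e.1.1.1 | 1 => pick (e.1.1.1.2 %/ 4) | _ => false end.
have Ac x q : x < nV -> A (vcyc_edge (x, q)) = cs (x, q) by move=> xn; rewrite /A btag_cyc.
have Bc x q : x < nV -> B (vcyc_edge (x, q)) = cs (x, q) && ~~ thin (x, q).
  by move=> xn; rewrite /B btag_cyc.
have At o : A (tap_edge o) = false by rewrite /A btag_tap.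
have Bt o : B (tap_edge o) = pick o by rewrite /B btag_tap /= div4.
have Cc x q : x < nV -> chosen A B (vcyc_edge (x, q)) = cs (x, q).
  move=> xn; rewrite /chosen Ac // Bc // /vcyc_edge /=.
  by case: (thin _); case: (cs _).
have csP x q : q < K -> cs (x, prq l q) = ~~ cs (x, q) by apply: cyc_sel_prq.
have csN x q : q < K -> cs (x, nxq l q) = ~~ cs (x, q).
  move=> qK; have nK := nxq_lt qK; rewrite -[cs (x, q)](_ : cs (x, prq l (nxq l q)) = _).
    by rewrite csP // negbK.
  by congr (cs (_, _)); apply/esym/(nxqP nK qK).
have nI q q' : q < K -> q' < K -> nxq l q = nxq l q' -> q = q'.
  by move=> qK qK' E; rewrite ((nxqP (nxq_lt qK') qK).1 E); apply/esym/(nxqP (nxq_lt qK') qK').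
have CC x q x' q' v : x < nV -> q < K -> q' < K -> cs (x, q) -> cs (x', q') ->
    inc v (vcyc_edge (x, q)) -> inc v (vcyc_edge (x', q')) -> vcyc_edge (x, q) = vcyc_edge (x', q').
  move=> xn qK qK' c c' /orP[]/eqP-> /orP[]/eqP[] e1 e2; subst x'.
  - by rewrite e2.
  - by move: c; rewrite e2 csN // c'.
  - by move: c'; rewrite -e2 csN // c.
  - by rewrite (nI _ _ qK qK' e2).
(* The picked literal is true, so the selected cycle edge at the end of its tap is thin and hence
   missing from the second matching. *)
have CT x q o v : x < nV -> q < K -> o < N -> cs (x, q) -> ~~ thin (x, q) -> pick o ->
    inc v (vcyc_edge (x, q)) -> inc v (tap_edge o) -> False.
  move=> xn qK oN c nt pk iv iw.
  have [f5 tr] := first_trueP l5 sat oN.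
  rewrite -(eqP pk) in tr.
  have ev : v = (lvar l o, 4 * o + 1, 0).
    case/orP: iw => /eqP // E; move: iv; rewrite E.
    by case/orP=> /eqP[e1 _]; move: xn; rewrite -e1 ltnn.
  have tE r : r < 4 -> thin (lvar l o, 4 * o + r) = (r.+1 == loff l o).
    by move=> r4; rewrite /thin /= div4 // mod4 // eqxx.
  have := tE 0 isT; have := tE 1 isT; rewrite addn0 /loff -/(lpol l o) => t1 t0.
  move: iv; rewrite ev => /orP[]/eqP[e1 e2]; subst x.
    move: c nt; rewrite -e2 t1 /cs /cyc_sel /= oddD oddM /= addbT; move: tr; rewrite /ltruth.
    by case: (lpol l o); rewrite ?eqb_id //= => ->.
  have e3 : q = 4 * o.
    by rewrite ((nxqP (tap_lt oN) qK).1 (esym e2)) /prq; case: eqP; lia.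
  move: c nt; rewrite e3 t0 /cs /cyc_sel /= oddM /= addbF; move: tr; rewrite /ltruth.
  by case: (lpol l o); rewrite ?eqbF_neg //= => /negbTE->.
exists A, B; split.
- move=> v e e' /bkindP[x q xn qK|o oN|j jN] /bkindP[x' q' xn' qK'|o' oN'|j' jN'];
    rewrite ?Ac ?At // => c c' i i'.
  + exact: (CC _ _ _ _ v).
  + by case/orP: i i' => /eqP-> /orP[]/eqP[e1 _]; move: xn; rewrite e1 ltnn.
  + by case/orP: i' i => /eqP-> /orP[]/eqP[e1 _]; move: xn'; rewrite -e1 ltnn.
  + by case/orP: i i' => /eqP-> /orP[]/eqP[] ->.
- move=> v e e' /bkindP[x q xn qK|o oN|j jN] /bkindP[x' q' xn' qK'|o' oN'|j' jN'];
    rewrite ?Bc ?Bt // => c c' i i'.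
  + by case/andP: c => c _; case/andP: c' => c' _; apply: (CC _ _ _ _ v).
  + by case/andP: c => c nt; case: (CT x q o' v).
  + by case/andP: c' => c' nt; case: (CT x' q' o v).
  + case/orP: i i' => /eqP-> /orP[]/eqP[].
    * by move=> _ e2; have -> : o = o' by lia.
    * by move=> e1; have := lvar_lt l o; rewrite e1 ltnn.
    * by move=> e1; have := lvar_lt l o'; rewrite -e1 ltnn.
    * by move=> e1; rewrite (eqP c) (eqP c') e1.
rewrite bwvalue_star -sum_bcap !big_seq; apply: leq_sum => v.
case/bip_vsP=> [[x [q [-> xn qK]]]|[j -> jN]|[j -> jN]].
- by rewrite bsum_cyc // !Cc // csP // /bcap /= ltn_eqF //; case: (cs _).
- rewrite bsum_clause // /bcap /= eqxx.
  have jN5 : 5 * j < N by lia.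
  have [f5 _] := first_trueP l5 sat jN5.
  have ej : 5 * j %/ 5 = j by lia.
  rewrite ej in f5; have fi : first_true l a j \in iota 0 5 by rewrite mem_iota.
  rewrite (bigD1_seq _ fi (iota_uniq _ _)) /= At Bt /pick.
  have -> : (5 * j + first_true l a j) %/ 5 = j by lia.
  by rewrite eqxx (leq_add2l 2 1) leq_addr.
- by rewrite /bcap.
Qed.

End Bipartite.

#[export] Instance fp_bip_vs : FP1 bip_vs.
Proof. by rewrite /FP1 /bip_vs /grid /nvar /clen /unzip1; fp. Qed.

#[export] Instance fp_bip_es : FP1 bip_es.
Proof.
rewrite /FP1 /bip_es /vcyc_edge /tap_edge /leaf_edge /thin /grid /nxq /nvar /clen /lvar /loff /unzip1.
by fp.
Qed.

Lemma bipartite_hard : NP_hard_max (Q := matching_shifting)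
  (fun I : shift_inst => bipartite (si_graph I) /\ si_n I = 2).
Proof.
apply: (@NP_hard_wedges _ bip_vs bip_es bip_target).
- exact: fp_bip_vs.
- exact: fp_bip_es.
- by rewrite /bip_target /nvar /clen /unzip1; fp.
move=> l l5 l0; split.
- rewrite size_cat size_map size_grid addn_gt0 muln_gt0 /clen muln_gt0 /=.
  by case: l l0 {l5}.
- exists (bip_wf l5) => h; split=> //.
  by have [side sP] := bip_bipartite l; exact: (sinst_bipartite (bip_wf l5) h sP).
split=> [[a sat]|[A [B [mA mB le]]]]; first exact: bip_complete sat.
exact: bip_sound le.
Qed.

(** * Binary arithmetic *)

Fixpoint valw (w : word) : nat := if w is b :: w' then b + (valw w').*2 else 0.

Lemma valw_cat u v : valw (u ++ v) = valw u + 2 ^ size u * valw v.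
Proof. by elim: u => [|b u IH] /=; rewrite ?mul1n // IH expnS; lia. Qed.

Lemma valw_lt w : valw w < 2 ^ size w.
Proof. by elim: w => [|b w IH] //=; rewrite expnS; case: b; lia. Qed.

Lemma valw_nseq n : valw (nseq n false) = 0.
Proof. by elim: n => //= n ->. Qed.

Lemma valw_bits n : valw (bits n) = n.
Proof.
elim/ltn_ind: n => -[|n] IH; first by rewrite bits0.
by rewrite bits_rec //= IH; have := odd_double_half n.+1; rewrite /=; lia.
Qed.

Definition add_step (s : (bool * word) * word) (x : bool) : (bool * word) * word :=
  let y := head false s.1.2 in let c := s.1.1 in
  (((x && y) || (c && (x (+) y)), behead s.1.2), (x (+) y (+) c) :: s.2).

(** The padding exhausts [b] and absorbs the last carry. Leading zeros are kept, so the length of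
    the result is known exactly and grows only additively in long sums. *)
Definition addw (a b : word) : word :=
  rev (foldl add_step ((false, b), [::]) (a ++ nseq (size b).+1 false)).2.

Lemma add_foldl a c b acc : let s := foldl add_step ((c, b), acc) a in
  [/\ valw (rev s.2) + 2 ^ size s.2 * (s.1.1 + valw s.1.2) =
      valw (rev acc) + 2 ^ size acc * (c + valw b + valw a),
      s.1.2 = drop (size a) b & size s.2 = size a + size acc].
Proof.
elim: a c b acc => [|x a IH] c b acc /=; first by rewrite addn0 drop0.
have [-> -> ->] := IH ((x && head false b) || (c && (x (+) head false b))) (behead b)
  ((x (+) head false b (+) c) :: acc).
split; last by rewrite /= addnS.
  rewrite rev_cons -cats1 valw_cat size_rev /= expnS.
  have -> : valw b = head false b + (valw (behead b)).*2 by case: b.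
  case: x; case: (head false b); case: c; rewrite /=; nia.
by case: b => //=; rewrite drop_oversize.
Qed.

Lemma addwE a b : valw (addw a b) = valw a + valw b.
Proof.
have := add_foldl (a ++ nseq (size b).+1 false) false b [::].
rewrite /addw; set s := foldl _ _ _; case.
rewrite expn0 mul1n valw_cat valw_nseq muln0 addn0 !add0n addnC => E.
rewrite drop_oversize ?size_cat ?size_nseq; last by lia.
move=> e2 e3; rewrite e2 addn0 in E.
(* A remaining carry would be worth [2 ^ (size a + size b).+1], which exceeds the sum of the two
   numbers. *)
case c: s.1.1 E => E; last by lia.
have := valw_lt a; have := valw_lt b; rewrite e3 /= addn0 in E.
have := leq_pexp2l (isT : 0 < 2) (leq_addr (size b) (size a)).
have := leq_pexp2l (isT : 0 < 2) (leq_addl (size a) (size b)).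
have := expn_gt0 2 (size a + (size b).+1); rewrite addnS expnS /= in E *.
by lia.
Qed.

(** The least significant digits come first, so a later difference overrides the verdict so far. *)
Definition lt_step (s : bool * word) (x : bool) : bool * word :=
  (if x == head false s.2 then s.1 else head false s.2, behead s.2).

Definition ltw (a b : word) : bool :=
  (foldl lt_step (false, b) (a ++ nseq (size b) false)).1.

Lemma lt_foldl a l b : size b <= size a -> (foldl lt_step (l, b) a).1 =
  if valw a == valw b then l else valw a < valw b.
Proof.
elim: a l b => [|x a IH] l [|y b] //= h; rewrite IH //=.
  by rewrite !ltn0; case: x; case: (valw a).
have -> : (x + (valw a).*2 == y + (valw b).*2) = (x == y) && (valw a == valw b).
  by case: x; case: y => /=; lia.
have -> : (x + (valw a).*2 < y + (valw b).*2) = (valw a < valw b) || [&& valw a == valw b, ~~ x & y].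
  by case: x; case: y => /=; lia.
by case: ltngtP => // _; case: x; case: y.
Qed.

Lemma ltwE a b : ltw a b = (valw a < valw b).
Proof.
rewrite /ltw lt_foldl; last by rewrite size_cat size_nseq leq_addl.
by rewrite valw_cat valw_nseq muln0 addn0; case: ltngtP.
Qed.

#[export] Instance fp_addw : FP2 addw.
Proof.
rewrite /FP2 /addw; fp.
apply: (@FP_foldl_add _ _ _ _ _ _ (fun _ => add_step)); rewrite ?/add_step; fp.
apply: (@bound1 (fun=> 10)); [pbd | move=> a [[c b] acc] x].
rewrite /add_step /= !tsz_pair tsz_cons.
have := tsz_bool (x && head false b || c && (x (+) head false b)).
have := tsz_bool (x (+) head false b (+) c); have := @tsz_drop _ enc_bool b 1.
by rewrite drop1; lia.
Qed.

#[export] Instance fp_ltw : FP2 ltw.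
Proof.
rewrite /FP2 /ltw; fp.
apply: (@FP_foldl_add _ _ _ _ _ _ (fun _ => lt_step)); rewrite ?/lt_step; fp.
apply: (@bound1 (fun=> 10)); [pbd | move=> a [c b] x].
rewrite /lt_step /= !tsz_pair.
have := tsz_bool (if x == head false b then c else head false b).
by have := @tsz_drop _ enc_bool b 1; rewrite drop1; lia.
Qed.

Lemma size_addw a b : size (addw a b) = size a + (size b).+1.
Proof.
have [_ _] := add_foldl (a ++ nseq (size b).+1 false) false b [::].
by rewrite /addw size_rev => ->; rewrite size_cat size_nseq addn0.
Qed.

Import Order.TTheory GRing.Theory Num.Theory.

(** * Minimum cost circulations with unit capacities *)

(* Identifier, state, (tail, head) and cost p - q for a pair (p, q) of binary
   numbers.  The state (true, false) marks an arc that carries flow; such an arc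
   is kept reversed, with its cost negated. *)
Notation arc := ((nat * (bool * bool)) * ((nat * nat) * (word * word)))%type.
Definition aid (a : arc) := a.1.1.
Definition afl (a : arc) := a.1.2.1.
Definition atl (a : arc) := a.2.1.1.
Definition ahd (a : arc) := a.2.1.2.
(** As differences, integers are negated by exchanging components and added componentwise; no signs
    have to be handled. *)
Definition zval (c : word * word) : int := (Posz (valw c.1) - Posz (valw c.2))%R.
Definition acost (a : arc) : int := zval a.2.2.
Definition arev (a : arc) : arc :=
  ((a.1.1, (a.1.2.2, a.1.2.1)), ((a.2.1.2, a.2.1.1), (a.2.2.2, a.2.2.1))).
Definition awf (a : arc) := a.1.2.2 == ~~ a.1.2.1.

Definition wsum (w : seq arc) : word * word :=
  foldl (fun c a => (addw c.1 a.2.2.1, addw c.2 a.2.2.2)) ([::], [::]) w.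
Definition zlt (x y : word * word) := ltw (addw x.1 y.2) (addw y.1 x.2).
(** Among walks of equal cost the shorter one wins. This keeps cycles of cost zero out of the
    cheapest walks. *)
Definition wbetter (w1 w2 : seq arc) :=
  zlt (wsum w1) (wsum w2) || (~~ zlt (wsum w2) (wsum w1) && (size w1 < size w2)).
(* Lists of length at most one stand for optional values. *)
Definition best (ws : seq (seq arc)) : seq (seq arc) :=
  foldl (fun c w => if nilp c || wbetter w (head [::] c) then [:: w] else c) [::] ws.

Notation walk_table := (seq (nat * seq (seq arc))).
Definition tget (T : walk_table) (v : nat) : seq (seq arc) :=
  flatten (take 1 [seq p.2 | p <- T & p.1 == v]).
(** A round of the Bellman-Ford algorithm that stores whole walks instead of distances. The starting
    vertex and the heads of arcs are the only vertices that walks can reach. *)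
Definition tstep (L : seq arc) (Vs : seq nat) (T : walk_table) : walk_table :=
  [seq (v, best (tget T v ++
     flatten [seq [seq rcons w a | w <- tget T (atl a)] | a <- L & ahd a == v])) | v <- Vs].
Definition tab (L : seq arc) (s i : nat) : walk_table :=
  let Vs := s :: map ahd L in
  iter i (tstep L Vs) [seq (v, if v == s then [:: [::]] else [::]) | v <- Vs].
Definition cheapest (L : seq arc) (s t : nat) : seq (seq arc) := tget (tab L s (size L)) t.

(** A negative cycle that [a] creates consists of [a] and a walk from its head to its tail, so it
    suffices to examine a cheapest such walk. *)
Definition ainsert (L : seq arc) (a : arc) : seq arc :=
  scase (cheapest L (ahd a) (atl a)) (a :: L) (fun w _ =>
    if zlt (wsum (rcons w a)) ([::], [::]) then
      arev a :: [seq if has (fun b => aid b == aid e) w then arev e else e | e <- L]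
    else a :: L).
Definition circulation (arcs : seq arc) : seq arc := foldl ainsert [::] arcs.
Definition used (L : seq arc) (o : arc) : bool := has (fun e => (aid e == aid o) && afl e) L.

Local Open Scope ring_scope.

Definition wcost (w : seq arc) : int := \sum_(a <- w) acost a.

Lemma wcost_nil : wcost [::] = 0. Proof. exact: big_nil. Qed.
Lemma wcost_cons a w : wcost (a :: w) = acost a + wcost w. Proof. exact: big_cons. Qed.
Lemma wcost_cat u v : wcost (u ++ v) = wcost u + wcost v. Proof. exact: big_cat. Qed.
Lemma wcost_rcons w a : wcost (rcons w a) = wcost w + acost a.
Proof. by rewrite -cats1 wcost_cat wcost_cons wcost_nil addr0. Qed.

Lemma wsumE w : zval (wsum w) = wcost w.
Proof.
rewrite /wsum; suff h c : zval (foldl (fun c a => (addw c.1 a.2.2.1, addw c.2 a.2.2.2)) c w) =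
    zval c + wcost w by rewrite h add0r.
elim: w c => [|a w IH] c; first by rewrite wcost_nil addr0.
by rewrite /= IH wcost_cons /acost /zval /= !addwE; lia.
Qed.

Lemma zltE x y : zlt x y = (zval x < zval y).
Proof. by rewrite /zlt ltwE !addwE /zval; lia. Qed.

Definition wle (w1 w2 : seq arc) : bool :=
  (wcost w1 < wcost w2) || ((wcost w1 == wcost w2) && (size w1 <= size w2)%N).

Lemma wle_refl w : wle w w. Proof. by rewrite /wle eqxx leqnn orbT. Qed.

Lemma wle_trans w1 w2 w3 : wle w1 w2 -> wle w2 w3 -> wle w1 w3.
Proof. by rewrite /wle; lia. Qed.

Lemma wbetterE w1 w2 : wbetter w1 w2 = ~~ wle w2 w1.
Proof.
by rewrite /wbetter !zltE !wsumE /wle ltnNge; case: ltgtP.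
Qed.

Lemma wle_rcons w1 w2 a : wle w1 w2 -> wle (rcons w1 a) (rcons w2 a).
Proof.
by rewrite /wle !wcost_rcons !size_rcons ltrD2r (inj_eq (addIr _)) ltnS.
Qed.

Lemma bestP ws :
  if ws is [::] then best ws = [::] else
  exists w, [/\ best ws = [:: w], w \in ws & {in ws, forall w', wle w w'}].
Proof.
elim/last_ind: ws => [|ws w IH] //.
have -> : best (rcons ws w) =
    if nilp (best ws) || wbetter w (head [::] (best ws)) then [:: w] else best ws.
  by rewrite /best -cats1 foldl_cat.
have R w' : w' \in rcons ws w -> w' = w \/ w' \in ws.
  by rewrite mem_rcons inE => /orP[/eqP|]; [left | right].
suff : exists w0, [/\ (if nilp (best ws) || wbetter w (head [::] (best ws)) then [:: w]
    else best ws) = [:: w0], w0 \in rcons ws w & {in rcons ws w, forall w', wle w0 w'}].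
  by case: ws {IH R}.
case: ws IH R => [|w1 ws] IH R.
  exists w; split; rewrite ?mem_head // => w'; rewrite inE => /eqP->; exact: wle_refl.
have [w0 [-> m h]] := IH; rewrite /= wbetterE; case: ifP => /= [nle|/negbFE le].
  exists w; split=> //; first by rewrite -rcons_cons mem_rcons mem_head.
  move=> w' /R[->|/h]; first exact: wle_refl.
  by apply: wle_trans; move: nle; rewrite /wle; lia.
exists w0; split=> //; first by rewrite -rcons_cons mem_rcons inE m orbT.
by move=> w' /R[->|/h].
Qed.

Lemma best_in ws w : w \in best ws -> w \in ws.
Proof.
case: ws (bestP ws) => [-> //|w1 ws [w0 [-> m _]]].
by rewrite inE => /eqP->.
Qed.

Lemma best_le ws w : w \in ws -> exists2 w', best ws = [:: w'] & wle w' w.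
Proof. by case: ws (bestP ws) => [//|w1 ws [w0 [-> _ h]]] /h le; exists w0. Qed.

Lemma tget_map (F : nat -> seq (seq arc)) Vs v :
  tget [seq (u, F u) | u <- Vs] v = if v \in Vs then F v else [::].
Proof.
rewrite /tget; elim: Vs => [|u Vs IH] //=; rewrite inE [v == u]eq_sym.
by case: eqP => [->|_] /=; rewrite ?take0 ?cats0 // IH.
Qed.

(** * Cheapest walks in the absence of negative cycles *)

Fixpoint walk (s : nat) (w : seq arc) (t : nat) : bool :=
  if w is a :: w' then (atl a == s) && walk (ahd a) w' t else s == t.

Lemma walk_cat s u v t : walk s (u ++ v) t <-> exists2 x, walk s u x & walk x v t.
Proof.
elim: u s => [|a u IH] s /=.
  by split=> [h|[x /eqP-> //]]; exists s.
by split=> [/andP[-> /IH //]|[x /andP[-> h] h']]; apply/IH; exists x.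
Qed.

Lemma walk_end s u v w : walk s u v -> walk s u w -> v = w.
Proof.
elim: u s => [|a u IH] s /=; first by move=> /eqP<- /eqP.
by move=> /andP[_ /IH h] /andP[_ /h].
Qed.

Lemma walk_rcons s w a t : walk s (rcons w a) t = walk s w (atl a) && (ahd a == t).
Proof. by elim: w s => [|b w IH] s /=; rewrite ?IH ?andbA 1?eq_sym. Qed.

Definition walkin (L : seq arc) s w t := walk s w t && all (mem L) w.

Section Cheapest.
Context (L : seq arc) (pot : nat -> int).
Hypothesis potP : forall e, e \in L -> 0 <= acost e + pot (atl e) - pot (ahd e).

Lemma walk_pot s w t (p : nat -> int) : walk s w t ->
  \sum_(e <- w) (acost e + p (atl e) - p (ahd e)) = wcost w + p s - p t.
Proof.
elim: w s => [|a w IH] s /=; first by move=> /eqP->; rewrite big_nil wcost_nil; lia.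
by move=> /andP[/eqP <- /IH h]; rewrite big_cons h wcost_cons; lia.
Qed.

Lemma closed_ge0 s w : walkin L s w s -> 0 <= wcost w.
Proof.
move=> /andP[/(walk_pot pot) h /allP wL].
have : 0 <= \sum_(e <- w) (acost e + pot (atl e) - pot (ahd e)).
  by rewrite big_seq; apply: sumr_ge0 => e /wL; apply: potP.
by rewrite h; lia.
Qed.

(** Two arcs with the same head enclose a closed walk, which is nonempty and has nonnegative cost.
    Removing it shortens the walk without raising the cost. *)
Lemma cut s w t : walkin L s w t -> ~~ uniq (map ahd w) ->
  exists2 w', walkin L s w' t & ~~ wle w w' /\ (size w' < size w)%N.
Proof.
move=> /andP[ww wL] /(uniqPn 0)[i [j [ij]]]; rewrite size_map => jw.
have iw := ltn_trans ij jw.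
have [a0 _] : {a : arc | a \in w} by case: w ww wL jw iw => // a w _ _ _ _; exists a; rewrite mem_head.
rewrite !(nth_map a0) // => E.
have cutP k : (k < size w)%N -> walk s (take k.+1 w) (ahd (nth a0 w k)) /\
    walk (ahd (nth a0 w k)) (drop k.+1 w) t.
  move=> kw; move: ww; rewrite -{1}(cat_take_drop k.+1 w) => /walk_cat[x h1 h2].
  suff -> : ahd (nth a0 w k) = x by [].
  by move: h1; rewrite (take_nth a0) // walk_rcons => /andP[_ /eqP].
have [i1 i2] := cutP _ iw; have [j1 j2] := cutP _ jw.
have e1 : take j.+1 w = take i.+1 w ++ drop i.+1 (take j.+1 w).
  by rewrite -[LHS](cat_take_drop i.+1) take_takel // ltnW.
have cw : walk (ahd (nth a0 w i)) (drop i.+1 (take j.+1 w)) (ahd (nth a0 w i)).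
  rewrite e1 in j1; have [x h1 h2] := (walk_cat _ _ _ _).1 j1; rewrite -E in h2.
  by rewrite -(walk_end i1 h1) in h2.
have wE : w = take i.+1 w ++ drop i.+1 (take j.+1 w) ++ drop j.+1 w.
  by rewrite catA -e1 cat_take_drop.
move: wL; rewrite {1}wE !all_cat => /and3P[a1 a2 a3].
exists (take i.+1 w ++ drop j.+1 w).
  apply/andP; split; last by rewrite all_cat a1.
  by apply/walk_cat; exists (ahd (nth a0 w i)); rewrite // E.
have c0 : 0 <= wcost (drop i.+1 (take j.+1 w)) by apply: (@closed_ge0 (ahd (nth a0 w i))); rewrite /walkin cw.
have s0 : (0 < size (drop i.+1 (take j.+1 w)))%N by rewrite size_drop size_takel //; lia.
have cE : wcost w = wcost (take i.+1 w ++ drop j.+1 w) + wcost (drop i.+1 (take j.+1 w)).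
  by rewrite {1}wE !wcost_cat; lia.
have sE : size w = (size (take i.+1 w ++ drop j.+1 w) + size (drop i.+1 (take j.+1 w)))%N.
  by rewrite {1}wE !size_cat; lia.
by rewrite /wle; split; lia.
Qed.

(** Once the heads are distinct, they are among the heads of the arcs in [L]; this is why [size L]
    rounds suffice. *)
Lemma short s w t : walkin L s w t ->
  exists2 w', walkin L s w' t & wle w' w /\ (size w' <= size L)%N.
Proof.
have [n] := ubnP (size w); elim: n w => // n IH w wn ww.
case: (boolP (uniq (map ahd w))) => [u|/(cut ww)[w' ww' [nle lt]]].
  exists w => //; split; first exact: wle_refl.
  rewrite -(size_map ahd w) -(size_map ahd L); apply: uniq_leq_size => // v /mapP[e ew ->].
  by apply: map_f; have /andP[_ /allP/(_ _ ew)] := ww.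
have [|w2 ww2 [le2 s2]] := IH w' _ ww'; first by lia.
exists w2 => //; split=> //; apply: wle_trans le2 _.
by move: nle; rewrite /wle; lia.
Qed.

Context (s : nat).
Let Vs := s :: map ahd L.

Lemma walk_Vs w t : walkin L s w t -> t \in Vs.
Proof.
case/andP; elim/last_ind: w => [|w a _] /=; first by move=> /eqP<-; rewrite mem_head.
rewrite walk_rcons all_rcons => /andP[_ /eqP<-] /andP[aL _].
by rewrite inE map_f ?orbT.
Qed.

Lemma tab0 v : tget (tab L s 0) v = if v == s then [:: [::]] else [::].
Proof.
rewrite /tab /= -/Vs -[(_, _) :: _]/[seq (v, if v == s then [:: [::]] else [::]) | v <- Vs].
rewrite (tget_map (fun v => if v == s then [:: [::]] else [::])).
by case: ifP => //; case: eqP => // ->; rewrite mem_head.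
Qed.

Definition cands i v := tget (tab L s i) v ++
  flatten [seq [seq rcons w a | w <- tget (tab L s i) (atl a)] | a <- L & ahd a == v].

Lemma tabS i v : tget (tab L s i.+1) v = if v \in Vs then best (cands i v) else [::].
Proof. by rewrite /tab iterS -/(tab L s i) /tstep (tget_map (fun v => best (cands i v))). Qed.

Lemma tab_sound i v w : w \in tget (tab L s i) v -> walkin L s w v.
Proof.
elim: i v w => [|i IH] v w.
  by rewrite tab0; case: eqP => // ->; rewrite inE => /eqP->; rewrite /walkin /= eqxx.
rewrite tabS; case: ifP => // _ /best_in; rewrite mem_cat => /orP[/IH //|].
move=> /flatten_mapP[a]; rewrite mem_filter => /andP[/eqP av aL] /mapP[u /IH /andP[uw uL] ->].
by rewrite /walkin walk_rcons uw av eqxx all_rcons uL /= aL.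
Qed.

Lemma tab_complete i v w : walkin L s w v -> (size w <= i)%N ->
  exists2 w', tget (tab L s i) v = [:: w'] & wle w' w.
Proof.
elim: i v w => [|i IH] v w ww.
  case: w ww => // /andP[/= /eqP <- _] _; exists [::]; first by rewrite tab0 eqxx.
  exact: wle_refl.
have vV := walk_Vs ww; rewrite tabS vV leq_eqVlt => /orP[/eqP sw|]; last first.
  rewrite ltnS => /(IH _ _ ww)[w' e le].
  have [|w2 -> le2] := @best_le (cands i v) w'; first by rewrite mem_cat e mem_head.
  by exists w2 => //; apply: wle_trans le.
case/lastP: w ww sw => [//|w a] /andP[]; rewrite walk_rcons all_rcons size_rcons.
move=> /andP[ww av] /andP[aL wL] [sw].
have [|w' e le] := IH (atl a) w _ (eq_leq sw); first by rewrite /walkin ww.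
have [|w2 -> le2] := @best_le (cands i v) (rcons w' a).
  rewrite mem_cat; apply/orP; right; apply/flatten_mapP; exists a.
    by rewrite mem_filter av.
  by rewrite e inE.
by exists w2 => //; apply: wle_trans le2 (wle_rcons _ le).
Qed.

Lemma cheapest_sound t w : w \in cheapest L s t -> walkin L s w t.
Proof. exact: tab_sound. Qed.

Lemma cheapest_complete t w : walkin L s w t ->
  exists2 w', cheapest L s t = [:: w'] & wle w' w.
Proof.
move=> /short[w1 ww1 [le1 s1]]; have [w2 e le2] := tab_complete ww1 s1.
by exists w2 => //; apply: wle_trans le1.
Qed.

Lemma cheapest_uniq t w r : cheapest L s t = w :: r -> uniq (map ahd w).
Proof.
move=> e; have ww : walkin L s w t by apply: cheapest_sound; rewrite e mem_head.
apply: contraT => /(cut ww)[w' ww' [nle _]].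
have [w2 e2 le2] := cheapest_complete ww'.
by move: e2 le2; rewrite e => -[<- _]; rewrite (negbTE nle).
Qed.

Definition dist v : int := wcost (head [::] (cheapest L s v)).
Definition reached v := ~~ nilp (cheapest L s v).

Lemma reachedP v : reached v -> exists2 w, cheapest L s v = [:: w] & walkin L s w v.
Proof.
rewrite /reached; case e: (cheapest L s v) => [|w r] // _.
have ww : walkin L s w v by apply: cheapest_sound; rewrite e mem_head.
have [w' e' _] := cheapest_complete ww; rewrite e in e'.
have r0 : r = [::] by case: e'.
by rewrite r0; exists w.
Qed.

Lemma dist_le v w : walkin L s w v -> reached v /\ dist v <= wcost w.
Proof.
move=> /cheapest_complete[w' e le]; rewrite /reached /dist e; split=> //=.
by move: le; rewrite /wle; lia.
Qed.

Lemma reached_arc e : e \in L -> reached (atl e) -> reached (ahd e) /\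
  0 <= acost e + dist (atl e) - dist (ahd e).
Proof.
move=> eL /reachedP[w ew /andP[ww wL]].
have [|r le] := @dist_le (ahd e) (rcons w e).
  by rewrite /walkin walk_rcons ww eqxx all_rcons wL /= eL.
by split=> //; move: le; rewrite /dist ew /= wcost_rcons; lia.
Qed.

Lemma dist_s : reached s /\ dist s = 0.
Proof.
have [|r le] := @dist_le s [::]; first by rewrite /walkin /= eqxx.
split=> //; have [w e /closed_ge0] := reachedP r.
by move: le; rewrite /dist e /= wcost_nil; lia.
Qed.

(** Reduced costs with respect to the distances are nonnegative and telescope to zero along a
    cheapest walk, so each of them vanishes. *)
Lemma cheapest_tight t w r e : cheapest L s t = w :: r -> e \in w ->
  [/\ e \in L, reached (atl e) & acost e + dist (atl e) - dist (ahd e) = 0].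
Proof.
move=> et; have ww : walkin L s w t by apply: cheapest_sound; rewrite et mem_head.
have wt : dist t = wcost w by rewrite /dist et.
have /andP[ww1 /allP wL] := ww.
have R : forall f, f \in w -> reached (atl f).
  suff h u x y : walk s u x -> all (mem L) u -> walk x y t -> all (mem L) y ->
      forall f, f \in y -> reached (atl f).
    by apply: (h [::] s w) => //=; apply/allP.
  elim: y u x => [|b y IH] u x //= wu uL /andP[/eqP bx wy] /andP[bL yL] f.
  rewrite inE => /orP[/eqP->|fy].
    by have [] := @dist_le (atl b) u; rewrite /walkin ?bx ?wu.
  apply: (IH (rcons u b) (ahd b)) => //; first by rewrite walk_rcons bx wu eqxx.
  by rewrite all_rcons uL /= bL.
move=> ew; split; [exact: wL | exact: R | ].
have S := walk_pot dist ww1; rewrite wt dist_s.2 addr0 subrr in S.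
have P f : f \in w -> 0 <= acost f + dist (atl f) - dist (ahd f).
  by move=> fw; have [] := reached_arc (wL _ fw) (R _ fw).
move/eqP: S; rewrite big_seq psumr_eq0; last exact: P.
by move=> /allP/(_ _ ew); rewrite ew => /eqP.
Qed.

End Cheapest.

(** * Residual arcs and the optimality certificate *)

Definition inflow (a : arc) (v : nat) : int := (ahd a == v)%:Z - (atl a == v)%:Z.
(* The contribution of a residual arc to the balance of the flow at v: if it
   carries flow, its original orientation is the opposite one. *)
Definition bal (a : arc) (v : nat) : int := if afl a then - inflow a v else 0.
Definition orig (a : arc) : arc := if afl a then arev a else a.

Lemma aid_arev a : aid (arev a) = aid a. Proof. by []. Qed.

Lemma aid_orig a : aid (orig a) = aid a. Proof. by rewrite /orig; case: ifP. Qed.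

Lemma awf_arev a : awf a -> awf (arev a).
Proof. by rewrite /awf /= => /eqP->; rewrite negbK. Qed.

Lemma orig_arev a : awf a -> orig (arev a) = orig a.
Proof. by case: a => [[i [[] []]] [[u v] [p q]]]. Qed.

Lemma acost_arev a : acost (arev a) = - acost a.
Proof. by rewrite /acost /zval /= opprB. Qed.

Lemma bal_arev a v : awf a -> bal (arev a) v = bal a v + inflow a v.
Proof. by case: a => [[i [[] []]] [[u w] [p q]]] //= _; rewrite /bal /inflow /afl /ahd /atl /=; lia. Qed.

(** The potential excludes negative residual cycles and thereby certifies that the flow is optimal
    for the arcs inserted so far. *)
Record circ_inv (L : seq arc) : Prop := {
  ci_uniq : uniq (map aid L);
  ci_wf : all awf L;
  ci_bal : forall v, \sum_(e <- L) bal e v = 0;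
  ci_pot : exists p : nat -> int, forall e, e \in L -> 0 <= acost e + p (atl e) - p (ahd e)
}.

Lemma exists_bound (s : seq arc) (f : arc -> int) : exists2 B : int, 0 <= B &
  forall e, e \in s -> 0 <= f e + B.
Proof.
elim: s => [|e s [B B0 h]]; first by exists 0.
exists (B + `|f e|); first by lia.
by move=> x; rewrite inE => /orP[/eqP->|/h]; lia.
Qed.

Lemma walk_inflow w s t v : walk s w t ->
  \sum_(e <- w) inflow e v = (t == v)%:Z - (s == v)%:Z.
Proof.
elim: w s => [|a w IH] s /=; first by move=> /eqP->; rewrite big_nil subrr.
by move=> /andP[/eqP <- /IH h]; rewrite big_cons h /inflow; lia.
Qed.

Definition flip (w : seq arc) (e : arc) : arc :=
  if has (fun b => aid b == aid e) w then arev e else e.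

Lemma aid_inj L b e : uniq (map aid L) -> b \in L -> e \in L -> aid b = aid e -> b = e.
Proof.
move=> u bL eL E; suff ie : index b L = index e L by rewrite -(nth_index b bL) ie nth_index.
apply/eqP; rewrite -(nth_uniq 0%N _ _ u) ?size_map ?index_mem //.
by rewrite !(nth_map b) ?index_mem // !nth_index // E.
Qed.

Lemma flip_mem L w e : uniq (map aid L) -> {subset w <= L} -> e \in L ->
  flip w e = if e \in w then arev e else e.
Proof.
move=> u wL eL; rewrite /flip; congr (if _ then _ else _); apply/hasP/idP => [[b bw /eqP E]|ew].
  by rewrite -(aid_inj u (wL _ bw) eL E).
by exists e.
Qed.

Lemma inv_insert L a : circ_inv L -> awf a -> ~~ afl a -> aid a \notin map aid L ->
  circ_inv (ainsert L a) /\ map orig (ainsert L a) = a :: map orig L.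
Proof.
move=> [uL wfL bL [p pP]] wa fa aL.
have oa : orig a = a by rewrite /orig (negbTE fa).
have ba v : bal a v = 0 by rewrite /bal (negbTE fa).
set s := ahd a; set t := atl a.
pose D := dist L s; pose R := reached L s.
(* Reached vertices get their distance as potential. No arc leads from a reached to an unreached
   vertex; raising the old potential of the unreached vertices by a large [B] takes care of arcs in
   the other direction, and of [a] if its tail is unreached. *)
have [B B0 BP] := exists_bound (a :: L) (fun e => acost e + p (atl e) - D (ahd e)).
pose q v := if R v then D v else p v + B.
have qP e : e \in L -> 0 <= acost e + q (atl e) - q (ahd e).
  move=> eL; rewrite /q; case rt: (R (atl e)).
    by have [rh dh] := reached_arc pP eL rt; rewrite /R rh.
  case: (R (ahd e)); last by have := pP e eL; lia.
  by have := BP e; rewrite inE eL orbT => /(_ isT); lia.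
have [Rs Ds] := dist_s pP s.
have qs : q s = 0 by rewrite /q /R Rs.
have plain : 0 <= acost a + q t -> circ_inv (a :: L) /\ map orig (a :: L) = a :: map orig L.
  move=> h; split; last by rewrite /= oa.
  split; rewrite /= ?aL ?wa //; first by move=> v; rewrite big_cons ba bL.
  by exists q => e; rewrite inE => /orP[/eqP->|/qP //]; rewrite -/s -/t qs; lia.
rewrite /ainsert -/s -/t; case E: (cheapest L s t) => [|w r] /=.
  apply: plain; rewrite /q /R /reached E /=.
  by have := BP a; rewrite mem_head => /(_ isT); rewrite -/s -/t /D Ds; lia.
have ww : walkin L s w t by apply: cheapest_sound; rewrite E mem_head.
have qt : q t = wcost w by rewrite /q /R /reached /D /dist E.
rewrite zltE wsumE wcost_rcons; case: ltP => h; last by apply: plain; rewrite qt; move: h; rewrite /zval /=; lia.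
have {}h : wcost w + acost a < 0 by move: h; rewrite /zval /=; lia.
have wL : {subset w <= L} by have /andP[_ /allP] := ww.
have fE e : e \in L -> (if has (fun b => aid b == aid e) w then arev e else e) =
    if e \in w then arev e else e by move=> eL; apply: (flip_mem uL wL eL).
have uw : uniq w by apply: (map_uniq (cheapest_uniq pP E)).
split; last first.
  rewrite /= orig_arev // oa; congr (_ :: _); rewrite -map_comp; apply/eq_in_map => e eL /=.
  by case: ifP => // _; rewrite orig_arev // (allP wfL).
split.
- rewrite /= aid_arev -map_comp [map _ L](_ : _ = map aid L) ?aL //.
  by apply: eq_map => e /=; case: ifP.
- rewrite /= awf_arev // all_map; apply/allP=> e eL /=; case: ifP => _; last exact: (allP wfL).
  by apply/awf_arev/(allP wfL).
- move=> v; rewrite big_cons big_map bal_arev // ba add0r.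
  rewrite (eq_big_seq (fun e => bal e v + if e \in w then inflow e v else 0)); last first.
    move=> e eL /=; rewrite fE //; case: ifP => _; last by rewrite addr0.
    by rewrite bal_arev // (allP wfL).
  rewrite big_split /= bL add0r -big_mkcond /= -big_filter.
  have -> : \sum_(e <- [seq e <- L | e \in w]) inflow e v = \sum_(e <- w) inflow e v.
    apply: perm_big; apply: uniq_perm => //; first by rewrite filter_uniq // (map_uniq uL).
    by move=> e; rewrite mem_filter; case ew: (e \in w) => //=; apply: wL.
  have /andP[ww1 _] := ww; rewrite (walk_inflow v ww1) /inflow /s /t; lia.
(* The potential survives the reversal: [a] had negative reduced cost, and the arcs of the cheapest
   walk had reduced cost zero. *)
exists q => e; rewrite inE => /orP[/eqP->|/mapP[f fL ->]].
  by rewrite acost_arev -[atl (arev a)]/s -[ahd (arev a)]/t qs qt; lia.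
rewrite fE //; case: ifP => fw; last exact: qP.
have [_ rt T] := cheapest_tight pP E fw.
have [rh _] := reached_arc pP fL rt.
rewrite acost_arev -[atl (arev f)]/(ahd f) -[ahd (arev f)]/(atl f) /q /R rt rh /D.
by lia.
Qed.

Lemma inv_circulation arcs : uniq (map aid arcs) -> all (fun a => awf a && ~~ afl a) arcs ->
  circ_inv (circulation arcs) /\ map orig (circulation arcs) = rev arcs.
Proof.
elim/last_ind: arcs => [_ _|arcs a IH].
  by split=> //; split=> // [v|]; [rewrite big_nil | exists (fun=> 0)].
rewrite map_rcons rcons_uniq all_rcons => /andP[an u] /andP[/andP[wa fa] wf].
have [inv E] := IH u wf; rewrite /circulation -cats1 foldl_cat /= -/(circulation arcs).
have [|I O] := inv_insert inv wa fa.
  have -> : map aid (circulation arcs) = rev (map aid arcs).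
    by rewrite -map_rev -E -map_comp; apply: eq_map => e /=; rewrite aid_orig.
  by rewrite mem_rev.
by split=> //; rewrite O E rev_cat.
Qed.

Lemma used_orig L e : uniq (map aid L) -> e \in L -> used L (orig e) = afl e.
Proof.
move=> u eL; rewrite /used; apply/hasP/idP => [[b bL /andP[/eqP E fb]]|fe].
  by rewrite aid_orig in E; rewrite -(aid_inj u bL eL E).
by exists e; rewrite // aid_orig eqxx.
Qed.

Section Optimal.
Context (arcs : seq arc).
Hypothesis uids : uniq (map aid arcs).
Hypothesis fresh : all (fun a => awf a && ~~ afl a) arcs.

Notation x := (used (circulation arcs)).

Lemma sum_orig (F : arc -> int) : \sum_(o <- arcs) F o = \sum_(e <- circulation arcs) F (orig e).
Proof.
have [_ E] := inv_circulation uids fresh.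
by rewrite -(big_map orig xpredT) E; apply/esym/perm_big; rewrite perm_rev.
Qed.

Lemma circulation_balanced v : \sum_(o <- arcs) (x o)%:Z * inflow o v = 0.
Proof.
have [inv _] := inv_circulation uids fresh.
rewrite sum_orig -[RHS](ci_bal inv v); apply: eq_big_seq => e eL.
rewrite (used_orig (ci_uniq inv) eL) /bal /orig; case: (afl e); rewrite ?mul0r // mul1r.
by rewrite /inflow opprB.
Qed.

Lemma circulation_optimal (k : nat) (y : arc -> nat) :
  (forall o, o \in arcs -> (y o <= k)%N) ->
  (forall v, \sum_(o <- arcs) (y o)%:Z * inflow o v = 0) ->
  k%:Z * (\sum_(o <- arcs) (x o)%:Z * acost o) <= \sum_(o <- arcs) (y o)%:Z * acost o.
Proof.
move=> yk yb; have [inv E] := inv_circulation uids fresh; have [p pP] := ci_pot inv.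
pose r o := acost o + p (atl o) - p (ahd o).
have S (z : arc -> nat) : (forall v, \sum_(o <- arcs) (z o)%:Z * inflow o v = 0) ->
    \sum_(o <- arcs) (z o)%:Z * acost o = \sum_(o <- arcs) (z o)%:Z * r o.
  move=> zb; apply/eqP; rewrite -subr_eq0 -sumrB; apply/eqP.
  (* Nodes are arbitrary numbers; a bound on those that occur makes the sum over nodes finite. *)
  pose N := (\max_(o <- arcs) maxn (atl o) (ahd o)).+1.
  have lt o : o \in arcs -> (atl o < N)%N /\ (ahd o < N)%N.
    move=> oa; have := @leq_bigmax_seq _ arcs xpredT (fun o => maxn (atl o) (ahd o)) o oa isT.
    by rewrite geq_max /N => /andP[? ?]; rewrite !ltnS.
  have P o : o \in arcs -> p (ahd o) - p (atl o) = \sum_(v < N) p v * inflow o v.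
    move=> /lt[h1 h2]; rewrite /inflow.
    rewrite (eq_bigr (fun v : 'I_N => (if v == Ordinal h2 then p v else 0) -
        (if v == Ordinal h1 then p v else 0))); last first.
      move=> v _; rewrite -!val_eqE /= [ahd o == v]eq_sym [atl o == v]eq_sym.
      by case: eqP; case: eqP; rewrite /=; lia.
    by rewrite sumrB -!big_mkcond !big_pred1_eq.
  rewrite (eq_big_seq (fun o => \sum_(v < N) p v * ((z o)%:Z * inflow o v))); last first.
    move=> o oa; rewrite -mulrBr /r.
    have -> : acost o - (acost o + p (atl o) - p (ahd o)) = p (ahd o) - p (atl o) by lia.
    rewrite (P o oa) mulr_sumr; apply: eq_bigr => v _.
    by rewrite mulrCA.
  rewrite exchange_big big1 // => v _; rewrite -mulr_sumr zb mulr0 //.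
rewrite (S y yb) (S x circulation_balanced) mulr_sumr !big_seq; apply: ler_sum => o oa.
have [e eL oe] : exists2 e, e \in circulation arcs & o = orig e.
  by apply/mapP; rewrite E mem_rev.
have := pP e eL; have := yk o oa; rewrite oe (used_orig (ci_uniq inv) eL) /r /orig.
case: (afl e) => yo re; last by rewrite mul0r mulr0; apply: mulr_ge0.
rewrite mul1r acost_arev -[atl (arev e)]/(ahd e) -[ahd (arev e)]/(atl e).
rewrite -[X in X <= _]opprK -[X in _ <= X]opprK lerN2 -!mulrN.
have -> : - (- acost e + p (ahd e) - p (atl e)) = acost e + p (atl e) - p (ahd e) by lia.
by apply: ler_wpM2r; rewrite ?lez_nat.
Qed.

End Optimal.

Local Close Scope ring_scope.

Lemma tsz_seq_le (A : eqType) (EA : Enc A) (s : seq A) B :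
  (forall x, x \in s -> tsz x <= B) -> tsz s <= size s * B.+1 + 1.
Proof.
elim: s => [|x s IH] h; first by rewrite tsz_nil.
have {}IH : tsz s <= size s * B.+1 + 1 by apply: IH => y ys; apply: h; rewrite inE ys orbT.
have hx := h x (mem_head _ _); rewrite tsz_cons [size _]/= mulSn.
by move: IH; set Y := _ * _ => IH; lia.
Qed.

Lemma tsz_in (A : eqType) (EA : Enc A) (s : seq A) x : x \in s -> tsz x <= tsz s.
Proof. by move=> /(tsz_mem EA id); rewrite map_id => /ltnW. Qed.

#[export] Instance fp_wsum : FP1 wsum.
Proof.
apply: (@FP_foldl _ _ _ _ _ _
  (fun _ (c : word * word) (a : arc) => (addw c.1 a.2.2.1, addw c.2 a.2.2.2))); fp.
exists 10 => w i; set f := fun c a => _.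
have main (u : seq arc) c : size (foldl f c u).1 + size (foldl f c u).2 <= size c.1 + size c.2 + tsz u.
  elim: u c => [|[[j fl] [uv [p q]]] u IH] c; first by rewrite /=; lia.
  apply: leq_trans (IH _) _; rewrite /f /= !size_addw tsz_cons !tsz_pair.
  have := @size_tsz _ enc_bool p; have := @size_tsz _ enc_bool q; lia.
have tk : tsz (take i w) <= tsz w.
  rewrite -[X in _ <= tsz X](cat_take_drop i) -ltnS tsz_cat.
  by rewrite -addn1 leq_add2l tsz_gt0.
have := main (take i w) ([::], [::]); case: (foldl _ _ _) => p q /= h.
rewrite tsz_pair; have := tsz_word p; have := tsz_word q.
rewrite /poly_bound; have : (tsz w).+1 <= (tsz w).+1 ^ 10 by rewrite -{1}(expn1 _.+1) leq_pexp2l.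
lia.
Qed.

#[export] Instance fp_zlt : FP2 zlt.
Proof. by rewrite /FP2 /zlt; fp. Qed.

#[export] Instance fp_wbetter : FP2 wbetter.
Proof. by rewrite /FP2 /wbetter; fp. Qed.

#[export] Instance fp_best : FP1 best.
Proof.
apply: (@FP_foldl_add _ _ _ _ _ _ (fun _ (c : seq (seq arc)) (w : seq arc) =>
  if nilp c || wbetter w (head [::] c) then [:: w] else c)); fp.
apply: (@bound1 (fun m => m + 2)); [by pbd | move=> a c w].
case: ifP => _; last by rewrite leq_addr.
by rewrite tsz_cons tsz_nil; lia.
Qed.

#[export] Instance fp_tget : FP2 tget.
Proof. by rewrite /FP2 /tget; fp. Qed.

#[export] Instance fp_tstep : FP3 tstep.
Proof. by rewrite /FP3 /tstep /atl /ahd; fp. Qed.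

Lemma tab_form L s i : tab L s i = [seq (v, tget (tab L s i) v) | v <- s :: map ahd L].
Proof.
case: i => [|i].
  rewrite -[LHS]/[seq (v, if v == s then [:: [::]] else [::]) | v <- s :: map ahd L].
  by apply/eq_in_map => v vV; rewrite tab0.
by rewrite {1}/tab iterS -/(tab L s i) {1}/tstep; apply/eq_in_map => v vV; rewrite tabS vV.
Qed.

Lemma tab_size L s i v : size (tget (tab L s i) v) <= 1 /\
  forall w, w \in tget (tab L s i) v -> size w <= i.
Proof.
elim: i v => [|i IH] v; first by rewrite tab0; case: eqP => // _; split=> // w; rewrite inE => /eqP->.
rewrite tabS; case: ifP => // _; split=> [|w /best_in].
  by case: (cands L s i v) (bestP (cands L s i v)) => [->|? ? [w [-> _ _]]].
rewrite mem_cat => /orP[/(IH v).2|/flatten_mapP[a _ /mapP[u /(IH _).2 h ->]]]; first exact: leqW.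
by rewrite size_rcons.
Qed.

(** Each entry holds at most one walk, made of at most [i] arcs of [L], so storing whole walks stays
    polynomial. *)
Lemma tsz_tab L s i :
  tsz (tab L s i) <= (tsz L + 1) * ((tsz L + tsz s + (i * (tsz L).+1 + 1 + 2)).+1).+1 + 1.
Proof.
apply: leq_trans (tsz_seq_le (B := (tsz L + tsz s + (i * (tsz L).+1 + 1 + 2)).+1) _) _; last first.
  rewrite leq_add2r leq_mul2r {1}tab_form size_map /= size_map.
  have h : (size L).*2 < tsz L by exact: size_tsz.
  by lia.
rewrite {1}tab_form => p /mapP[v vV ->]; rewrite tsz_pair ltnS leq_add //.
  move: vV; rewrite inE => /orP[/eqP->|/mapP[a aL ->]]; first exact: leq_addl.
  apply: (@leq_trans (tsz L)); last exact: leq_addr.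
  apply: leq_trans (tsz_in _ aL); case: a {aL} => [x [[u t] y]].
  by rewrite /ahd !tsz_pair /=; lia.
have [s1 sw] := tab_size L s i v.
have := @tab_sound L s i v; case: (tget _ _) s1 sw => [|w [|//]] _ sw sd.
  by rewrite tsz_nil; lia.
have /andP[_ /allP wL] := sd w (mem_head _ _).
have h : tsz w <= size w * (tsz L).+1 + 1 by apply: tsz_seq_le => x xw; exact/tsz_in/wL.
rewrite tsz_cons tsz_nil addn1 addn2 !ltnS; apply: leq_trans h _.
by rewrite leq_add2r leq_mul2r; apply/orP; right; apply: sw; rewrite mem_head.
Qed.

#[export] Instance fp_cheapest : FP3 cheapest.
Proof.
have H : FP (fun p : seq arc * nat => tab p.1 p.2 (size p.1)).
  apply: (@FP_iter _ _ _ _ _ (fun p => tstep p.1 (p.2 :: map ahd p.1))); rewrite ?/ahd; fp.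
  pose q m := (m + 1) * ((m + m + (m * m.+1 + 1 + 2)).+1).+1 + 1.
  have [k kP] : pbounded q by rewrite /q; pbd.
  exists k => -[L s] i /= le; apply: leq_trans (kP _).
  apply: leq_trans (tsz_tab L s i) _; rewrite /q tsz_pair.
  have h : (size L).*2 < tsz L by exact: size_tsz.
  rewrite leq_add2r leq_mul // ?ltnS; first by lia.
  by rewrite leq_add ?leq_add // ?leq_mul //; lia.
have ? : FP2 (fun L s => tab L s (size L)) := H.
rewrite /FP3 /cheapest.
apply (FP_app2 (F := tget) (u := fun p : seq arc * (nat * nat) => tab p.1 p.2.1 (size p.1))); fp.
by apply (FP_app2 (F := fun L s => tab L s (size L))); fp.
Qed.

#[export] Instance fp_arev : FP1 arev.
Proof. by rewrite /FP1 /arev; fp. Qed.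

#[export] Instance fp_ainsert : FP2 ainsert.
Proof. by rewrite /FP2 /ainsert /ahd /atl /aid; fp. Qed.

Lemma tsz_arev a : tsz (arev a) = tsz a.
Proof. by case: a => [[i [f g]] [[u v] [p q]]]; rewrite /arev /= !tsz_pair; lia. Qed.

Lemma tsz_ainsert L a : tsz (ainsert L a) = (tsz L + tsz a).+1.
Proof.
rewrite /ainsert; case: (cheapest _ _ _) => [|w r] /=; first by rewrite tsz_cons addnC.
case: ifP => _; last by rewrite tsz_cons addnC.
rewrite tsz_cons tsz_arev addnC; congr (_ + _).+1.
by elim: L => // e L IH; rewrite /= !tsz_cons IH; case: ifP; rewrite ?tsz_arev.
Qed.

#[export] Instance fp_circulation : FP1 circulation.
Proof.
apply: (@FP_foldl_add _ _ _ _ _ _ (fun _ => ainsert)); fp.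
by apply: (@bound1 S); [pbd | move=> u L a; rewrite tsz_ainsert; lia].
Qed.

(** * Degree constrained subgraphs of bipartite graphs *)

Definition touch (ed : nat -> nat * nat) v i := (v == (ed i).1) || (v == (ed i).2).

(* Node 0 is joined by m arcs to each vertex on side false and from each vertex
   on side true; vertex v is node v.+1. *)
Definition earc (ed : nat -> nat * nat) (co : nat -> word * word) (i : nat) : arc :=
  ((i, (false, true)), (((ed i).1.+1, (ed i).2.+1), co i)).
Definition narc (N m : nat) (s : nat -> bool) (v j : nat) : arc :=
  ((N + (v * m + j), (false, true)),
   (if s v then (v.+1, 0) else (0, v.+1), ([::], [::]))).
Definition network (nv N m : nat) (s : nat -> bool) (ed : nat -> nat * nat)
    (co : nat -> word * word) (act : nat -> bool) : seq arc :=
  [seq earc ed co i | i <- iota 0 N & act i] ++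
  flatten [seq [seq narc N m s v j | j <- iota 0 m] | v <- iota 0 nv].

Definition selected (act : nat -> bool) (L : seq arc) (i : nat) :=
  act i && has (fun e => (aid e == i) && afl e) L.

Local Open Scope ring_scope.

Lemma sum_at n u (F : nat -> int) : (u < n)%N -> \sum_(0 <= v < n) F v * (v == u)%:Z = F u.
Proof.
move=> un; rewrite (bigD1_seq u) ?mem_index_iota ?iota_uniq //= eqxx mulr1 big1 ?addr0 //.
by move=> v /negbTE->; rewrite mulr0.
Qed.

Section Network.
Context (nv N m : nat) (s : nat -> bool) (ed : nat -> nat * nat).
Context (co : nat -> word * word) (act : nat -> bool).
Hypothesis ed_s : forall i, (i < N)%N -> s (ed i).1 = false /\ s (ed i).2 = true.
Hypothesis ed_lt : forall i, (i < N)%N -> ((ed i).1 < nv)%N /\ ((ed i).2 < nv)%N.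

Let A := network nv N m s ed co act.
Let sel := selected act (circulation A).

Lemma network_uniq : uniq (map aid A).
Proof.
rewrite map_cat cat_uniq -map_comp map_id_in; last by [].
rewrite filter_uniq ?iota_uniq //=; apply/andP; split.
  apply/hasPn => _ /mapP[_ /flatten_mapP[v _ /mapP[j _ ->]] ->].
  by rewrite mem_filter mem_iota /aid /=; lia.
have -> : map aid (flatten [seq [seq narc N m s v j | j <- iota 0 m] | v <- iota 0 nv]) =
    [seq (N + (v * m + j))%N | v <- iota 0 nv, j <- iota 0 m].
  rewrite map_flatten -map_comp; congr flatten; apply: eq_map => v /=.
  by rewrite -map_comp.
apply: allpairs_uniq; rewrite ?iota_uniq // => -[v j] [v' j'] /=.
move=> /allpairsP[[a b] /= [_ bm [-> ->]]] /allpairsP[[a' b'] /= [_ bm' [-> ->]]].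
rewrite !mem_iota !add0n /= in bm bm' * => /addnI E.
have e1 : a = a' by have := congr1 (divn^~ m) E; rewrite !divnMDl ?divn_small ?addn0 //; lia.
by rewrite e1 in E *; rewrite (addnI E).
Qed.

Lemma network_fresh : all (fun a => awf a && ~~ afl a) A.
Proof.
rewrite all_cat; apply/andP; split; first by apply/allP => _ /mapP[i _ ->].
by apply/allP => _ /flatten_mapP[v _ /mapP[j _ ->]].
Qed.

Lemma big_network (F : arc -> int) : \sum_(o <- A) F o =
  \sum_(0 <= i < N | act i) F (earc ed co i) + \sum_(0 <= v < nv) \sum_(0 <= j < m) F (narc N m s v j).
Proof.
rewrite big_cat big_map big_filter /index_iota !subn0; congr (_ + _).
rewrite big_flatten big_map; apply: eq_bigr => v _; by rewrite big_map.
Qed.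

Lemma inflow_earc i v : (i < N)%N -> inflow (earc ed co i) v.+1 =
  (if s v then 1 else -1) * (touch ed v i)%:Z.
Proof.
move=> /ed_s[s1 s2]; rewrite /inflow /ahd /atl /touch /= !eqSS ![v == _]eq_sym.

have [e2|_] := eqVneq (ed i).2 v; have [e1|_] := eqVneq (ed i).1 v; rewrite ?mulr0 //.
- by rewrite e1 -e2 s2 in s1.
- by rewrite -e2 s2.
- by rewrite -e1 s1.
Qed.

Lemma touchE i v : (i < N)%N -> touch ed v i = ((v == (ed i).1) + (v == (ed i).2))%N :> nat.
Proof.
move=> /ed_s[s1 s2]; rewrite /touch; have [->|_] //= := eqVneq v (ed i).1.
by case: eqP s2 => // <-; rewrite s1.
Qed.

Lemma inflow_narc u j v : inflow (narc N m s u j) v.+1 =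
  (if s v then -1 else 1) * (u == v)%:Z.
Proof.
rewrite /inflow /ahd /atl /narc /=; have [->|ne] := eqVneq u v.
  by case: (s v); rewrite /= eqxx.
by case: (s u); rewrite /= eqSS (negbTE ne) mulr0.
Qed.

(** Balance at the node of [v]: the selected edges at [v] are as many as the used arcs between this
    node and node 0, of which there are only [m]. *)
Lemma sel_cap v : (v < nv)%N -> (\sum_(0 <= i < N) sel i * touch ed v i <= m)%N.
Proof.
move=> vnv; have := circulation_balanced network_uniq network_fresh v.+1.
rewrite big_network (bigD1_seq v) ?mem_index_iota ?iota_uniq //=.
rewrite [X in _ + (_ + X)]big1 ?addr0; last first.
  by move=> u /negbTE nuv; rewrite big1 // => j _; rewrite inflow_narc nuv !mulr0.
set U := circulation _.
rewrite (eq_big_nat _ _ (F2 := fun j => (used U (narc N m s v j))%:Z * (if s v then -1 else 1))); last first.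
  by move=> j _; rewrite inflow_narc eqxx mulr1.
have -> : \sum_(0 <= i < N | act i) (used U (earc ed co i))%:Z * inflow (earc ed co i) v.+1 =
    (if s v then 1 else -1) * (\sum_(0 <= i < N) sel i * touch ed v i)%N%:Z.
  rewrite big_mkcond [in RHS](big_morph Posz PoszD (erefl _)) mulr_sumr.
  apply: eq_big_nat => i /andP[_ iN]; rewrite /sel /selected /used /aid /=.
  case: (act i); rewrite ?mulr0 // inflow_earc // mulrCA PoszM //.
rewrite -mulr_suml => E.
have : (\sum_(0 <= i < N) sel i * touch ed v i)%N%:Z = \sum_(0 <= j < m) (used U (narc N m s v j))%:Z.
  by move: E; set a := Posz _; set b := bigop _ _ _; case: (s v) => E; lia.
rewrite -(big_morph Posz PoszD (erefl _)) => -[->].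
apply: (@leq_trans (\sum_(0 <= j < m) 1)); first by apply: leq_sum => j _; apply: leq_b1.
by rewrite sum_nat_const_nat muln1 subn0.
Qed.

(** Parallel arcs of capacity [k] are filled one after the other. *)
Lemma split_sum k m' d : (d <= m' * k)%N -> (\sum_(0 <= j < m') minn k (d - j * k) = d)%N.
Proof.
elim: m' d => [|n IH] d; first by rewrite big_geq //; lia.
rewrite mulSn => le; rewrite big_nat_recl // mul0n subn0.
under eq_bigr do rewrite mulSn subnDA.
by rewrite IH; lia.
Qed.

Lemma sel_opt k (z : nat -> nat) : (forall i, (i < N)%N -> z i <= k)%N ->
  (forall i, (i < N)%N -> ~~ act i -> z i = 0%N) ->
  (forall v, (v < nv)%N -> (\sum_(0 <= i < N) z i * touch ed v i <= m * k)%N) ->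
  k%:Z * (\sum_(0 <= i < N) (sel i)%:Z * zval (co i)) <= \sum_(0 <= i < N) (z i)%:Z * zval (co i).
Proof.
move=> zk za zd; pose deg v := (\sum_(0 <= i < N) z i * touch ed v i)%N.
(* Extends [z] to a circulation: the degree of [z] at a vertex is carried by the parallel arcs
   there, each of them filled up to [k] before the next one. *)
pose y (o : arc) : nat := if (aid o < N)%N then z (aid o) else
  minn k (deg ((aid o - N) %/ m)%N - ((aid o - N) %% m) * k).
have ye i : (i < N)%N -> y (earc ed co i) = z i by rewrite /y /aid /= => ->.
have yn v j : (j < m)%N -> y (narc N m s v j) = minn k (deg v - j * k).
  move=> jm; rewrite /y /aid /= ltnNge leq_addr /= addKn divnMDl; last by lia.
  by rewrite divn_small // addn0 modnMDl modn_small.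
have cond (F : nat -> int) : \sum_(0 <= i < N | act i) (z i)%:Z * F i = \sum_(0 <= i < N) (z i)%:Z * F i.
  rewrite big_mkcond; apply: eq_big_nat => i /andP[_ iN].
  by case a : (act i) => //; rewrite za ?a // mul0r.
have zero v j : acost (narc N m s v j) = 0 by [].
have ysum v : (v < nv)%N -> (\sum_(0 <= j < m) (y (narc N m s v j))%:Z = (deg v)%:Z).
  move=> vn; rewrite -[in RHS](split_sum (zd v vn : deg v <= _)%N) (big_morph Posz PoszD (erefl _)).
  by apply: eq_big_nat => j /andP[_ /yn ->].
have := @circulation_optimal A network_uniq network_fresh k y.
rewrite !big_network.
have R (G : arc -> int) : \sum_(0 <= v < nv) \sum_(0 <= j < m) G (narc N m s v j) * acost (narc N m s v j) = 0.
  by rewrite big1 // => v _; rewrite big1 // => j _; rewrite mulr0.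
rewrite (R (fun o => (used (circulation A) o)%:Z)) (R (fun o => (y o)%:Z)) !addr0.
have -> : \sum_(0 <= i < N | act i) (y (earc ed co i))%:Z * acost (earc ed co i) =
    \sum_(0 <= i < N) (z i)%:Z * zval (co i).
  by rewrite -cond big_mkcond [RHS]big_mkcond; apply: eq_big_nat => i /andP[_ /ye ->].
have -> : \sum_(0 <= i < N | act i) (used (circulation A) (earc ed co i))%:Z * acost (earc ed co i) =
    \sum_(0 <= i < N) (sel i)%:Z * zval (co i).
  rewrite big_mkcond; apply: eq_big_nat => i _; rewrite /sel /selected /used /aid /=.
  by case: (act i); rewrite ?mul0r.
apply.
  move=> o; rewrite mem_cat => /orP[/mapP[i]|/flatten_mapP[v vv /mapP[j jm ->]]].
    by rewrite mem_filter mem_iota /= add0n => /andP[_ iN] ->; rewrite ye // zk.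
  by rewrite yn ?geq_minl //; move: jm; rewrite mem_iota; lia.
(* At node 0 the degrees on the two sides cancel, since every edge has one end on each side. *)
case=> [|v]; rewrite big_network.
  rewrite big_mkcond (eq_big_nat _ _ (F2 := fun=> 0)); last first.
    by move=> i _; case: ifP => // _; rewrite /inflow /ahd /atl /= mulr0.
  rewrite big1 // add0r.
  rewrite (eq_big_nat _ _ (F2 := fun v => \sum_(0 <= i < N) (if s v then 1 else -1) * ((z i)%:Z * (touch ed v i)%:Z))).
    rewrite exchange_big big1_seq // => i; rewrite mem_index_iota => /and3P[_ _ iN].
    have [s1 s2] := ed_s iN; have [l1 l2] := ed_lt iN.
    rewrite (eq_bigr (fun v => (if s v then 1 else -1) * (z i)%:Z * (v == (ed i).1)%:Z +
        (if s v then 1 else -1) * (z i)%:Z * (v == (ed i).2)%:Z)); last first.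
      by move=> v _; rewrite touchE // PoszD mulrDr mulrDr !mulrA.
    by rewrite big_split /= !sum_at // s1 s2; lia.
  move=> v /andP[_ vn]; rewrite -mulr_sumr.
  under [in RHS]eq_bigr do rewrite -PoszM.
  rewrite -(big_morph Posz PoszD (erefl _)) -/(deg v) -(ysum v vn) mulr_sumr.
  by apply: eq_bigr => j _; rewrite mulrC /inflow /ahd /atl /narc; case: ifP.
have E1 : \sum_(0 <= i < N | act i) (y (earc ed co i))%:Z * inflow (earc ed co i) v.+1 =
    (if s v then 1 else -1) * (deg v)%:Z.
  transitivity (\sum_(0 <= i < N) (z i)%:Z * inflow (earc ed co i) v.+1).
    by rewrite -cond big_mkcond [RHS]big_mkcond; apply: eq_big_nat => i /andP[_ /ye ->].
  rewrite /deg (big_morph Posz PoszD (erefl _)) mulr_sumr; apply: eq_big_nat => i /andP[_ iN].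
  by rewrite inflow_earc // mulrCA PoszM.
rewrite E1; case: (ltnP v nv) => vn; last first.
  have -> : deg v = 0%N.
    rewrite /deg big1_seq // => i; rewrite mem_index_iota => /and3P[_ _ /ed_lt[l1 l2]].
    rewrite /touch; have /negbTE -> : v != (ed i).1 by lia.
    have /negbTE -> : v != (ed i).2 by lia.
    by rewrite muln0.
  rewrite mulr0 add0r big1_seq // => u; rewrite mem_index_iota => /and3P[_ _ un].
  rewrite big1 // => j _; rewrite inflow_narc; have /negbTE -> : u != v by lia.
  by rewrite !mulr0.
rewrite (bigD1_seq v) ?mem_index_iota ?iota_uniq //=.
rewrite [X in _ + (_ + X)]big1 ?addr0; last first.
  by move=> u /negbTE nuv; rewrite big1 // => j _; rewrite inflow_narc nuv !mulr0.
under eq_bigr do rewrite inflow_narc eqxx mulr1.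
by rewrite -mulr_suml ysum //; case: (s v); lia.
Qed.

End Network.

Local Close Scope ring_scope.

(* Each vertex carries the name of its component and its side; an edge between
   two components merges the second one into the first one. *)
Definition side_step (T : seq (nat * bool)) (e : nat * nat) : seq (nat * bool) :=
  let a := nth (0, false) T e.1 in let b := nth (0, false) T e.2 in
  if a.1 == b.1 then T else
  [seq if x.1 == b.1 then (a.1, x.2 (+) (a.2 == b.2)) else x | x <- T].
Definition sides (nv : nat) (es : seq (nat * nat)) : seq (nat * bool) :=
  foldl side_step [seq (i, false) | i <- iota 0 nv] es.
Definition side (T : seq (nat * bool)) (v : nat) : bool := (nth (0, false) T v).2.
Definition orient (T : seq (nat * bool)) (e : nat * nat) : nat * nat :=
  if side T e.1 then (e.2, e.1) else e.

Section Sides.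
Context (nv : nat) (es : seq (nat * nat)) (col : nat -> bool).
Hypothesis es_lt : all (fun e => (e.1 < nv) && (e.2 < nv)) es.
Hypothesis es_col : all (fun e => col e.1 != col e.2) es.

(** Invariant: for two vertices in the same component, the sides differ exactly if the colours do.
    In the end the two ends of every edge lie in the same component. *)
Lemma sidesP : size (sides nv es) = nv /\
  all (fun e => side (sides nv es) e.1 != side (sides nv es) e.2) es.
Proof.
pose t T v := nth (0, false) (T : seq (nat * bool)) v.
pose inv T := size T = nv /\ forall x y, x < nv -> y < nv -> (t T x).1 = (t T y).1 ->
  (t T x).2 (+) (t T y).2 = col x (+) col y.
have main r T : inv T -> all (fun e => (e.1 < nv) && (e.2 < nv)) r -> all (fun e => col e.1 != col e.2) r ->
  [/\ inv (foldl side_step T r),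
    forall x y, x < nv -> y < nv -> (t T x).1 = (t T y).1 ->
      (t (foldl side_step T r) x).1 = (t (foldl side_step T r) y).1 &
    all (fun e => (t (foldl side_step T r) e.1).1 == (t (foldl side_step T r) e.2).1) r].
  elim: r T => [|e r IH] T iT //= /andP[/andP[l1 l2] lr] /andP[c1 cr].
  have [sT hT] := iT.
  have [iS kS eS] : [/\ inv (side_step T e), forall x y, x < nv -> y < nv -> (t T x).1 = (t T y).1 ->
      (t (side_step T e) x).1 = (t (side_step T e) y).1 &
      (t (side_step T e) e.1).1 = (t (side_step T e) e.2).1].
    rewrite /side_step -/(t T e.1) -/(t T e.2); case: eqP => [//|ne].
    have N x : x < nv -> t [seq if x.1 == (t T e.2).1 then ((t T e.1).1, x.2 (+) ((t T e.1).2 == (t T e.2).2))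
        else x | x <- T] x = if (t T x).1 == (t T e.2).1 then ((t T e.1).1, (t T x).2 (+) ((t T e.1).2 == (t T e.2).2))
        else t T x.
      by move=> xn; rewrite /t (nth_map (0, false)) // sT.
    split; first split; first by rewrite size_map.
    - move=> x y xn yn; rewrite !N //.
      have h1 := hT x e.2 xn l2; have h2 := hT y e.2 yn l2; have h3 := hT x e.1 xn l1.
      have h4 := hT y e.1 yn l1; have h5 := hT x y xn yn.
      have [ex|_] := eqVneq (t T x).1 (t T e.2).1; have [ey|_] := eqVneq (t T y).1 (t T e.2).1 => //=.
      + by move=> _; rewrite addbACA addbb addbF h5 // ex.
      + move=> ey; have {}h4 := h4 (esym ey); have {}h1 := h1 ex.
        by move: c1 h4 h1; move: (t T x).2 (t T y).2 (t T e.1).2 (t T e.2).2 (col x) (col y) (col e.1)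
          (col e.2) => [] [] [] [] [] [] [] [].
      + move=> ex; have {}h3 := h3 ex; have {}h2 := h2 ey.
        by move: c1 h3 h2; move: (t T x).2 (t T y).2 (t T e.1).2 (t T e.2).2 (col x) (col y) (col e.1)
          (col e.2) => [] [] [] [] [] [] [] [].
    - by move=> x y xn yn exy; rewrite !N // exy; case: ifP.
    by rewrite !N // eqxx; case: ifP.
  have [i1 k1 a1] := IH _ iS lr cr; split=> //; first by move=> x y xn yn /kS/k1; apply.
  by rewrite a1 (k1 _ _ l1 l2 eS) eqxx.
have i0 : inv [seq (i, false) | i <- iota 0 nv].
  have N x : x < nv -> t [seq (i, false) | i <- iota 0 nv] x = (x, false).
    by move=> xn; rewrite /t (nth_map 0) ?size_iota // nth_iota.
  by split=> [|x y xn yn]; rewrite ?size_map ?size_iota // !N //= => ->; case: (col y).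
have [[si hi] _ ae] := main es _ i0 es_lt es_col; split=> //.
apply/allP => e ein; have /andP[l1 l2] := allP es_lt e ein.
have := hi _ _ l1 l2 (eqP (allP ae e ein)); have := allP es_col e ein.
rewrite -/(sides nv es) /side -/(t (sides nv es) e.1) -/(t (sides nv es) e.2).
by move: (t _ e.1).2 (t _ e.2).2 (col e.1) (col e.2) => [] [] [] [].
Qed.

Lemma orientP e : e \in es -> let T := sides nv es in
  [/\ side T (orient T e).1 = false, side T (orient T e).2 = true,
    (orient T e).1 < nv & (orient T e).2 < nv].
Proof.
move=> ein T; have [_ /allP/(_ _ ein)] := sidesP; have /andP[l1 l2] := allP es_lt e ein.
by rewrite /orient -/T; case E : (side T e.1); case E' : (side T e.2) => //=; rewrite E E'.
Qed.

End Sides.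

(** * Choosing multiplicities and decomposing the multigraph into matchings *)

Lemma leq_sum_nat n (F G : nat -> nat) : (forall i, i < n -> F i <= G i) ->
  \sum_(0 <= i < n) F i <= \sum_(0 <= i < n) G i.
Proof. by move=> FG; rewrite !big_mkord; apply: leq_sum => i _; apply: FG. Qed.

(** Arc number [i * n + j] is copy [j] of edge [i]; with [n = 1] these are the edges themselves. *)
Definition ends (es : seq (nat * nat)) (n i : nat) : nat * nat := nth (0, 0) es (i %/ n).
Definition edeg (es : seq (nat * nat)) (y : seq nat) (v : nat) : nat :=
  sumn [seq nth 0 y i * nat_of_bool (touch (ends es 1) v i) | i <- iota 0 (size es)].

(** The components of each profit are exchanged because circulations minimize. *)
Definition flow_rows (nv : nat) (s : nat -> bool) (es : seq (nat * nat)) (n : nat)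
    (cs : seq (word * word)) : seq nat :=
  let act := fun=> true in
  let L := circulation (network nv (size es * n) n s (ends es n)
    (fun i => ((nth ([::], [::]) cs i).2, (nth ([::], [::]) cs i).1)) act) in
  [seq sumn [seq nat_of_bool (selected act L (i * n + j)) | j <- iota 0 n] | i <- iota 0 (size es)].

(* If k is the maximum degree of the multigraph y then the optimum covers every
   vertex of degree k, because the fractional solution y / k does. *)
Definition peel1 (nv : nat) (s : nat -> bool) (es : seq (nat * nat)) (y : seq nat) (k : nat) : seq bool :=
  let act := fun i => 0 < nth 0 y i in
  let L := circulation (network nv (size es) 1 s (ends es 1)
    (fun i => ([::], addw [:: edeg es y (ends es 1 i).1 == k] [:: edeg es y (ends es 1 i).2 == k])) act) in
  [seq selected act L i | i <- iota 0 (size es)].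
Definition peel_step (nv : nat) (s : nat -> bool) (es : seq (nat * nat))
    (c : seq (seq bool) * seq nat) (k : nat) : seq (seq bool) * seq nat :=
  let M := peel1 nv s es c.2 k in
  (rcons c.1 M, [seq nth 0 c.2 i - nat_of_bool (nth false M i) | i <- iota 0 (size es)]).
Definition peel (nv : nat) (s : nat -> bool) (es : seq (nat * nat)) (y : seq nat) (n : nat) :
    seq (seq bool) :=
  (foldl (peel_step nv s es) ([::], y) (rev (iota 1 n))).1.

Section Peel.
Context (nv : nat) (s : nat -> bool) (es : seq (nat * nat)).
Hypothesis esP : forall e, e \in es ->
  [/\ s e.1 = false, s e.2 = true, e.1 < nv & e.2 < nv].

Let N := size es.

Lemma endsP n i : i < N * n -> ends es n i \in es.
Proof. by move=> iN; rewrite mem_nth // ltn_divLR //; case: n iN => //; rewrite muln0. Qed.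

Lemma ends1P i : i < N -> ends es 1 i \in es.
Proof. by move=> iN; apply: endsP; rewrite muln1. Qed.

Lemma edegE y v : edeg es y v = \sum_(0 <= i < N) nth 0 y i * touch (ends es 1) v i.
Proof. by rewrite /edeg sumnE big_map /index_iota subn0. Qed.

(** Double counting; it turns the objective of [peel1] into the number of vertices of maximum degree
    that are covered. *)
Lemma sum_endpoints (w : nat -> nat) (f : nat -> nat) :
  \sum_(0 <= i < N) w i * (f (ends es 1 i).1 + f (ends es 1 i).2) =
  \sum_(0 <= v < nv) f v * \sum_(0 <= i < N) w i * touch (ends es 1) v i.
Proof.
under [RHS]eq_bigr do rewrite big_distrr /=.
rewrite exchange_big; apply: eq_big_nat => i /andP[_ iN] /=.
have [s1 s2 l1 l2] := esP (ends1P iN).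
have P u : u < nv -> \sum_(0 <= v < nv) f v * (v == u) = f u.
  move=> un; rewrite (bigD1_seq u) ?mem_index_iota ?iota_uniq //= eqxx muln1 big1 ?addn0 //.
  by move=> v /negbTE->; rewrite muln0.
rewrite (eq_bigr (fun v => w i * (f v * (v == (ends es 1 i).1)) + w i * (f v * (v == (ends es 1 i).2)))).
  by rewrite big_split /= -!big_distrr /= !P // mulnDr.
move=> v _; rewrite (@touchE N s) //; first by rewrite !mulnDr; lia.
by move=> j /ends1P /esP[].
Qed.

Lemma peel1P y k : (forall v, v < nv -> edeg es y v <= k.+1) ->
  let M := peel1 nv s es y k.+1 in
  [/\ size M = N, forall i, i < N -> nat_of_bool (nth false M i) <= nth 0 y i,
    forall v, v < nv -> \sum_(0 <= i < N) nth false M i * touch (ends es 1) v i <= 1 &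
    forall v, v < nv -> edeg es y v - \sum_(0 <= i < N) nth false M i * touch (ends es 1) v i <= k].
Proof.
move=> yk M.
pose act i := 0 < nth 0 y i.
pose d v : nat := edeg es y v == k.+1.
pose co i : word * word := ([::], addw [:: edeg es y (ends es 1 i).1 == k.+1] [:: edeg es y (ends es 1 i).2 == k.+1]).
pose sel := selected act (circulation (network nv N 1 s (ends es 1) co act)).
have Mi i : i < N -> nth false M i = sel i.
  by move=> iN; rewrite /M /peel1 (nth_map 0) ?size_iota // nth_iota.
have es1 i : i < N -> s (ends es 1 i).1 = false /\ s (ends es 1 i).2 = true by move=> /ends1P/esP[].
have es2 i : i < N -> (ends es 1 i).1 < nv /\ (ends es 1 i).2 < nv by move=> /ends1P/esP[].
have MS v : \sum_(0 <= i < N) nth false M i * touch (ends es 1) v i = \sum_(0 <= i < N) sel i * touch (ends es 1) v i.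
  by apply: eq_big_nat => i /andP[_ /Mi->].
have cap v : v < nv -> \sum_(0 <= i < N) nth false M i * touch (ends es 1) v i <= 1.
  by move=> vn; rewrite MS; exact: (sel_cap 1 co act es1).
split=> //; first by rewrite size_map size_iota.
  by move=> i iN; rewrite Mi // /sel /selected -/(act i) /act; case: (nth 0 y i) => //= j; case: (has _ _).
have zco i : zval (co i) = (- (d (ends es 1 i).1 + d (ends es 1 i).2)%N%:Z)%R.
  by rewrite /zval /co addwE /= !addn0 sub0r.
have zk i : i < N -> nth 0 y i <= k.+1.
  move=> iN; apply: leq_trans (yk (ends es 1 i).1 _); last by have [] := es2 i iN.
  rewrite edegE (bigD1_seq i) ?mem_index_iota ?iota_uniq //= /touch eqxx muln1; exact: leq_addr.
have za i : i < N -> ~~ act i -> nth 0 y i = 0 by move=> _; rewrite /act; case: (nth 0 y i).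
have zd v : v < nv -> \sum_(0 <= i < N) nth 0 y i * touch (ends es 1) v i <= 1 * k.+1.
  by move=> vn; rewrite mul1n -edegE; apply: yk.
have := sel_opt (m := 1) co es1 es2 zk za zd.
have H (w : nat -> nat) : (\sum_(0 <= i < N) (w i)%:Z * zval (co i) =
    - (\sum_(0 <= v < nv) d v * \sum_(0 <= i < N) w i * touch (ends es 1) v i)%N%:Z)%R.
  rewrite -sum_endpoints (big_morph Posz PoszD (erefl _)) -sumrN; apply: eq_bigr => i _.
  by rewrite zco mulrN PoszM.
rewrite (H sel) (H (fun i => nth 0 y i)) => le.
(* The fractional solution [y / k.+1] covers each vertex of degree [k.+1] exactly once, so the
   integral optimum covers at least as many of these vertices, counted with multiplicity. *)
have {}le : \sum_(0 <= v < nv) d v * k.+1 <= k.+1 * \sum_(0 <= v < nv) d v * \sum_(0 <= i < N) sel i * touch (ends es 1) v i.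
  have E : \sum_(0 <= v < nv) d v * \sum_(0 <= i < N) nth 0 y i * touch (ends es 1) v i = \sum_(0 <= v < nv) d v * k.+1.
    by apply: eq_bigr => v _; rewrite -edegE /d; case: eqP => [->|].
  by rewrite E in le; lia.
rewrite -big_distrl /= mulnC leq_pmul2l // in le.
move=> v vn; rewrite leq_subLR; have [lt|ge] := ltnP (edeg es y v) k.+1; first by rewrite -ltnS; lia.
have dv : d v = 1 by rewrite /d eqn_leq yk // ge.
(* No vertex is covered twice, so missing one vertex of degree [k.+1] would make that count too
   small. *)
suff -> : \sum_(0 <= i < N) nth false M i * touch (ends es 1) v i = 1 by rewrite add1n yk.
apply/eqP; rewrite eqn_leq cap // MS lt0n; apply: contraTneq le => z.
rewrite -ltnNge (bigD1_seq v) ?mem_index_iota ?iota_uniq //= z muln0 add0n.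
rewrite [X in _ < X](bigD1_seq v) ?mem_index_iota ?iota_uniq //= dv add1n ltnS.
rewrite big_seq_cond [X in _ <= X]big_seq_cond; apply: leq_sum => u.
rewrite mem_index_iota => /andP[/andP[_ un] _]; rewrite -MS; have := cap u un; nia.
Qed.

Lemma peelP n y C : (forall v, v < nv -> edeg es y v <= n) ->
  exists cols y', [/\ foldl (peel_step nv s es) (C, y) (rev (iota 1 n)) = (C ++ cols, y'),
    size cols = n,
    forall M, M \in cols -> forall v, v < nv -> \sum_(0 <= i < N) nth false M i * touch (ends es 1) v i <= 1 &
    forall i, i < N -> nth 0 y i = \sum_(M <- cols) nth false M i].
Proof.
elim: n y C => [|n IH] y C yn.
  exists [::], y; rewrite cats0; split=> // i iN; rewrite big_nil.
  have [_ _ l1 _] := esP (ends1P iN); have := yn _ l1.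
  by rewrite edegE (bigD1_seq i) ?mem_index_iota ?iota_uniq //= /touch eqxx muln1; lia.
have [sM My Mc Md] := peel1P yn; set M := peel1 _ _ _ _ _ in sM My Mc Md.
have -> : rev (iota 1 n.+1) = n.+1 :: rev (iota 1 n).
  by rewrite -{1}(addn1 n) iotaD rev_cat /= add1n.
set y1 := [seq nth 0 y i - nat_of_bool (nth false M i) | i <- iota 0 N].
have y1E i : i < N -> nth 0 y1 i = nth 0 y i - nth false M i.
  by move=> iN; rewrite (nth_map 0) ?size_iota // nth_iota.
have [|cols [y' [E sz c1 c2]]] := IH y1 (rcons C M).
  move=> v vn; apply: leq_trans (Md v vn); rewrite !edegE leq_subRL; last first.
    by apply: leq_sum_nat => i iN; rewrite leq_mul2r My ?orbT.
  rewrite -big_split /=; apply: leq_sum_nat => i iN.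
  by rewrite y1E // -mulnDl leq_mul2r subnKC ?leqnn ?orbT // My.
exists (M :: cols), y'; split.
- by rewrite /= {2}/peel_step E cat_rcons.
- by rewrite /= sz.
- by move=> M'; rewrite inE => /orP[/eqP->|/c1].
by move=> i iN; rewrite big_cons -c2 // y1E // subnKC // My.
Qed.

End Peel.

Lemma big_blocks (V : nmodType) N n (F : nat -> V) :
  (\sum_(0 <= k < N * n) F k = \sum_(0 <= i < N) \sum_(0 <= j < n) F (i * n + j)%N)%R.
Proof.
rewrite big_nat_mul; apply: eq_bigr => i _.
rewrite -{1}[(i * n)%N]add0n big_addn mulSn addnK.
by apply: eq_bigr => j _; rewrite addnC.
Qed.

Lemma big_prefix n r (c : nat -> int) : r <= n ->
  (\sum_(0 <= j < n) (j < r)%:Z * c j = \sum_(0 <= j < r) c j)%R.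
Proof.
move=> rn; rewrite (big_cat_nat (n := r)) //= [X in (_ + X)%R]big1_seq ?addr0.
  by apply: eq_big_nat => j /andP[_ ->]; rewrite mul1r.
by move=> j; rewrite mem_index_iota => /and3P[_ le _]; rewrite ltnNge le mul0r.
Qed.

Lemma sum_bool_le n (b : nat -> bool) : \sum_(0 <= j < n) nat_of_bool (b j) <= n.
Proof.
apply: (@leq_trans (\sum_(0 <= j < n) 1)); first by apply: leq_sum => j _; apply: leq_b1.
by rewrite sum_nat_const_nat muln1 subn0.
Qed.

Lemma sum_prefix n r : \sum_(0 <= j < n) nat_of_bool (j < r) = minn n r.
Proof.
elim: n => [|n IH]; first by rewrite big_geq ?min0n.
by rewrite big_nat_recr //= IH; lia.
Qed.

(** If the last copy is chosen, the number of copies chosen before it is at most its index, so by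
    monotonicity it earns no more than the first copy not yet in the prefix. *)
Lemma exchange n (b : nat -> bool) (c : nat -> int) :
  (forall j k, j <= k < n -> (c k <= c j)%R) ->
  (\sum_(0 <= j < n) (b j)%:Z * c j <= \sum_(0 <= j < \sum_(0 <= j < n) nat_of_bool (b j)) c j)%R.
Proof.
elim: n => [|n IH] cm; first by rewrite !big_geq.
rewrite !big_nat_recr //=.
have {}IH : (\sum_(0 <= j < n) (b j)%:Z * c j <= \sum_(0 <= j < \sum_(0 <= j < n) nat_of_bool (b j)) c j)%R.
  by apply: IH => j k /andP[jk kn]; apply: cm; rewrite jk leqW.
case: (b n); last by rewrite addn0 mul0r addr0.
rewrite addn1 big_nat_recr //= mul1r lerD //; apply: cm.
by rewrite sum_bool_le ltnSn.
Qed.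

Section FlowRows.
Context (nv : nat) (s : nat -> bool) (es : seq (nat * nat)) (n : nat) (cs : seq (word * word)).
Hypothesis esP : forall e, e \in es ->
  [/\ s e.1 = false, s e.2 = true, e.1 < nv & e.2 < nv].

Let N := size es.
Let y := flow_rows nv s es n cs.
Let c i j : int := zval (nth ([::], [::]) cs (i * n + j)).
Let co k : word * word := ((nth ([::], [::]) cs k).2, (nth ([::], [::]) cs k).1).
Let sel := selected (fun=> true) (circulation (network nv (N * n) n s (ends es n) co (fun=> true))).

Lemma flow_rowsE i : i < N -> nth 0 y i = \sum_(0 <= j < n) sel (i * n + j).
Proof.
move=> iN; rewrite /y /flow_rows (nth_map 0) ?size_iota // nth_iota // sumnE big_map.
by rewrite /index_iota subn0.
Qed.

Let es1 k : k < N * n -> s (ends es n k).1 = false /\ s (ends es n k).2 = true.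
Proof. by move=> /endsP/esP[]. Qed.
Let es2 k : k < N * n -> (ends es n k).1 < nv /\ (ends es n k).2 < nv.
Proof. by move=> /endsP/esP[]. Qed.

Lemma touch_block v i j : j < n -> touch (ends es n) v (i * n + j) = touch (ends es 1) v i.
Proof.
move=> jn; have e : (i * n + j) %/ n = i by rewrite divnMDl ?divn_small ?addn0 //; lia.
by rewrite /touch /ends e divn1.
Qed.

Lemma edeg_flow_rows v : v < nv -> edeg es y v <= n.
Proof.
move=> vn; have := sel_cap n co (fun=> true) es1 vn; rewrite -/sel -/N.
rewrite (big_blocks _ _ (fun k => sel k * touch (ends es n) v k)) => le.
rewrite edegE; apply: leq_trans le; apply: leq_sum_nat => i iN; rewrite flow_rowsE //.
rewrite big_distrl /=; apply: leq_sum_nat => j jn; by rewrite touch_block.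
Qed.

(** The first [r i] copies of every edge form a feasible choice, which earns at most as much as the
    circulation; [exchange] then moves the copies selected by the circulation to the front. *)
Lemma flow_rows_optimal (r : nat -> nat) :
  (forall i j k, i < N -> j <= k < n -> (c i k <= c i j)%R) ->
  (forall i, i < N -> r i <= n) ->
  (forall v, v < nv -> \sum_(0 <= i < N) r i * touch (ends es 1) v i <= n) ->
  (\sum_(0 <= i < N) \sum_(0 <= j < r i) c i j <= \sum_(0 <= i < N) \sum_(0 <= j < nth 0 y i) c i j)%R.
Proof.
move=> cm rn rd; pose z k : nat := k %% n < r (k %/ n).
have zE i j : j < n -> z (i * n + j) = (j < r i).
  by move=> jn; rewrite /z modnMDl modn_small // divnMDl ?divn_small ?addn0 //; lia.
have zd v : v < nv -> \sum_(0 <= k < N * n) z k * touch (ends es n) v k <= n * 1.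
  move=> vn; rewrite muln1 (big_blocks _ _ (fun k => z k * touch (ends es n) v k)).
  apply: leq_trans (rd v vn); apply: leq_sum_nat => i iN.
  rewrite (eq_big_nat _ _ (F2 := fun j => (j < r i) * touch (ends es 1) v i)); last first.
    by move=> j /andP[_ jn]; rewrite zE // touch_block.
  rewrite -big_distrl leq_mul2r /=; apply/orP; right.
  by rewrite sum_prefix geq_minr.
have zle k : k < N * n -> z k <= 1 by move=> _; apply: leq_b1.
have za k : k < N * n -> ~~ true -> z k = 0 by [].
have := sel_opt (m := n) (act := fun=> true) co es1 es2 zle za zd.
rewrite mul1r -/N -/sel (big_blocks N n (fun k => (sel k)%:Z * zval (co k))%R).
rewrite (big_blocks N n (fun k => (z k)%:Z * zval (co k))%R) => le.
have coE i j : zval (co (i * n + j)) = (- c i j)%R by rewrite /c /zval /co opprB.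
have R (w : nat -> nat) : (\sum_(0 <= i < N) \sum_(0 <= j < n) (w (i * n + j)%N)%:Z * zval (co (i * n + j)) =
    - \sum_(0 <= i < N) \sum_(0 <= j < n) (w (i * n + j)%N)%:Z * c i j)%R.
  by rewrite -sumrN; apply: eq_bigr => i _; rewrite -sumrN; apply: eq_bigr => j _; rewrite coE mulrN.
rewrite (R sel) (R z) lerN2 in le.
rewrite (eq_big_nat _ _ (F2 := fun i => \sum_(0 <= j < n) (z (i * n + j)%N)%:Z * c i j)%R); last first.
  move=> i /andP[_ iN]; rewrite -(big_prefix _ (rn i iN)).
  by apply: eq_big_nat => j /andP[_ jn]; rewrite zE.
apply: le_trans le _; rewrite !big_mkord; apply: ler_sum => i _.
rewrite flow_rowsE //; apply: (@exchange n (fun j => sel (i * n + j)) (c i)) => j k; exact: cm.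
Qed.

End FlowRows.

Definition icost (x : bool * word) : word * word := if x.1 then ([::], x.2) else (x.2, [::]).

(** [n] is recovered from the number of cost entries. It is given in binary, so if there are no
    edges it may be exponentially large; the quotient is then 0. *)
Definition solve (nv : nat) (es : seq (nat * nat)) (cs : seq (word * word)) : seq bool :=
  let T := sides nv es in
  let oes := [seq orient T e | e <- es] in
  let n := size cs %/ size es in
  let cols := peel nv (side T) oes (flow_rows nv (side T) oes n cs) n in
  flatten [seq [seq nth false M i | M <- cols] | i <- iota 0 (size es)].

Lemma nth_pairs S1 S2 S3 (f : S1 -> S2 -> S3) x0 y0 z0 s t i j : i < size s -> j < size t ->
  nth z0 [seq f x y | x <- s, y <- t] (i * size t + j) = f (nth x0 s i) (nth y0 t j).
Proof.
move=> + jt; elim: s i => [|x s IH] [|i] //= ile; rewrite nth_cat size_map.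
  by rewrite mul0n jt (nth_map y0).
by rewrite mulSn -addnA ltnNge leq_addr /= addKn IH.
Qed.

(** A sorted row of zeros and ones is determined by the number of ones, so the value of a solution
    depends only on how many of its columns use each edge. *)
Lemma shift_bool d n (b : 'I_d -> 'I_n -> bool) (x : 'M[int]_(d, n)) i j :
  (forall i j, x i j = Posz (b i j)) -> shift_mx x i j = Posz (j < \sum_k b i k).
Proof.
move=> xb; set r := \sum_k b i k; rewrite mxE.
pose bs := [seq b i k | k <- enum 'I_n].
have rE : r = count id bs.
  by rewrite -sum1_count big_map big_mkcond big_enum; apply: eq_bigr => k _ /=; case: (b i k).
have sb : size bs = n by rewrite size_map size_enum_ord.
have -> : [seq x i k | k <- enum 'I_n] = [seq Posz (nat_of_bool c) | c <- bs].
  by rewrite /bs -map_comp; apply/eq_map => k /=; rewrite xb.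
have tot : total (>=%O : rel int) by move=> a c; exact: ge_total.
have tr : transitive (>=%O : rel int) by exact: ge_trans.
have asy : antisymmetric (>=%O : rel int) by exact: ge_anti.
have -> : sort >=%O [seq Posz (nat_of_bool c) | c <- bs] =
    [seq Posz (nat_of_bool (k < r)) | k <- iota 0 n].
  apply: (sorted_eq tr asy); first exact: sort_sorted.
    rewrite sorted_map; apply: (@sub_sorted _ ltn) (iota_ltn_sorted 0 n) => k l kl /=.
    rewrite lez_nat; case: (ltnP l r) => // lr.
    by rewrite (ltn_trans kl lr).
  rewrite perm_sort.
  have -> : [seq Posz (nat_of_bool (k < r)) | k <- iota 0 n] =
      [seq Posz (nat_of_bool c) | c <- [seq k < r | k <- iota 0 n]] by rewrite -map_comp.
  apply: perm_map; apply/allP => c _ /=; apply/eqP.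
  have rn : r <= n by rewrite rE -sb count_size.
  have ct : count id [seq k < r | k <- iota 0 n] = r.
    rewrite count_map -(subnKC rn) iotaD count_cat.
    rewrite (eq_in_count (a2 := predT)); last by move=> k; rewrite mem_iota /=; lia.
    rewrite [X in _ + X](eq_in_count (a2 := pred0)); last by move=> k; rewrite mem_iota /=; lia.
    by rewrite count_predT count_pred0 size_iota addn0.
  have C (u : seq bool) : count (pred1 c) u = if c then count id u else size u - count id u.
    case: c; first by apply: eq_count => -[].
    rewrite -(count_predC id u) addKn; apply: eq_count => -[] //.
  by rewrite !C ct -rE sb size_map size_iota.
by rewrite (nth_map 0) ?size_iota // nth_iota.
Qed.

(** * Correctness of the algorithm for bipartite graphs *)

Section Correct.
Context (I : shift_inst).
Local Notation G := (si_graph I).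
Local Notation d := (ne G).
Local Notation n := (si_n I).
Local Notation c := (si_c I).
Hypothesis bip : bipartite G.
Hypothesis shc : shifted c.
Hypothesis d_gt0 : 0 < d.

Let es : seq (nat * nat) := [seq (val e.1, val e.2) | e <- edge G].
Let cs : seq (word * word) :=
  [seq icost ((c i j < 0)%R, bits `|c i j|%N) | i <- enum 'I_d, j <- enum 'I_n].
Let T := sides (nv G) es.
Let oes := [seq orient T e | e <- es].

Lemma size_edges : size es = d. Proof. by rewrite size_map size_tuple. Qed.
Lemma size_oes : size oes = d. Proof. by rewrite size_map size_edges. Qed.

Lemma size_costs : size cs = d * n.
Proof. by rewrite size_allpairs !size_enum_ord. Qed.

Lemma edges_lt_nv : all (fun e => (e.1 < nv G) && (e.2 < nv G)) es.
Proof. by apply/allP => _ /mapP[e _ ->] /=; rewrite !ltn_ord. Qed.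

Lemma edges_colored : exists col : nat -> bool, all (fun e => col e.1 != col e.2) es.
Proof.
have [sd sP] := bip; exists (fun v => if insub v is Some u then sd u else false).
apply/allP => _ /mapP[e /tnthP[i ->] ->] /=; rewrite !valK; exact: sP.
Qed.

Lemma oesP e : e \in oes -> [/\ side T e.1 = false, side T e.2 = true, e.1 < nv G & e.2 < nv G].
Proof.
by have [col colP] := edges_colored; move=> /mapP[e' ein ->]; apply: (orientP edges_lt_nv colP ein).
Qed.

Lemma touch_incident (v : 'I_(nv G)) (i : 'I_d) : touch (ends oes 1) v i = incident v i.
Proof.
have iN : i < size es by rewrite size_edges.
rewrite /touch /ends divn1 (nth_map (0, 0)) //.
rewrite (nth_map (tnth (edge G) i)) ?size_tuple // -tnth_nth /incident /orient -!val_eqE.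
by case: ifP => _ //=; rewrite orbC.
Qed.

Lemma cost_entry (i : 'I_d) (j : 'I_n) : zval (nth ([::], [::]) cs (i * n + j)) = c i j.
Proof.
have := @nth_pairs _ _ _ (fun i j => icost ((c i j < 0)%R, bits `|c i j|%N)) i j ([::], [::])
  (enum 'I_d) (enum 'I_n) i j.
rewrite !size_enum_ord !nth_ord_enum => -> //; rewrite /icost /zval /=.
by case: ifP => /= s; rewrite ?valw_bits; lia.
Qed.

Lemma cost_mono i j k : i < size oes -> j <= k < n ->
  (zval (nth ([::], [::]) cs (i * n + k)) <= zval (nth ([::], [::]) cs (i * n + j)))%R.
Proof.
rewrite size_oes => iN /andP[jk kn]; have jn := leq_ltn_trans jk kn.
have [_ mono] := (shift_mxP _ _).1 shc.
rewrite (cost_entry (Ordinal iN) (Ordinal kn)) (cost_entry (Ordinal iN) (Ordinal jn)).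
exact: mono.
Qed.

Lemma value_bool (b : 'I_d -> 'I_n -> bool) (x : 'M[int]_(d, n)) (r : nat -> nat) :
  (forall i j, x i j = Posz (b i j)) -> (forall i : 'I_d, r i = \sum_j b i j) ->
  mx_dot c (shift_mx x) =
    (\sum_(0 <= i < size oes) \sum_(0 <= j < r i) zval (nth ([::], [::]) cs (i * n + j)))%R.
Proof.
move=> xb rb; rewrite size_oes big_mkord; apply: eq_bigr => i _.
have rn : r i <= n.
  rewrite rb; apply: (@leq_trans (\sum_(j < n) 1)); first by apply: leq_sum => j _; apply: leq_b1.
  by rewrite sum_nat_const card_ord muln1.
rewrite -(big_prefix _ rn) big_mkord; apply: eq_bigr => j _.
by rewrite (shift_bool _ _ xb) -rb cost_entry mulrC.
Qed.

Let y := flow_rows (nv G) (side T) oes n cs.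

Lemma solve_optimal : exists2 x : sol (m := matching_shifting) I, optimal x &
  [seq x i j | i <- enum 'I_d, j <- enum 'I_n] = [seq Posz (nat_of_bool b) | b <- solve (nv G) es cs].
Proof.
have yn v : v < nv G -> edeg oes y v <= n by move=> vn; exact: (edeg_flow_rows n cs oesP vn).
have [cols [y' [E sz cm cy]]] := peelP oesP [::] yn.
pose b (i : 'I_d) (j : 'I_n) := nth false (nth [::] cols j) i.
pose x : 'M[int]_(d, n) := (\matrix_(i, j) Posz (b i j))%R.
have xb i j : x i j = Posz (b i j) by rewrite mxE.
have yb (i : 'I_d) : nth 0 y i = \sum_j b i j.
  rewrite cy ?size_oes // (big_nth [::]) sz big_mkord; exact: eq_bigr.
have nE : size cs %/ size es = n by rewrite size_costs size_edges mulKn.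
exists x; last first.
  rewrite /solve -/T -/oes nE -/y /peel E cat0s size_edges map_flatten -map_comp.
  congr flatten; rewrite -val_enum_ord -map_comp; apply: eq_map => i /=.
  rewrite -map_comp -[in RHS](mkseq_nth [::] cols) sz /mkseq -val_enum_ord -!map_comp.
  by apply: eq_map => j /=; rewrite xb.
have le1 (A : {set 'I_d}) (v : 'I_(nv G)) : matching A ->
    \sum_(i < d) nat_of_bool (i \in A) * nat_of_bool (incident v i) <= 1.
  move=> mA; rewrite (eq_bigr (fun i => nat_of_bool ((i \in A) && incident v i))); last first.
    by move=> i _; rewrite mulnb.
  rewrite -big_mkcond sum1_card; apply/card_le1_eqP => i j.
  move=> /andP[iA iv] /andP[jA jv]; apply/eqP; apply: contraTT isT => ij.
  by have := mA j i jA iA ij v; rewrite iv jv.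
split.
  move=> j; exists [set i | b i j]; last first.
    by apply/colP => i; rewrite !mxE inE; case: (b i j).
  move=> i k; rewrite !inE => ib kb ik v; apply/negP => /andP[iv kv].
  have := cm _ (mem_nth [::] (_ : j < size cols)) v (ltn_ord v).
  rewrite sz ltn_ord size_oes big_mkord => /(_ isT).
  rewrite (bigD1 i) //= (bigD1 k) 1?eq_sym //= !touch_incident iv kv.
  by rewrite -!/(b _ _) ib kb.
move=> z fz; pose bz (i : 'I_d) (j : 'I_n) := z i j == 1%R.
have bzP j : exists2 A : {set 'I_d}, matching A & forall i, bz i j = (i \in A) /\ z i j = Posz (bz i j).
  have [A mA eA] := fz j; exists A => // i; have /colP/(_ i) := eA; rewrite !mxE /bz => ->.
  by case: (i \in A).
pose r k : nat := if insub k is Some i then \sum_j bz i j else 0.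
have rE (i : 'I_d) : r i = \sum_j bz i j by rewrite /r valK.
have zb i j : z i j = Posz (bz i j) by have [A _ /(_ i)[_ ->]] := bzP j.
rewrite /value /= (value_bool zb rE) (value_bool xb yb).
apply: (flow_rows_optimal oesP cost_mono).
- move=> i; rewrite size_oes => iN; rewrite (rE (Ordinal iN)).
  apply: (@leq_trans (\sum_(j < n) 1)); first by apply: leq_sum => j _; apply: leq_b1.
  by rewrite sum_nat_const card_ord muln1.
move=> v vn; rewrite size_oes big_mkord.
rewrite (eq_bigr (fun i : 'I_d => \sum_j bz i j * incident (Ordinal vn) i)); last first.
  by move=> i _; rewrite rE big_distrl /= -touch_incident.
rewrite exchange_big /=; apply: (@leq_trans (\sum_(j < n) 1)).
  apply: leq_sum => j _; have [A mA AP] := bzP j.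
  rewrite (eq_bigr (fun i => nat_of_bool (i \in A) * nat_of_bool (incident (Ordinal vn) i))).
    exact: le1.
  by move=> i _; rewrite (AP i).1.
by rewrite sum_nat_const card_ord muln1.
Qed.

End Correct.

(** * Running time of the algorithm for bipartite graphs *)

#[export] Instance fp_nat_of_bool : FP1 nat_of_bool.
Proof. by apply: (@FP_ext _ _ _ _ (fun b : bool => if b then 1 else 0)); [case | fp]. Qed.

#[export] Instance fp_side : FP2 side.
Proof. by rewrite /FP2 /side; fp. Qed.

#[export] Instance fp_side_step : FP2 side_step.
Proof. by rewrite /FP2 /side_step; fp. Qed.

#[export] Instance fp_sides : FP2 sides.
Proof.
apply: (@FP_foldl _ _ _ _ _ _ (fun _ => side_step)); fp.
pose q m := m * (m + m + 10) + 1.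
have [k kP] : pbounded q by rewrite /q; pbd.
exists k => -[nv es] i /=; apply: leq_trans (kP _).
set T0 := [seq (i, false) | i <- iota 0 nv].
have main (r : seq (nat * nat)) T : size T = nv -> all (fun x => x.1 <= nv) T ->
    size (foldl side_step T r) = nv /\ all (fun x => x.1 <= nv) (foldl side_step T r).
  elim: r T => [|e r IH] T sT aT //=; apply: IH; rewrite /side_step; case: ifP => // _.
    by rewrite size_map.
  have h j : (nth (0, false) T j).1 <= nv.
    case: (ltnP j (size T)) => jT; first by have /allP/(_ _ (mem_nth (0, false) jT)) := aT.
    by rewrite nth_default.
  apply/allP => _ /mapP[x xT ->]; case: ifP => _; [exact: h | exact: (allP aT)].
have [||s1 a1] := main (take i es) T0.
- by rewrite size_map size_iota.
- by apply/allP => _ /mapP[j jn ->] /=; move: jn; rewrite mem_iota; lia.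
have h : tsz (foldl side_step T0 (take i es)) <=
    size (foldl side_step T0 (take i es)) * (nv.*2 + 5).+1 + 1.
  apply: tsz_seq_le => -[c b] /(allP a1) /= cn; rewrite tsz_pair tsz_nat.
  by have := tsz_bool b; lia.
apply: leq_trans h _; rewrite s1 /q tsz_pair tsz_nat leq_add2r.
by apply: leq_mul; lia.
Qed.

#[export] Instance fp_orient : FP2 orient.
Proof. by rewrite /FP2 /orient; fp. Qed.

#[export] Instance fp_ends : FP3 ends.
Proof. by rewrite /FP3 /ends; fp. Qed.

#[export] Instance fp_edeg : FP3 edeg.
Proof. by rewrite /FP3 /edeg /touch; fp. Qed.

(** The side function is represented by its table, because arguments have to be encodable data. *)
Definition flow_rows_t (q : nat * (seq (nat * bool) * (seq (nat * nat) * (nat * seq (word * word))))) :=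
  flow_rows q.1 (side q.2.1) q.2.2.1 q.2.2.2.1 q.2.2.2.2.

#[export] Instance fp_flow_rows : FP1 flow_rows_t.
Proof. by rewrite /FP1 /flow_rows_t /flow_rows /network /earc /narc /selected /aid /afl; fp. Qed.

Definition peel1_t (q : nat * (seq (nat * bool) * (seq (nat * nat) * (seq nat * nat)))) :=
  peel1 q.1 (side q.2.1) q.2.2.1 q.2.2.2.1 q.2.2.2.2.

#[export] Instance fp_peel1 : FP1 peel1_t.
Proof. by rewrite /FP1 /peel1_t /peel1 /network /earc /narc /selected /aid /afl; fp. Qed.

Definition peel_t (q : nat * (seq (nat * bool) * (seq (nat * nat) * (seq nat * nat)))) :=
  peel q.1 (side q.2.1) q.2.2.1 q.2.2.2.1 q.2.2.2.2.

#[export] Instance fp_peel : FP1 peel_t.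
Proof.
rewrite /FP1 /peel_t /peel.
apply (FP_fst (f := fun q : nat * (seq (nat * bool) * (seq (nat * nat) * (seq nat * nat))) =>
  foldl (peel_step q.1 (side q.2.1) q.2.2.1) ([::], q.2.2.2.1) (rev (iota 1 q.2.2.2.2)))).
apply: (@FP_foldl _ _ _ _ _ _
  (fun (q : nat * (seq (nat * bool) * (seq (nat * nat) * (seq nat * nat)))) (c : seq (seq bool) * seq nat) k =>
   peel_step q.1 (side q.2.1) q.2.2.1 c k)); last 1 first.
- pose B m := m + m * (m + m + 1).+1 + 1.
  pose p m := 1 + m * (m * 4 + 2) + B m + 1.
  have [k kP] : pbounded p by rewrite /p /B; pbd.
  exists k => -[nv [T [es [y n]]]] i /=; apply: leq_trans (kP _).
  set m := tsz (nv, _).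
  have [ym em nm] : [/\ tsz y <= m, size es <= m & n <= m].
    have he : (size es).*2 < tsz es by exact: size_tsz.
    by rewrite /m !tsz_pair !tsz_nat; split; lia.
  have main (r : seq nat) C y' b : tsz C <= 1 + b * (m * 4 + 2) -> tsz y' <= B m ->
      (forall j, nth 0 y' j <= m) -> let c := foldl (peel_step nv (side T) es) (C, y') r in
      tsz c.1 <= 1 + (b + size r) * (m * 4 + 2) /\ tsz c.2 <= B m.
    elim: r C y' b => [|e r IH] C y' b hC hy hj /=; first by rewrite addn0.
    rewrite addnS -addSn; apply: IH => /=.
    - set M := peel1 _ _ _ _ _; have hM : tsz M <= size M * 4 + 1.
        by apply: tsz_seq_le => x _; exact: tsz_bool.
      rewrite tsz_rcons; rewrite size_map size_iota in hM.
      by rewrite mulSn /=; move: hC; set X := b * _ => hC; lia.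
    - apply: (@leq_trans (size es * (m + m + 1).+1 + 1)).
        rewrite -{2}(size_iota 0 (size es)) -[X in X * _](size_map (fun i => nth 0 y' i - nat_of_bool (nth false
          (peel1 nv (side T) es y' e) i))).
        apply: tsz_seq_le => _ /mapP[j _ ->]; rewrite tsz_nat; have := hj j; lia.
      by rewrite /B leq_add2r; apply: leq_trans (leq_addl _ _); rewrite leq_mul2r em orbT.
    - move=> j; case: (ltnP j (size es)) => js; last by rewrite nth_default // size_map size_iota.
      by rewrite (nth_map 0) ?size_iota // nth_iota // (leq_trans (leq_subr _ _)).
  have [|||h1 h2] := main (take i (rev (iota 1 n))) [::] y 0.
  - by rewrite tsz_nil.
  - by rewrite /B; apply: leq_trans ym _; rewrite -addnA leq_addr.
  - move=> j; case: (ltnP j (size y)) => jy; last by rewrite nth_default.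
    have h : @tsz nat enc_unat (nth 0 y j) <= tsz y by exact: (tsz_in _ (mem_nth 0 jy)).
    by rewrite tsz_nat in h; lia.
  move: h1 h2; case: (foldl _ _ _) => C y' /= h1 h2; rewrite tsz_pair /p addn1 ltnS leq_add //.
  apply: leq_trans h1 _; rewrite leq_add2l leq_mul2r; apply/orP; right.
  rewrite size_take size_rev size_iota; case: ifP => // h; lia.
- apply: (@FP_ext _ _ _ _ (fun p : (nat * (seq (nat * bool) * (seq (nat * nat) * (seq nat * nat)))) *
      ((seq (seq bool) * seq nat) * nat) =>
    let M := peel1_t (p.1.1, (p.1.2.1, (p.1.2.2.1, (p.2.1.2, p.2.2)))) in
    (rcons p.2.1.1 M, [seq nth 0 p.2.1.2 i - nat_of_bool (nth false M i) | i <- iota 0 (size p.1.2.2.1)]))).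
    by [].
  by cbv zeta; fp.
- by fp.
by fp.
Qed.

#[export] Instance fp_icost : FP1 icost.
Proof. by rewrite /FP1 /icost; fp. Qed.

#[export] Instance fp_solve : FP3 solve.
Proof.
apply: (@FP_ext _ _ _ _ (fun p : nat * (seq (nat * nat) * seq (word * word)) =>
  let T := sides p.1 p.2.1 in
  let oes := [seq orient T e | e <- p.2.1] in
  let n := size p.2.2 %/ size p.2.1 in
  let cols := peel_t (p.1, (T, (oes, (flow_rows_t (p.1, (T, (oes, (n, p.2.2)))), n)))) in
  flatten [seq [seq nth false M i | M <- cols] | i <- iota 0 (size p.2.1)])) => [|]; first by [].
by cbv zeta; fp.
Qed.

(** * Parsing *)

(** The flag records the end of the list. A list has fewer entries than its code has bits, so
    [size w] rounds suffice, and rounds after the end change nothing. *)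
Definition pstep (B : Type) (p : word -> B * word) (c : bool * (seq B * word)) :
    bool * (seq B * word) :=
  if c.1 then c else scase c.2.2 (true, c.2) (fun b r =>
    if b then (false, (rcons c.2.1 (p r).1, (p r).2)) else (true, (c.2.1, r))).
(* Inverse of enc_seq, given an inverse p of the encoding of the entries. *)
Definition pseq (B : Type) (p : word -> B * word) (w : word) : seq B * word :=
  (iter (size w) (pstep p) (false, ([::], w))).2.

Lemma pseqE (A B : Type) (p : word -> B * word) (enc : A -> word) (g : A -> B) s r :
  (forall x r, p (enc x ++ r) = (g x, r)) -> pseq p (enc_seq enc s ++ r) = (map g s, r).
Proof.
move=> pE; rewrite /pseq.
have main k out : size s < k ->
    iter k (pstep p) (false, (out, enc_seq enc s ++ r)) = (true, (out ++ map g s, r)).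
  elim: s k out => [|x s IH] [|k] out //= lt.
    rewrite -iterS iterSr {2}/pstep /= cats0.
    by elim: k {lt} => //= k ->.
  rewrite -iterS iterSr {2}/pstep /= -!catA pE /=.
  rewrite [X in iter k _ X](_ : _ = (false, (rcons out (g x), enc_seq enc s ++ r))); last first.
    by rewrite /enc_seq -catA.
  by rewrite IH // cat_rcons.
rewrite main ?cat0s // !size_cat /=.
have : size s <= size (flatten [seq true :: enc x | x <- s]).
  by elim: s {main} => //= x s IH; rewrite size_cat; lia.
lia.
Qed.

(** The tree of the marker [true] before an entry has size 3; its removal pays for what the parsed
    entry takes beyond the bits that it was read from. *)
Lemma pseq_tsz (B : Type) (EB : Enc B) (p : word -> B * word) :
  (forall r, tsz (p r).1 + tsz (p r).2 <= tsz r + 3) -> forall w i,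
  let c := iter i (pstep p) (false, ([::], w)) in tsz c.2.1 + tsz c.2.2 <= tsz w + 1.
Proof.
move=> pt w; elim=> [|i IH] /=; first by rewrite tsz_nil addnC.
move: IH; case: (iter _ _ _) => [[] [out [|[] r]]] //=; rewrite /pstep /= ?tsz_cons ?tsz_true => h.
  by rewrite tsz_rcons; have := pt r; lia.
by apply: leq_trans h; rewrite leq_add2l; lia.
Qed.

Lemma FP_pseq (B : Type) (EB : Enc B) (p : word -> B * word) :
  (forall r, tsz (p r).1 + tsz (p r).2 <= tsz r + 3) -> FP p -> FP (pseq p).
Proof.
move=> pt Fp; have ? : FP1 p := Fp.
apply (FP_snd (f := fun w : word => iter (size w) (pstep p) (false, ([::], w)))).
apply: (@FP_iter _ _ _ _ _ (fun _ => pstep p)); rewrite ?/pstep; fp.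
pose q m := m + 1 + 1 + 3 + 1; have [k kP] : pbounded q by rewrite /q; pbd.
exists k => w i _; apply: leq_trans (kP _).
have := pseq_tsz pt w i; case: (iter _ _ _) => b [out r] /= h.
by rewrite !tsz_pair /q; have := tsz_bool b; lia.
Qed.

(** Words and unary numbers are also coded as by [enc_seq], with entries of one bit and empty
    entries; one parser scheme serves all encodings. *)
Definition pbit (r : word) : bool * word := (head false r, behead r).
Definition pword : word -> word * word := pseq pbit.
Definition punary : word -> seq unit * word := pseq (fun r => (tt, r)).
Definition pedge (r : word) : (word * word) * word :=
  (((pword r).1, (pword (pword r).2).1), (pword (pword r).2).2).
Definition pint (r : word) : (bool * word) * word :=
  ((head false r, (pword (behead r)).1), (pword (behead r)).2).

Lemma pbit_tsz r : tsz (pbit r).1 + tsz (pbit r).2 <= tsz r + 1.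
Proof. by case: r => [|b r] //; rewrite tsz_cons /=; lia. Qed.

Lemma pword_tsz r : tsz (pword r).1 + tsz (pword r).2 <= tsz r + 1.
Proof.
apply: (@pseq_tsz _ _ pbit); move=> u; apply: leq_trans (pbit_tsz u) _.
by rewrite leq_add2l.
Qed.

#[export] Instance fp_pword : FP1 pword.
Proof.
apply: FP_pseq => [u|]; first by apply: leq_trans (pbit_tsz u) _; rewrite leq_add2l.
by rewrite /pbit; fp.
Qed.

#[export] Instance fp_punary : FP1 punary.
Proof. by apply: FP_pseq => [u|]; [rewrite /= addnC leq_add2l | fp]. Qed.

#[export] Instance fp_pedges : FP1 (pseq pedge).
Proof.
apply: FP_pseq => [u|]; last by rewrite /pedge; fp.
by rewrite /pedge /= tsz_pair; have := pword_tsz u; have := pword_tsz (pword u).2; lia.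
Qed.

#[export] Instance fp_pints : FP1 (pseq pint).
Proof.
apply: FP_pseq => [u|]; last by rewrite /pint; fp.
rewrite /pint /= tsz_pair; have := pword_tsz (behead u).
by have := pbit_tsz u; rewrite /pbit /=; lia.
Qed.

(* Bounded, so that the result has polynomial size in unary. *)
Definition natw (B : nat) (w : word) : nat :=
  foldl (fun c (b : bool) => minn (b + c.*2) B) 0 (rev w).

Lemma natwE B w : natw B w = minn (valw w) B.
Proof. by rewrite /natw foldl_rev; elim: w => [|b w IH] /=; rewrite ?min0n // IH; lia. Qed.

#[export] Instance fp_minn : FP2 minn.
Proof. by rewrite /FP2 /minn; fp. Qed.

#[export] Instance fp_double : FP1 double.
Proof. by apply: (@FP_ext _ _ _ _ (fun n => n + n)) => [n|]; rewrite ?addnn //; fp. Qed.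

#[export] Instance fp_natw : FP2 natw.
Proof.
apply: (@FP_foldl _ _ _ _ _ _ (fun (p : nat * word) c (b : bool) => minn (b + c.*2) p.1)); fp.
exists 1 => -[B w] i /=; rewrite tsz_pair !tsz_nat /poly_bound mul1n expn1.
have le (u : word) c : c <= B -> foldl (fun c (b : bool) => minn (b + c.*2) B) c u <= B.
  by elim: u c => //= b u IH c _; apply: IH; apply: geq_minr.
by have := le (take i (rev w)) 0 isT; lia.
Qed.

Definition parse (w : word) : nat * (seq (word * word) * seq (bool * word)) :=
  let q1 := punary w in let q2 := pseq pedge q1.2 in let q3 := pword q2.2 in
  (size q1.1, (q2.1, (pseq pint q3.2).1)).

Definition solve_word (w : word) : word :=
  let i := parse w in
  enc_seq (fun b : bool => false :: enc_nat b)
    (solve i.1 [seq (natw i.1 e.1, natw i.1 e.2) | e <- i.2.1] [seq icost x | x <- i.2.2]).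

#[export] Instance fp_solve_word : FP1 solve_word.
Proof.
have ? : FP1 parse by rewrite /FP1 /parse; fp.
rewrite /FP1 /solve_word.
by apply: (@FP_enc_seq _ _ _ _ (fun _ (b : bool) => false :: enc_nat b)); cbv zeta; fp.
Qed.

Lemma pword_enc w r : pword (enc_word w ++ r) = (w, r).
Proof.
rewrite -[enc_word w]/(enc_seq (fun b => [:: b]) w) /pword (@pseqE _ _ _ _ id) ?map_id //.
Qed.

Lemma map_pairs S1 S2 S3 S4 (h : S3 -> S4) (f : S1 -> S2 -> S3) s t :
  map h [seq f x y | x <- s, y <- t] = [seq h (f x y) | x <- s, y <- t].
Proof. by elim: s => //= x s IH; rewrite map_cat IH -map_comp. Qed.

Lemma parse_enc (I : shift_inst) : parse (enc_shift_inst I) =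
  (nv (si_graph I), ([seq (bits (val e.1), bits (val e.2)) | e <- edge (si_graph I)],
    [seq ((si_c I i j < 0)%R, bits `|si_c I i j|%N) | i <- enum 'I_(ne (si_graph I)), j <- enum 'I_(si_n I)])).
Proof.
rewrite /parse /enc_shift_inst; set G := si_graph I.
have -> r : punary (enc_unary (nv G) ++ r) = (nseq (nv G) tt, r).
  have -> : enc_unary (nv G) = enc_seq (fun _ : unit => [::]) (nseq (nv G) tt).
    by rewrite /enc_unary /enc_seq; congr (_ ++ _); elim: (nv G) => //= k ->.
  by rewrite /punary (@pseqE _ _ _ _ id) ?map_id // => -[].
rewrite size_nseq /=.
have E r : pseq pedge (enc_seq (fun e : 'I_(nv G) * 'I_(nv G) => enc_nat e.1 ++ enc_nat e.2) (edge G) ++ r) =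
    ([seq (bits (val e.1), bits (val e.2)) | e <- edge G], r).
  apply: (pseqE (g := fun e : 'I_(nv G) * 'I_(nv G) => (bits (val e.1), bits (val e.2)))) => x u.
  by rewrite /pedge -catA !pword_enc.
rewrite E pword_enc /= -[enc_mx _]cats0 /enc_mx.
rewrite (@pseqE _ _ _ _ (fun z : int => ((z < 0)%R, bits `|z|%N))) ?map_pairs // => x u.
by rewrite /pint /= pword_enc.
Qed.

Lemma solve_word_correct (I : shift_inst) : bipartite (si_graph I) -> shifted (si_c I) ->
  exists2 x : sol (m := matching_shifting) I, optimal x &
    solve_word (enc_shift_inst I) = enc_sol x.
Proof.
move=> bip shc; set d := ne (si_graph I).
have O (x : 'M[int]_(d, si_n I)) (bs : seq bool) :
    [seq x i j | i <- enum 'I_d, j <- enum 'I_(si_n I)] = [seq Posz (nat_of_bool b) | b <- bs] ->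
    enc_seq (fun b : bool => false :: enc_nat b) bs = enc_mx x.
  by rewrite /enc_mx => ->; rewrite /enc_seq -map_comp.
rewrite /solve_word parse_enc /= -map_comp map_pairs.
have -> : [seq (natw (nv (si_graph I)) (bits (val e.1)), natw (nv (si_graph I)) (bits (val e.2))) | e <- edge (si_graph I)] =
    [seq (val e.1, val e.2) | e <- edge (si_graph I)].
  apply: eq_map => e /=; rewrite !natwE !valw_bits.
  by congr (_, _); apply/minn_idPl/ltnW.
(* Without edges the matrix has no rows, so for every [n] its code is that of the empty list. *)
case: (posnP d) => [d0|dgt0]; last first.
  by have [x xopt xE] := solve_optimal bip shc dgt0; exists x => //; apply: O.
have e0 : enum 'I_d = [::] by apply: size0nil; rewrite size_enum_ord.
exists (0%R : 'M[int]_(d, si_n I)); last first.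
  apply: O; rewrite e0 [X in solve _ X _]size0nil //.
  by rewrite size_map size_tuple.
have no (i : 'I_d) : False by have := ltn_ord i; rewrite [X in _ < X]d0.
split=> [j|y _]; last by rewrite /value /= /mx_dot !big1 // => i; case: (no i).
by exists set0 => [i|]; [case: (no i) | apply/colP => i; case: (no i)].
Qed.

Lemma bipartite_solvable : polytime_solvable (Q := matching_shifting)
  (fun I : shift_inst => bipartite (si_graph I) /\ shifted (si_c I)).
Proof.
have [M [k MP]] := FP_polytime fp_solve_word.
exists M, k => I [bip shc]; have [x xopt xE] := solve_word_correct bip shc.
by exists x => //; rewrite -xE; apply: MP.
Qed.

Theorem theorem2p2 :
  [/\ polytime_solvable (Q := matching_shifting)
        (fun I : shift_inst => bipartite (si_graph I) /\ shifted (si_c I)),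
      NP_hard_max (Q := matching_shifting)
        (fun I : shift_inst =>
           [/\ cubic (si_graph I), shifted (si_c I) & si_n I = 2]) &
      NP_hard_max (Q := matching_shifting)
        (fun I : shift_inst => bipartite (si_graph I) /\ si_n I = 2)].
Proof. by split; [exact: bipartite_solvable | exact: cubic_hard | exact: bipartite_hard]. Qed.
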